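(* Let $m\ge 0$. (i) Let $a,b,k>0$ satisfy $ab=k^2$. If $a\ge 9k$ or $a\le \frac{k}{9}$, then $\lambda_1(a,b)\ge\lambda_1(k,k)$. (ii) Let $b,k>0$ and $a\in(0,(2+\sqrt2)k)$ satisfy $a+b+\sqrt{a^2+b^2}=(2+\sqrt2)k$. If $a\ge 3.5\,k$ or $a\le\frac{k}{9}$, then $\lambda_1(a,b)\ge\lambda_1(k,k)$.
   Context: For $a,b>0$ let $\Omega_{a,b}\subset\mathbb{R}^2$ be the open right triangle with vertices $O=(0,0)$, $A=(a,0)$, $B=(0,b)$. For $m\ge 0$, let $T_{a,b}$ be the operator in $L^2(\Omega_{a,b};\mathbb{C}^2)$ acting as $$T_{a,b}=\begin{pmatrix} m & -i(\partial_1-i\partial_2)\\ -i(\partial_1+i\partial_2) & -m\end{pmatrix}$$ with domain $$\mathsf{D}(T_{a,b})=\{\psi=(\psi_1,\psi_2)^\top\in W^{1,2}(\Omega_{a,b};\mathbb{C}^2):\ \psi_2=i(n_1+in_2)\psi_1 \text{ on }\partial\Omega_{a,b}\},$$ where $n=(n_1,n_2)$ is the outward unit normal and the boundary condition is in the sense of traces. The operator $T_{a,b}$ is self-adjoint with compact resolvent and its spectrum is symmetric with respect to zero. $\lambda_1(a,b)$ denotes its lowest positive eigenvalue (for the given $m$, the same $m$ on both sides of each inequality); it is characterised by $\lambda_1(a,b)^2=\inf_{0\ne\psi\in\mathsf{D}(T_{a,b})}\|T_{a,b}\psi\|^2/\|\psi\|^2$, where norms are those of $L^2(\Omega_{a,b};\mathbb{C}^2)$.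 *)

(* Defs.v *)
From HB Require Import structures.
From mathcomp Require Import all_boot all_order all_algebra.
From mathcomp Require Import complex.
From mathcomp Require Import all_classical all_reals all_analysis.

Set Implicit Arguments.
Unset Strict Implicit.
Unset Printing Implicit Defensive.

Import Order.TTheory GRing.Theory Num.Theory.
Import numFieldNormedType.Exports.

Local Open Scope classical_set_scope.
Local Open Scope ring_scope.
Local Open Scope complex_scope.

Section DiracTriangle.
Context {R : realType}.

Definition tri (a b : R) : set (R * R) :=
  [set x | [/\ 0 < x.1, 0 < x.2 & x.1 / a + x.2 / b < 1]].

Definition leb2 : {measure set (measurableTypeR R * measurableTypeR R) -> \bar R} :=
  (@lebesgue_measure R \x @lebesgue_measure R)%E.

Definition sqmod (z : R[i]) : R := complex.Re z ^+ 2 + complex.Im z ^+ 2.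

(* Functions are total on R^2 and are meant up to equality almost everywhere
   on the domain [U]; values off [U] are irrelevant. *)
Definition inL2 (U : set (R * R)) (u : R * R -> R[i]) : Prop :=
  [/\ measurable_fun (U : set (measurableTypeR R * measurableTypeR R))
        (fun x => complex.Re (u x)),
      measurable_fun (U : set (measurableTypeR R * measurableTypeR R))
        (fun x => complex.Im (u x)) &
      (\int[leb2]_(x in U) (sqmod (u x))%:E < +oo)%E].

Definition normL2sq (U : set (R * R)) (u : R * R -> R[i]) : R :=
  \int[leb2]_(x in U) sqmod (u x).

(* The coordinate directions: [false] is x_1, [true] is x_2. *)
Definition dir (j : bool) : R * R := if j then (0, 1) else (1, 0).

Fixpoint Ck (k : nat) (f : R * R -> R) : Prop :=
  continuous f /\
  match k with
  | 0 => True
  | k'.+1 => forall j, (forall x, derivable f x (dir j)) /\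
                       Ck k' (fun x => 'D_(dir j) f x)
  end.

Definition test_function (U : set (R * R)) (phi : R * R -> R) : Prop :=
  (forall k, Ck k phi) /\
  exists K : set (R * R), [/\ compact K, K `<=` U & forall x, ~ K x -> phi x = 0].

Definition real_weak_deriv (U : set (R * R)) (j : bool) (u w : R * R -> R) : Prop :=
  forall phi, test_function U phi ->
    \int[leb2]_(x in U) (u x * 'D_(dir j) phi x) =
    - \int[leb2]_(x in U) (w x * phi x).

Definition weak_deriv (U : set (R * R)) (j : bool) (u w : R * R -> R[i]) : Prop :=
  [/\ inL2 U w,
      real_weak_deriv U j (fun x => complex.Re (u x)) (fun x => complex.Re (w x)) &
      real_weak_deriv U j (fun x => complex.Im (u x)) (fun x => complex.Im (w x))].

Definition W12 (U : set (R * R)) (u : R * R -> R[i]) : Prop :=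
  inL2 U u /\ forall j, exists w, weak_deriv U j u w.

(* A representative of the weak derivative, unique up to a null set
   when it exists. *)
Definition wderiv (U : set (R * R)) (j : bool) (u : R * R -> R[i]) : R * R -> R[i] :=
  xget (fun=> 0) [set w | weak_deriv U j u w].

Definition cC1 (u : R * R -> R[i]) : Prop :=
  Ck 1 (fun x => complex.Re (u x)) /\ Ck 1 (fun x => complex.Im (u x)).

Definition cderiv (j : bool) (u : R * R -> R[i]) (x : R * R) : R[i] :=
  'D_(dir j) (fun y => complex.Re (u y)) x +i*
  'D_(dir j) (fun y => complex.Im (u y)) x.

Inductive side := OA | OB | AB.
Definition sides : seq side := [:: OA; OB; AB].

Definition param (a b : R) (s : side) (t : R) : R * R :=
  match s with
  | OA => (t * a, 0)
  | OB => (0, t * b)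
  | AB => ((1 - t) * a, t * b)
  end.

Definition side_length (a b : R) (s : side) : R :=
  match s with
  | OA => a
  | OB => b
  | AB => Num.sqrt (a ^+ 2 + b ^+ 2)
  end.

Definition outward_normal (a b : R) (s : side) : R * R :=
  match s with
  | OA => (0, -1)
  | OB => (-1, 0)
  | AB => (b / Num.sqrt (a ^+ 2 + b ^+ 2), a / Num.sqrt (a ^+ 2 + b ^+ 2))
  end.

Definition inL2_bd (a b : R) (g : R * R -> R[i]) : Prop :=
  forall s,
  [/\ measurable_fun (`[0, 1] : set (measurableTypeR R))
        (fun t => complex.Re (g (param a b s t))),
      measurable_fun (`[0, 1] : set (measurableTypeR R))
        (fun t => complex.Im (g (param a b s t))) &
      (\int[@lebesgue_measure R]_(t in `[0%R, 1%R])
         (sqmod (g (param a b s t)))%:E < +oo)%E].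

(* The integral with respect to arc length on each side. *)
Definition normL2sq_bd (a b : R) (g : R * R -> R[i]) : R :=
  \sum_(s <- sides)
    side_length a b s * \int[@lebesgue_measure R]_(t in `[0, 1]) sqmod (g (param a b s t)).

(* The trace operator is the continuous extension from W^{1,2} to L^2 of the
   boundary, of the restriction map on functions that are C^1 up to the
   boundary (these are dense in W^{1,2} of a triangle). *)
Definition is_trace (a b : R) (u g : R * R -> R[i]) : Prop :=
  inL2_bd a b g /\
  exists un : nat -> R * R -> R[i],
  [/\ forall n, cC1 (un n),
      normL2sq (tri a b) (un n - u) @[n --> \oo] --> (0 : R),
      forall j, normL2sq (tri a b) (cderiv j (un n) - wderiv (tri a b) j u)
                  @[n --> \oo] --> (0 : R) &
      normL2sq_bd a b (un n - g) @[n --> \oo] --> (0 : R)].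

Definition spinor := ((R * R -> R[i]) * (R * R -> R[i]))%type.

Definition spinor_normsq (a b : R) (psi : spinor) : R :=
  normL2sq (tri a b) psi.1 + normL2sq (tri a b) psi.2.

Definition dirac_domain (a b : R) (psi : spinor) : Prop :=
  [/\ W12 (tri a b) psi.1, W12 (tri a b) psi.2 &
      exists g1 g2, [/\ is_trace a b psi.1 g1, is_trace a b psi.2 g2 &
        forall s, {ae @lebesgue_measure R, forall t : R, t \in `[0, 1] ->
          let n := outward_normal a b s in
          g2 (param a b s t) =
            'i * (n.1%:C + 'i * n.2%:C) * g1 (param a b s t)}]].

Definition dirac_op (m a b : R) (psi : spinor) : spinor :=
  let d1 := wderiv (tri a b) false in
  let d2 := wderiv (tri a b) true in
  (fun x => m%:C * psi.1 x - 'i * (d1 psi.2 x - 'i * d2 psi.2 x),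
   fun x => - 'i * (d1 psi.1 x + 'i * d2 psi.1 x) - m%:C * psi.2 x).

(* [spinor_normsq] vanishes exactly on the spinors of the domain that are zero
   almost everywhere. *)
Definition eigenvalue_dirac (m a b l : R) : Prop :=
  exists psi, [/\ dirac_domain a b psi, spinor_normsq a b psi != 0 &
    {ae leb2, forall x, tri a b x ->
      (dirac_op m a b psi).1 x = l%:C * psi.1 x /\
      (dirac_op m a b psi).2 x = l%:C * psi.2 x}].

Definition lowest_positive_eigenvalue (m a b l : R) : Prop :=
  [/\ 0 < l, eigenvalue_dirac m a b l &
      forall l', 0 < l' -> eigenvalue_dirac m a b l' -> l <= l'].

Definition rayleigh_quotients (m a b : R) : set R :=
  [set q | exists psi, [/\ dirac_domain a b psi, spinor_normsq a b psi != 0 &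
     q = spinor_normsq a b (dirac_op m a b psi) / spinor_normsq a b psi]].

End DiracTriangle.

(* Main.v *)
From mathcomp Require Import all_boot all_order all_algebra.
From mathcomp Require Import complex ring lra.
From mathcomp Require Import all_classical all_reals all_analysis measurable_realfun.
Require Import Defs.

Set Implicit Arguments.
Unset Strict Implicit.
Unset Printing Implicit Defensive.

Import Order.TTheory GRing.Theory Num.Theory.
Import numFieldNormedType.Exports.

Local Open Scope classical_set_scope.
Local Open Scope ring_scope.

(** Both parts compare two explicit bounds.  If one leg of the triangle has
    length [s] and the other one is at least [9 * s], then every spinor of the
    domain satisfies

      |T psi|^2 >= (m^2 + (544/475) / s^2) |psi|^2,

    while a single trial spinor on the isosceles triangle gives

      lambda1(k,k)^2 <= m^2 + 5 pi^2 / k^2 <= m^2 + 80 / k^2.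

    Each of the constraints on [a], [b], [k] with [a <= k / 9] or [9 k <= a]
    makes the short leg [s <= k / 9] and the other leg at least [9 * s], and
    81 * 544 / 475 > 80.  In the perimeter case [7 k / 2 <= a] is vacuous: the
    hypotenuse is at least [a], so the perimeter would exceed [(2 + sqrt 2) k].

    Upper bound.  On the triangle with legs [k] the function
    [sin(pi x/k) sin(2 pi y/k) + sin(2 pi x/k) sin(pi y/k)] vanishes on the
    boundary and is an eigenfunction of the Dirichlet Laplacian for
    [5 pi^2 / k^2]; the spinor with this first component and second component
    0 satisfies the boundary condition ([trial_quotient]).  As [wderiv] is a
    representative chosen among all weak derivatives, this needs their
    uniqueness up to null sets ([weak_deriv_unique]), which is obtained by
    testing against smooth bumps that increase to the indicators of open
    boxes, and then passing from boxes to Borel sets.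

    Lower bound.  Write [psi] in real components, [u1 + i u2] and [v1 + i v2],
    and let [jac f g] be the Jacobian determinant of [(f, g)].  Expanding the
    square ([sqmod_dirac]),

      |T psi|^2 = m^2 |psi|^2 + |grad psi|^2
                    + 2 int (jac v1 v2 - jac u1 u2) + 2 m (boundary term),

    where the boundary term is the squared norm of the trace of [u]
    ([cross_ge0]).  On each side the boundary condition says that [v] is [u]
    rotated by an angle depending only on that side.

    The two Jacobian integrals are equal ([jacobian_balance]).  For smooth
    functions the integral of a Jacobian is a boundary integral of
    tangential derivatives, and a constant rotation does not change it side by
    side; but traces of [W^{1,2}] functions have no tangential derivative and
    the three rotations do not fit together at the corners.  Weights [chi]
    that vanish on two of the sides isolate the third one: the weighted form
    [kform] is invariant under rotations, and it does not see a perturbation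
    of trace zero on that side ([kform_trace0]), by an estimate of Jacobian
    integrals by the L^1 norm of the boundary values ([jacobian_le_bd]).
    Three such weights add up to 1 minus a cutoff concentrated at the corners,
    and the contribution of the cutoff tends to 0 by dominated convergence
    ([cut_vanish]).  The domination is Hardy's inequality: on each side
    [v - rotated u] has trace zero, hence is square integrable against the
    inverse squared distance to the side, and near a corner the two
    differences belonging to the adjacent sides control all of [psi]
    ([density_le_hardy]).

    It remains to bound [|grad psi|^2] from below by
    [(544/475) / s^2 |psi|^2].  The long leg and the hypotenuse are almost
    parallel and face each other at distance at most [s], and their outward
    normals are almost opposite, so that the rotation on one is almost minus
    the rotation on the other.  Hence the two differences belonging to them,
    which vanish each on one of these sides, have together almost exactly twice
    the density of [psi] and of its gradient ([parallelogram_gap]).  A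
    one-dimensional Poincare inequality for functions vanishing at one end
    ([poincare]) then gives the constant: 32/25 times
    [(2 - 1/9) / (2 + 1/9)].

    Both inequalities, Hardy and Poincare, are instances of one estimate
    obtained by completing a square ([onesided]). *)

(** * Square-integrable functions and their limits *)

Section SquareIntegrable.
Context d (T : measurableType d) (R : realType).
Variables (mu : {measure set T -> \bar R}) (D : set T) (mD : measurable D).
Implicit Types (f g rho : T -> R).

Definition sqint f :=
  measurable_fun D f /\ mu.-integrable D (EFin \o (fun x => f x ^+ 2)).

Definition bounded_weight rho (M : R) :=
  measurable_fun D rho /\ forall x, D x -> `|rho x| <= M.

Lemma integrable_le f g : measurable_fun D f ->
  mu.-integrable D (EFin \o g) -> (forall x, D x -> `|f x| <= g x) ->
  mu.-integrable D (EFin \o f).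
Proof.
move=> mf ig fg; apply: le_integrable ig => //.
  exact/measurable_EFinP.
move=> x Dx /=; rewrite lee_fin (le_trans (fg x Dx))// ler_norm //.
Qed.

Lemma integrable_add f g : mu.-integrable D (EFin \o f) -> mu.-integrable D (EFin \o g) ->
  mu.-integrable D (EFin \o (fun x => f x + g x)).
Proof. by move=> fi gi; have := integrableD mD fi gi; apply: eq_integrable. Qed.

Lemma integrable_sub f g : mu.-integrable D (EFin \o f) -> mu.-integrable D (EFin \o g) ->
  mu.-integrable D (EFin \o (fun x => f x - g x)).
Proof. by move=> fi gi; have := integrableB mD fi gi; apply: eq_integrable. Qed.

Lemma integrable_scale (c : R) f : mu.-integrable D (EFin \o f) ->
  mu.-integrable D (EFin \o (fun x => c * f x)).
Proof.
by move=> fi; have := integrableZl mD c fi; apply: eq_integrable => // x _ /=; rewrite EFinM.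
Qed.

Lemma integrable_comb f g (a b : R) :
  mu.-integrable D (EFin \o f) -> mu.-integrable D (EFin \o g) ->
  mu.-integrable D (EFin \o (fun x => a * f x + b * g x)).
Proof.
by move=> fi gi; apply: integrable_add; exact: integrable_scale.
Qed.

Lemma Rintegral_comb f g (a b : R) :
  mu.-integrable D (EFin \o f) -> mu.-integrable D (EFin \o g) ->
  \int[mu]_(x in D) (a * f x + b * g x) =
  a * (\int[mu]_(x in D) f x) + b * \int[mu]_(x in D) g x.
Proof.
move=> fi gi; rewrite RintegralD//.
- by rewrite !RintegralZl.
- by have := integrableZl mD a fi; apply: eq_integrable => // x _ /=; rewrite EFinM.
- by have := integrableZl mD b gi; apply: eq_integrable => // x _ /=; rewrite EFinM.
Qed.

Lemma sqint_comb f g (a b : R) : sqint f -> sqint g ->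
  sqint (fun x => a * f x + b * g x).
Proof.
move=> [mf fi] [mg gi].
have mfg : measurable_fun D (fun x => a * f x + b * g x).
  by apply: measurable_funD; apply: measurable_funM => //; exact: measurable_cst.
split=> //.
apply: (@integrable_le _ (fun x => (2 * a ^+ 2) * f x ^+ 2 + (2 * b ^+ 2) * g x ^+ 2)).
- by apply: measurable_funX.
- exact: integrable_comb.
- move=> x _; rewrite ger0_norm ?sqr_ge0//.
  have : 0 <= (a * f x - b * g x) ^+ 2 by exact: sqr_ge0.
  by nra.
Qed.

Lemma sqint_sub f g : sqint f -> sqint g -> sqint (fun x => f x - g x).
Proof.
move=> hf hg; have := sqint_comb 1 (-1) hf hg.
by congr sqint; apply/funext => x; rewrite mul1r mulN1r.
Qed.

Lemma sqint_weight rho M f : bounded_weight rho M -> sqint f ->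
  sqint (fun x => rho x * f x).
Proof.
move=> [mr rM] [mf fi]; split; first exact: measurable_funM.
apply: (@integrable_le _ (fun x => M ^+ 2 * f x ^+ 2 + 0 * f x ^+ 2)).
- by apply: measurable_funX; exact: measurable_funM.
- exact: integrable_comb.
- move=> x Dx; rewrite ger0_norm ?sqr_ge0// mul0r addr0 exprMn.
  apply: ler_wpM2r; first exact: sqr_ge0.
  by rewrite -real_normK ?num_real// lerXn2r ?nnegrE ?(le_trans _ (rM _ Dx))// rM.
Qed.

Lemma sqint_mul f g : sqint f -> sqint g ->
  mu.-integrable D (EFin \o (fun x => f x * g x)).
Proof.
move=> [mf fi] [mg gi].
apply: (@integrable_le _ (fun x => 1 * f x ^+ 2 + 1 * g x ^+ 2)).
- exact: measurable_funM.
- exact: integrable_comb.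
- move=> x _; rewrite normrM -(real_normK (num_real (f x))) -(real_normK (num_real (g x))).
  have : 0 <= (`|f x| - `|g x|) ^+ 2 by exact: sqr_ge0.
  have := normr_ge0 (f x); have := normr_ge0 (g x).
  by nra.
Qed.

Lemma sqint_mul_weight rho M f g : bounded_weight rho M -> sqint f -> sqint g ->
  mu.-integrable D (EFin \o (fun x => rho x * (f x * g x))).
Proof.
move=> rM hf hg; have := sqint_mul (sqint_weight rM hf) hg.
by apply: eq_integrable => // x _ /=; rewrite mulrA.
Qed.

Lemma ge0_sqint f : 0 <= \int[mu]_(x in D) (f x ^+ 2).
Proof. by apply: Rintegral_ge0 => x _; exact: sqr_ge0. Qed.

(** The free parameter [e] lets the factor [g] be as large as wished while
    [f] tends to 0, which is how [sqcvg_mul] uses it; the Cauchy-Schwarz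
    inequality is the optimum over [e]. *)
Lemma young_sqint rho M f g (e : R) : 0 < e ->
  bounded_weight rho M -> sqint f -> sqint g ->
  `|\int[mu]_(x in D) (rho x * (f x * g x))| <=
  M * (e * \int[mu]_(x in D) (f x ^+ 2) + e^-1 * \int[mu]_(x in D) (g x ^+ 2)).
Proof.
move=> e0 rM hf hg.
have [D0|/set0P[x0 Dx0]] := eqVneq D set0.
  by rewrite D0 !Rintegral_set0 !mulr0 normr0 addr0 mulr0.
have M0 : 0 <= M by exact: le_trans (normr_ge0 _) (rM.2 x0 Dx0).
have ii := sqint_mul_weight rM hf hg.
rewrite (le_trans (le_normr_Rintegral _ ii))//.
rewrite mulrDr !mulrA -Rintegral_comb//; [|exact: hf.2|exact: hg.2].
apply: le_Rintegral => //.
- apply: (@integrable_le _ (fun x => `|rho x * (f x * g x)|)) => //.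
    by apply: measurableT_comp => //; apply/measurable_EFinP; apply: measurable_int ii.
  by have := integrable_norm ii; apply: eq_integrable.
  by move=> x _; rewrite normr_id.
- by apply: integrable_comb; [exact: hf.2|exact: hg.2].
- move=> x Dx; rewrite !normrM.
  have h1 := rM.2 x Dx.
  rewrite -!mulrA -mulrDr; apply: ler_pM => //.
  rewrite -(real_normK (num_real (f x))) -(real_normK (num_real (g x))).
  have := sqr_ge0 (e * `|f x| - `|g x|) => h.
  rewrite -(ler_pM2l e0) mulrDr [e * (e^-1 * _)]mulrA mulfV ?gt_eqF// mul1r.
  have := normr_ge0 (f x); have := normr_ge0 (g x).
  by nra.
Qed.

Definition sqcvg (f_ : nat -> T -> R) f :=
  [/\ forall n, sqint (f_ n), sqint f &
      (fun n => \int[mu]_(x in D) ((f_ n x - f x) ^+ 2)) @ \oo --> (0 : R)].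

(** A product of two convergent sequences is split as
    [(f_n - f)(g_n - g) + (f_n - f) g + f (g_n - g)], and each term is
    bounded by [young_sqint]. *)
Lemma sqcvg_mul rho M (f_ : nat -> T -> R) f (g_ : nat -> T -> R) g : bounded_weight rho M ->
  sqcvg f_ f -> sqcvg g_ g ->
  (fun n => \int[mu]_(x in D) (rho x * (f_ n x * g_ n x))) @ \oo -->
  \int[mu]_(x in D) (rho x * (f x * g x)).
Proof.
move=> rM [hf_ hf cf] [hg_ hg cg].
have [D0|/set0P[x0 Dx0]] := eqVneq D set0.
  rewrite D0 Rintegral_set0; under eq_fun do rewrite Rintegral_set0.
  exact: cvg_cst.
have M0 : 0 <= M by exact: le_trans (normr_ge0 _) (rM.2 x0 Dx0).
set If := \int[mu]_(x in D) (f x ^+ 2); set Ig := \int[mu]_(x in D) (g x ^+ 2).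
have If0 : 0 <= If by exact: ge0_sqint.
have Ig0 : 0 <= Ig by exact: ge0_sqint.
have est (e : R) n : 0 < e ->
  `|\int[mu]_(x in D) (rho x * (f_ n x * g_ n x)) - \int[mu]_(x in D) (rho x * (f x * g x))|
  <= M * ((1 + e^-1) * (\int[mu]_(x in D) ((f_ n x - f x) ^+ 2) +
        \int[mu]_(x in D) ((g_ n x - g x) ^+ 2)) + e * (If + Ig)).
  move=> e0.
  have sf := sqint_sub (hf_ n) hf; have sg := sqint_sub (hg_ n) hg.
  rewrite -RintegralB//; [|exact: sqint_mul_weight rM _ _|exact: sqint_mul_weight rM _ _].
  rewrite (_ : \int[mu]_(x in D) _ =
     \int[mu]_(x in D) (rho x * ((f_ n x - f x) * (g_ n x - g x))) +
     (\int[mu]_(x in D) (rho x * ((f_ n x - f x) * g x)) +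
     \int[mu]_(x in D) (rho x * (f x * (g_ n x - g x))))); last first.
    rewrite -RintegralD//; [|exact: sqint_mul_weight rM _ _|exact: sqint_mul_weight rM _ _].
    rewrite -RintegralD//; first by apply: eq_Rintegral => x _; ring.
      exact: sqint_mul_weight rM _ _.
    have := integrable_comb 1 1 (sqint_mul_weight rM sf hg) (sqint_mul_weight rM hf sg).
    by apply: eq_integrable => // x _ /=; rewrite !mul1r.
  have e1 : 0 < e^-1 by rewrite invr_gt0.
  have y1 := young_sqint ltr01 rM sf sg.
  have y2 := young_sqint e1 rM sf hg.
  have y3 := young_sqint e0 rM hf sg.
  rewrite invrK in y2; rewrite invr1 in y1.
  apply: (le_trans (ler_normD _ _)); apply: le_trans (lerD y1 (ler_normD _ _)) _.
  apply: le_trans (lerD (lexx _) (lerD y2 y3)) _.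
  by rewrite -!mulrDr ler_wpM2l// -/If -/Ig; lra.
apply/cvgrPdist_le => /= e e0.
pose e' := e / (2 * (M + 1) * (If + Ig + 1)).
have e'0 : 0 < e' by rewrite divr_gt0// mulr_gt0 ?mulr_gt0//; lra.
have cc : (fun n => M * ((1 + e'^-1) * (\int[mu]_(x in D) ((f_ n x - f x) ^+ 2) +
        \int[mu]_(x in D) ((g_ n x - g x) ^+ 2)))) @ \oo --> (0 : R).
  rewrite -[X in _ --> X](_ : M * ((1 + e'^-1) * (0 + 0)) = 0); last by rewrite addr0 !mulr0.
  by apply: cvgMr; apply: cvgMr; apply: cvgD.
have e2 : 0 < e / 2 by rewrite divr_gt0.
move/cvgrPdist_le : cc => /(_ _ e2) cc.
near=> n; rewrite distrC (le_trans (est _ n e'0))// mulrDr.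
rewrite [leRHS](splitr e) lerD//.
  by rewrite (le_trans (ler_norm _))// -normrN -sub0r; near: n.
have -> : e / 2 = (M + 1) * (e' * (If + Ig + 1)).
  by rewrite /e'; field; apply/andP; split; rewrite gt_eqF//; lra.
have e'I : 0 <= e' * (If + Ig) by apply: mulr_ge0; [exact: ltW|exact: addr_ge0].
by rewrite [e' * (If + Ig + 1)]mulrDr mulr1; nra.
Unshelve. all: by end_near. Qed.

Lemma sqcvg_comb (f_ : nat -> T -> R) f (g_ : nat -> T -> R) g (a b : R) : sqcvg f_ f -> sqcvg g_ g ->
  sqcvg (fun n x => a * f_ n x + b * g_ n x) (fun x => a * f x + b * g x).
Proof.
move=> [hf_ hf cf] [hg_ hg cg]; split.
- by move=> n; exact: sqint_comb.
- exact: sqint_comb.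
apply: (@squeeze_cvgr _ _ _ _ (fun=> 0) (fun n =>
   (2 * a ^+ 2) * \int[mu]_(x in D) ((f_ n x - f x) ^+ 2) +
   (2 * b ^+ 2) * \int[mu]_(x in D) ((g_ n x - g x) ^+ 2))).
- apply: nearW => n; rewrite ge0_sqint/=.
  have sf := sqint_sub (hf_ n) hf; have sg := sqint_sub (hg_ n) hg.
  rewrite -Rintegral_comb//; [|exact: sf.2|exact: sg.2].
  apply: le_Rintegral => //.
  + have := (sqint_comb a b sf sg).2.
    by apply: eq_integrable => // x _ /=; congr (_ ^+ 2)%:E; ring.
  + by apply: integrable_comb; [exact: sf.2|exact: sg.2].
  + move=> x _.
    have : 0 <= (a * (f_ n x - f x) - b * (g_ n x - g x)) ^+ 2 by exact: sqr_ge0.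
    by nra.
- exact: cvg_cst.
- rewrite -[X in _ --> X](_ : (2 * a ^+ 2) * 0 + (2 * b ^+ 2) * 0 = 0); last by rewrite !mulr0 addr0.
  by apply: cvgD; apply: cvgMr.
Qed.

Lemma sqcvg_weight rho M (f_ : nat -> T -> R) f : bounded_weight rho M -> sqcvg f_ f ->
  sqcvg (fun n x => rho x * f_ n x) (fun x => rho x * f x).
Proof.
move=> rM [hf_ hf cf]; split.
- by move=> n; exact: sqint_weight rM _.
- exact: sqint_weight rM _.
apply: (@squeeze_cvgr _ _ _ _ (fun=> 0) (fun n =>
   (M ^+ 2) * \int[mu]_(x in D) ((f_ n x - f x) ^+ 2))).
- apply: nearW => n; rewrite ge0_sqint/=.
  have sf := sqint_sub (hf_ n) hf.
  rewrite -RintegralZl//; last exact: sf.2.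
  apply: le_Rintegral => //.
  + have := (sqint_weight rM sf).2.
    by apply: eq_integrable => // x _ /=; congr (_ ^+ 2)%:E; ring.
  + have := integrableZl mD (M ^+ 2) sf.2.
    by apply: eq_integrable => // x _ /=.
  + move=> x Dx; rewrite -mulrBr exprMn ler_wpM2r ?sqr_ge0//.
    by rewrite -real_normK ?num_real// lerXn2r ?nnegrE ?(le_trans _ (rM.2 _ Dx))// rM.2.
- exact: cvg_cst.
- rewrite -[X in _ --> X](mulr0 (M ^+ 2)).
  exact: cvgMr.
Qed.

Lemma sqcvg_const f : sqint f -> sqcvg (fun=> f) f.
Proof.
move=> hf; split => //.
under eq_fun do under eq_Rintegral do rewrite subrr expr0n.
by rewrite /= Rintegral_cst// mul0r; exact: cvg_cst.
Qed.

Lemma sqcvg_sq (f_ : nat -> T -> R) f : sqcvg f_ f ->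
  (fun n => \int[mu]_(x in D) (f_ n x ^+ 2)) @ \oo --> \int[mu]_(x in D) (f x ^+ 2).
Proof.
move=> cf; have w1 : bounded_weight (fun=> 1) 1.
  by split; [exact: measurable_cst|move=> *; rewrite normr1].
have := sqcvg_mul w1 cf cf.
under eq_fun do under eq_Rintegral do rewrite mul1r -expr2.
by under eq_Rintegral do rewrite mul1r -expr2.
Qed.

Lemma sqcvg_norm (f_ : nat -> T -> R) f : sqcvg f_ f ->
  sqcvg (fun n x => `|f_ n x|) (fun x => `|f x|).
Proof.
have sqn g : sqint g -> sqint (fun x => `|g x|).
  move=> [mg ig]; split; first exact: measurableT_comp.
  by apply: eq_integrable ig => // x _ /=; rewrite real_normK// num_real.
move=> [hf_ hf cf]; split; [by move=> n; exact: sqn|exact: sqn|].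
apply: (@squeeze_cvgr _ _ _ _ (fun=> 0) (fun n => \int[mu]_(x in D) ((f_ n x - f x) ^+ 2))) => //.
- apply: nearW => n; rewrite ge0_sqint/=.
  have sf := sqint_sub (hf_ n) hf; have sf' := sqint_sub (sqn _ (hf_ n)) (sqn _ hf).
  apply: le_Rintegral => //; [exact: sf'.2|exact: sf.2|move=> x _].
  rewrite -[leLHS]real_normK ?num_real// -[leRHS]real_normK ?num_real//.
  by rewrite lerXn2r ?nnegrE//; exact: ler_dist_dist.
- exact: cvg_cst.
Qed.

Lemma sqcvg_eq (f_ g_ : nat -> T -> R) f g : sqcvg f_ f ->
  (forall n, {in D, f_ n =1 g_ n}) -> {in D, f =1 g} -> sqcvg g_ g.
Proof.
have sqe h k : sqint h -> {in D, h =1 k} -> sqint k.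
  move=> [mh ih] hk; split; first exact: eq_measurable_fun mh.
  by apply: eq_integrable ih => // x xD /=; rewrite hk.
move=> [hf_ hf cf] fgn fg; split.
- by move=> n; apply: sqe (fgn n).
- exact: sqe fg.
- move: cf; rewrite (_ : (fun n => \int[mu]_(x in D) ((f_ n x - f x) ^+ 2)) =
    fun n => \int[mu]_(x in D) ((g_ n x - g x) ^+ 2))//.
  by apply/funext => n; apply: eq_Rintegral => x xD; rewrite fgn ?fg.
Qed.

(** Convergence of integrals, packaged with integrability so that it can be
    assembled term by term. *)
Definition intcvg (F_ : nat -> T -> R) F :=
  [/\ forall n, mu.-integrable D (EFin \o F_ n), mu.-integrable D (EFin \o F) &
      (fun n => \int[mu]_(x in D) F_ n x) @ \oo --> \int[mu]_(x in D) F x].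

Lemma intcvgD (F_ G_ : nat -> T -> R) F G : intcvg F_ F -> intcvg G_ G ->
  intcvg (fun n x => F_ n x + G_ n x) (fun x => F x + G x).
Proof.
move=> [iF_ iF cF] [iG_ iG cG]; split; [by move=> n; exact: integrable_add|exact: integrable_add|].
rewrite RintegralD//; under eq_fun do rewrite RintegralD//.
exact: cvgD.
Qed.

Lemma intcvg_mul rho M (f_ : nat -> T -> R) f (g_ : nat -> T -> R) g :
  bounded_weight rho M -> sqcvg f_ f -> sqcvg g_ g ->
  intcvg (fun n x => rho x * (f_ n x * g_ n x)) (fun x => rho x * (f x * g x)).
Proof.
move=> rM cf cg; split.
- by move=> n; have [h _ _] := cf; have [k _ _] := cg; exact: sqint_mul_weight rM (h n) (k n).
- by have [_ h _] := cf; have [_ k _] := cg; exact: sqint_mul_weight rM h k.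
- exact: sqcvg_mul rM cf cg.
Qed.

Lemma intcvg_eq (F_ G_ : nat -> T -> R) F G : intcvg F_ F ->
  (forall n, {in D, F_ n =1 G_ n}) -> {in D, F =1 G} -> intcvg G_ G.
Proof.
move=> [iF_ iF cF] FGn FG; split.
- by move=> n; apply: eq_integrable (iF_ n) => // x xD /=; rewrite FGn.
- by apply: eq_integrable iF => // x xD /=; rewrite FG.
- move: cF; rewrite (eq_Rintegral _ FG) (_ : (fun n => \int[mu]_(x in D) F_ n x) =
    fun n => \int[mu]_(x in D) G_ n x)//.
  by apply/funext => n; apply: eq_Rintegral => x xD; rewrite FGn.
Qed.

End SquareIntegrable.

(** * The plane, its measure, and the closed triangle *)

Notation plane R := (measurableTypeR R * measurableTypeR R)%type.
Notation L1 D f := ((@leb2 _).-integrable D (EFin \o f)).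

Section PlaneMeasure.
Context {R : realType}.
Implicit Types (A : set (R * R)) (f : R * R -> R).

(** Open sets of the product topology belong to the product sigma-algebra
    because the plane has a countable base of boxes with rational corners. *)
Lemma open_measurable2 A : open A ->
  measurable (A : set (plane R)).
Proof.
move=> oA.
pose box (q : (rat * rat) * (rat * rat)) : set (plane R) :=
  (`](ratr q.1.1 : R), (ratr q.1.2)[) `*` (`](ratr q.2.1 : R), (ratr q.2.2)[).
rewrite (_ : A = \bigcup_q (if `[< box q `<=` A >] then box q else set0)).
  apply: countable_bigcupT_measurable => [|q]; first exact: countableP.
  by case: ifPn => // _; apply: measurableX; exact: measurable_itv.
apply/seteqP; split=> [[x y] Axy|z [q _]]; last by case: ifPn => // /asboolP; apply.
have /nbhs_ballP[e /= e0 eA] : nbhs (x, y) A by exact: open_nbhs_nbhs.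
have lt (t : R) : t - e < t by rewrite ltrBlDr ltrDl.
have gt (t : R) : t < t + e by rewrite ltrDl.
have [q1 q1x] := rat_in_itvoo (lt x); have [q2 q2x] := rat_in_itvoo (gt x).
have [q3 q3y] := rat_in_itvoo (lt y); have [q4 q4y] := rat_in_itvoo (gt y).
move: q1x q2x q3y q4y; rewrite !in_itv /= => /andP[? ?] /andP[? ?] /andP[? ?] /andP[? ?].
exists ((q1, q2), (q3, q4)) => //; case: ifPn => [_|/asboolP].
  by split => /=; rewrite in_itv/=; apply/andP; split.
case=> -[x' y'] [/=]; rewrite !in_itv /= => /andP[? ?] /andP[? ?].
by apply: eA; split => /=; rewrite /ball/= ltr_norml; apply/andP; split; lra.
Qed.

Lemma open_continuous_measurable2 A f : open A -> (forall x, A x -> {for x, continuous f}) ->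
  measurable_fun (A : set (plane R)) f.
Proof.
move=> oA cf; apply: (measurability _ (RGenOpens.measurableE R)).
move=> _ [_ [a [b ->] <-]]; apply: open_measurable2.
rewrite openE => x [Ax fx].
rewrite /interior; apply: filterI; first exact: open_nbhs_nbhs.
by apply: (cf _ Ax); apply: open_nbhs_nbhs; split => //; exact: interval_open.
Qed.

Lemma is_derive_dir1 f (x y d : R) :
  is_derive ((x, y) : R * R) (dir false) f d <-> is_derive x 1 (fun t => f (t, y)) d.
Proof.
have E : (fun h : R => h^-1 *: (f (h *: dir false + (x, y)) - f (x, y))) =
  (fun h => h^-1 *: (f (h *: 1 + x, y) - f (x, y))).
  apply/funext => h; congr (_ *: (f _ - _)).
  by apply: injective_projections => /=; rewrite ?scaler0 ?add0r.
split=> -[h1 h2]; split.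
- by move: h1; rewrite /derivable E.
- by rewrite -h2 /derive E.
- by move: h1; rewrite /derivable E.
- by rewrite -h2 /derive E.
Qed.

Lemma is_derive_dir2 f (x y d : R) :
  is_derive ((x, y) : R * R) (dir true) f d <-> is_derive y 1 (fun t => f (x, t)) d.
Proof.
have E : (fun h : R => h^-1 *: (f (h *: dir true + (x, y)) - f (x, y))) =
  (fun h => h^-1 *: (f (x, h *: 1 + y) - f (x, y))).
  apply/funext => h; congr (_ *: (f _ - _)).
  by apply: injective_projections => /=; rewrite ?scaler0 ?add0r.
split=> -[h1 h2]; split.
- by move: h1; rewrite /derivable E.
- by rewrite -h2 /derive E.
- by move: h1; rewrite /derivable E.
- by rewrite -h2 /derive E.
Qed.

Lemma continuous_slice1 f (x y : R) : {for (x, y), continuous f} ->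
  {for x, continuous (fun t => f (t, y))}.
Proof.
by move=> cf; exact: (cvg_comp _ f (cvg_pair (@cvg_id _ (nbhs x)) (cvg_cst y)) cf).
Qed.

Lemma continuous_slice2 f (x y : R) : {for (x, y), continuous f} ->
  {for y, continuous (fun t => f (x, t))}.
Proof.
by move=> cf; exact: (cvg_comp _ f (cvg_pair (cvg_cst x) (@cvg_id _ (nbhs y))) cf).
Qed.

End PlaneMeasure.

Section ContinuousOn.
Context {R : realType} (D : set (R * R)).
Implicit Types (f G : R * R -> R).

(** Continuity at the points of [D] as a function on the whole plane, which
    is stronger than continuity of the restriction to [D]; the approximants in
    the definition of traces are of this kind, and it is stable under all the
    operations below without side conditions. *)
Definition conton f := forall x, D x -> {for x, continuous f}.

Lemma ccontM f G : conton f -> conton G -> conton (fun x => f x * G x).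
Proof. by move=> cf cg x tx; apply: cvgM; [exact: cf|exact: cg]. Qed.
Lemma ccontD f G : conton f -> conton G -> conton (fun x => f x + G x).
Proof. by move=> cf cg x tx; apply: cvgD; [exact: cf|exact: cg]. Qed.
Lemma ccontN f : conton f -> conton (fun x => - f x).
Proof. by move=> cf x tx; apply: cvgN; exact: cf. Qed.
Lemma ccontB f G : conton f -> conton G -> conton (fun x => f x - G x).
Proof. by move=> cf cg; apply: ccontD => //; exact: ccontN. Qed.
Lemma ccont_cst (c : R) : conton (fun=> c).
Proof. by move=> x tx; exact: cvg_cst. Qed.
Lemma ccontX f n : conton f -> conton (fun x => f x ^+ n).
Proof.
move=> cf; elim: n => [|n IH]; first exact: ccont_cst.
rewrite (_ : (fun _ => _) = fun x => f x * f x ^+ n); first exact: ccontM.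
by apply/funext => x; rewrite exprS.
Qed.
Lemma ccontV f : (forall x, D x -> f x != 0) -> conton f -> conton (fun x => (f x)^-1).
Proof. by move=> f0 cf x tx; apply: cvgV; [exact: f0|exact: cf]. Qed.

End ContinuousOn.

Section Triangle.
Context {R : realType} (a b : R) (a0 : 0 < a) (b0 : 0 < b).
Implicit Types (f F G : R * R -> R).

Definition ctri : set (R * R) :=
  [set x | [/\ 0 <= x.1, 0 <= x.2 & x.1 / a + x.2 / b <= 1]].

Lemma tri_sub_ctri : tri a b `<=` ctri.
Proof. by move=> x [x0 y0 xy]; split; exact: ltW. Qed.

Lemma cont_lin (c1 c2 c0 : R) : continuous (fun x : R * R => c1 * x.1 + c2 * x.2 + c0).
Proof.
move=> x; apply: cvgD; last exact: cvg_cst.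
by apply: cvgD; (apply: cvgM; first exact: cvg_cst); [exact: cvg_fst|exact: cvg_snd].
Qed.

Lemma open_tri : open (tri a b).
Proof.
have h (c1 c2 c0 : R) : open [set x : R * R | 0 < c1 * x.1 + c2 * x.2 + c0].
  rewrite (_ : [set _ | _] = (fun x : R * R => c1 * x.1 + c2 * x.2 + c0) @^-1` [set t | 0 < t])//.
  by apply: open_comp; [move=> x _; exact: cont_lin|exact: open_gt].
rewrite (_ : tri a b = [set x : R * R | 0 < 1 * x.1 + 0 * x.2 + 0] `&`
  ([set x : R * R | 0 < 0 * x.1 + 1 * x.2 + 0] `&`
   [set x : R * R | 0 < (- a^-1) * x.1 + (- b^-1) * x.2 + 1])).
  by apply: openI => //; exact: openI.
apply/seteqP; split => x /=.
  by case=> x0 y0 xy; split; [lra|split; [lra|]]; lra.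
by case=> ? [? ?]; split; lra.
Qed.

Lemma measurable_tri : measurable (tri a b : set (plane R)).
Proof. exact: open_measurable2 open_tri. Qed.

Lemma ctri_box : ctri `<=` `[0, a] `*` `[0, b].
Proof.
move=> [x y] [/= x0 y0 xy]; split => /=; rewrite in_itv/=; apply/andP; split => //.
- have yb : 0 <= y / b by rewrite divr_ge0// ltW.
  by rewrite -[leRHS]mul1r -ler_pdivrMr// (le_trans _ xy)// lerDl.
- have xa : 0 <= x / a by rewrite divr_ge0// ltW.
  by rewrite -[leRHS]mul1r -ler_pdivrMr// (le_trans _ xy)// lerDr.
Qed.

Lemma compact_ctri : compact ctri.
Proof.
have h (c1 c2 c0 : R) : closed [set x : R * R | 0 <= c1 * x.1 + c2 * x.2 + c0].
  rewrite (_ : [set _ | _] = (fun x : R * R => c1 * x.1 + c2 * x.2 + c0) @^-1` [set t | 0 <= t])//.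
  by apply: closed_comp; [move=> x _; exact: cont_lin|exact: closed_ge].
apply: (@subclosed_compact _ _ (`[0, a] `*` `[0, b])).
- rewrite (_ : ctri = [set x : R * R | 0 <= 1 * x.1 + 0 * x.2 + 0] `&`
    ([set x : R * R | 0 <= 0 * x.1 + 1 * x.2 + 0] `&`
     [set x : R * R | 0 <= (- a^-1) * x.1 + (- b^-1) * x.2 + 1])).
    by apply: closedI => //; exact: closedI.
  apply/seteqP; split => x /=.
    by case=> x0 y0 xy; split; [lra|split; [lra|]]; lra.
  by case=> ? [? ?]; split; lra.
- by apply: compact_setX; exact: segment_compact.
- exact: ctri_box.
Qed.

Notation ccont := (conton ctri).

Lemma ccont_bounded f : ccont f -> exists2 M, 0 < M & forall x, ctri x -> `|f x| <= M.
Proof.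
move=> cf.
have cf' : {within ctri, continuous f} by apply: continuous_in_subspaceT => x /set_mem; exact: cf.
have /compact_bounded[M [Mr Mb]] := continuous_compact cf' compact_ctri.
exists (`|M| + 1); first by rewrite ltr_wpDl.
by move=> x tx; apply: (Mb (`|M| + 1)) => //=; [rewrite (le_lt_trans (ler_norm _))// ltrDl|exists x].
Qed.

Lemma ccont_measurable f : ccont f ->
  measurable_fun (tri a b : set (plane R)) f.
Proof.
move=> cf; apply: open_continuous_measurable2; first exact: open_tri.
by move=> x /tri_sub_ctri; exact: cf.
Qed.

Lemma leb2_tri_fin : (@leb2 R (tri a b) < +oo)%E.
Proof.
apply: (@le_lt_trans _ _ (@leb2 R ((`[0, a] : set (measurableTypeR R)) `*`
   (`[0, b] : set (measurableTypeR R))))).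
  apply: le_measure; rewrite ?inE; [exact: measurable_tri|apply: measurableX; exact: measurable_itv|].
  by move=> z /tri_sub_ctri; exact: ctri_box.
have -> : @leb2 R ((`[0, a] : set (measurableTypeR R)) `*` (`[0, b] : set (measurableTypeR R)))
   = (@lebesgue_measure R `[0%R, a] * @lebesgue_measure R `[0%R, b])%E.
  by apply: product_measure1E; exact: measurable_itv.
rewrite -ge0_fin_numE; last by rewrite mule_ge0.
by apply: fin_numM; rewrite lebesgue_measure_itv/= lte_fin ?a0 ?b0.
Qed.

Lemma ccont_integrable f : ccont f -> L1 (tri a b) f.
Proof.
move=> cf; have [M M0 fM] := ccont_bounded cf.
apply: (@integrable_le _ _ _ _ _ measurable_tri _ (fun=> M)).
- exact: ccont_measurable.
- apply: measurable_bounded_integrable; [exact: measurable_tri|exact: leb2_tri_fin|exact: measurable_cst|exact: bounded_cst].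
- by move=> x /tri_sub_ctri; exact: fM.
Qed.

Lemma ccont_weight f : ccont f -> exists M, bounded_weight (tri a b : set (plane R)) f M.
Proof.
move=> cf; have [M M0 fM] := ccont_bounded cf; exists M; split.
  exact: ccont_measurable.
by move=> x /tri_sub_ctri; exact: fM.
Qed.

Lemma ccont_sqint f : ccont f -> sqint (@leb2 R) (tri a b) f.
Proof.
by move=> cf; split; [exact: ccont_measurable|apply: ccont_integrable; exact: ccontX].
Qed.

End Triangle.

(** * Directional derivatives and the divergence theorem on the triangle *)

Section DerivativeRules.
Context {R : realType} {V : normedModType R}.
Implicit Types (f g : V -> R) (x v : V).

Lemma derM f g x v (df dg : R) : is_derive x v f df -> is_derive x v g dg ->
  is_derive x v (fun y => f y * g y) (f x * dg + g x * df).
Proof. exact: is_deriveM. Qed.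

Lemma derD f g x v (df dg : R) : is_derive x v f df -> is_derive x v g dg ->
  is_derive x v (fun y => f y + g y) (df + dg).
Proof. exact: is_deriveD. Qed.

Lemma derN f x v (df : R) : is_derive x v f df ->
  is_derive x v (fun y => - f y) (- df).
Proof. exact: is_deriveN. Qed.

Lemma derB f g x v (df dg : R) : is_derive x v f df -> is_derive x v g dg ->
  is_derive x v (fun y => f y - g y) (df - dg).
Proof. by move=> hf hg; apply: derD => //; exact: derN. Qed.

Lemma der_eq f g x v (df dg : R) : is_derive x v f df -> f =1 g -> df = dg ->
  is_derive x v g dg.
Proof. by move=> hf /funext <- <-. Qed.

End DerivativeRules.

Lemma der_comp {R : realType} (f : R * R -> R) (g : R -> R) (x : R * R) (j : bool) (df dg : R) :
  is_derive x (dir j) f df -> is_derive (f x) 1 g dg ->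
  is_derive x (dir j) (fun y => g (f y)) (dg * df).
Proof.
case: x => x y; case: j => hf hg; [apply/is_derive_dir2|apply/is_derive_dir1].
- move/is_derive_dir2 in hf.
  exact: (@is_derive1_comp R g (fun t => f (x, t)) y).
- move/is_derive_dir1 in hf.
  exact: (@is_derive1_comp R g (fun t => f (t, y)) x).
Qed.

Lemma derV {R : realType} (f : R * R -> R) (x : R * R) (j : bool) (df : R) :
  f x != 0 -> is_derive x (dir j) f df ->
  is_derive x (dir j) (fun y => (f y)^-1) (- (f x) ^- 2 * df).
Proof.
move=> f0 hf; apply: (@der_comp _ f (fun t => t^-1)) => //.
by have := @is_deriveV R id (f x) 1 1 f0 (is_derive_id _ _); rewrite /GRing.scale/= mulr1.
Qed.

Lemma der_coord {R : realType} (c1 c2 c0 : R) (x : R * R) (j : bool) :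
  is_derive x (dir j) (fun y : R * R => c1 * y.1 + c2 * y.2 + c0) (if j then c2 else c1).
Proof.
case: x => x y; case: j; [apply/is_derive_dir2|apply/is_derive_dir1] => /=.
- apply: (der_eq (derD (derD (is_derive_cst (c1 * x) y 1)
    (derM (is_derive_cst c2 y 1) (is_derive_id y 1))) (is_derive_cst c0 y 1))) => //.
  by rewrite addr0 add0r mulr0 addr0 mulr1.
- apply: (der_eq (derD (derD (derM (is_derive_cst c1 x 1) (is_derive_id x 1))
    (is_derive_cst (c2 * y) x 1)) (is_derive_cst c0 x 1))) => //.
  by rewrite !addr0 mulr0 addr0 mulr1.
Qed.

Section Green.
Context {R : realType} (a b : R) (a0 : 0 < a) (b0 : 0 < b).
Implicit Types (f F G : R * R -> R).
Notation mu := (@lebesgue_measure R).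
Notation ccont := (conton (ctri a b)).
Notation ctri := (ctri a b).

Lemma FTC_segment (c : R) (f g : R -> R) : 0 < c ->
  (forall t, t \in `[0, c] -> {for t, continuous f}) ->
  (forall t, t \in `[0, c] -> {for t, continuous g}) ->
  (forall t, t \in `[0, c] -> is_derive t 1 f (g t)) ->
  (\int[mu]_(t in `]0%R, c[) (g t)%:E = (f c - f 0)%:E)%E.
Proof.
move=> c0 cf cg df.
have mg : measurable_fun `]0%R, c[ g.
  apply: open_continuous_measurable_fun; first exact: interval_open.
  by move=> t /set_mem tc; apply: cg; apply: subset_itv_oo_cc.
rewrite -(@integral_itv_bndoo _ _ _ _ true false)//; last exact/measurable_EFinP.
rewrite (@continuous_FTC2 _ g f)//.
- by apply: continuous_in_subspaceT => x /set_mem; exact: cg.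
- have in0 : 0 \in `[0, c] by rewrite in_itv/= lexx ltW.
  have inc : c \in `[0, c] by rewrite in_itv/= lexx ltW.
  split.
  + by move=> x xc; apply: ex_derive; exact/df/subset_itv_oo_cc.
  + by apply: cvg_at_right_filter; exact: cf.
  + by apply: cvg_at_left_filter; exact: cf.
- move=> x xc; rewrite derive1E; apply: derive_val.
  exact/df/subset_itv_oo_cc.
Qed.

(** The sides are parametrised over [0, 1], while the fundamental theorem of
    calculus produces integrals over [0, c]. *)
Lemma Rintegral_scale (c : R) (h : R -> R) : 0 < c ->
  (forall t, t \in `[0, c] -> {for t, continuous h}) ->
  (\int[mu]_(t in `]0%R, c[) (h t)%:E = (c * \int[mu]_(t in `[0, 1]) h (t * c))%:E)%E.
Proof.
move=> c0 ch.
have mh : measurable_fun `]0%R, c[ h.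
  apply: open_continuous_measurable_fun; first exact: interval_open.
  by move=> t /set_mem tc; apply: ch; apply: subset_itv_oo_cc.
rewrite -(@integral_itv_bndoo _ _ _ _ true false)//; last exact/measurable_EFinP.
pose F (t : R) := t * c.
have dF (t : R) : is_derive t 1 F c.
  by have := derM (is_derive_id t 1) (is_derive_cst c t 1); rewrite mulr0 add0r mulr1.
have F' : (F^`())%classic = cst c by apply/funext => t; rewrite derive1E; apply: derive_val.
have cF : continuous F by move=> t; apply: cvgM; [exact: cvg_id|exact: cvg_cst].
have F0 : F 0 = 0 by rewrite /F mul0r.
have F1 : F 1 = c by rewrite /F mul1r.
have := @integration_by_substitution_increasing _ F h 0 1 ler01.
rewrite F0 F1 => -> //.
- rewrite F' -RintegralZl//=.
  + rewrite /Rintegral fineK//.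
      by apply: eq_integral => t _; rewrite fctE/= mulrC.
    apply: integrable_fin_num => //.
    apply: continuous_compact_integrable; first exact: segment_compact.
    apply: continuous_in_subspaceT => x /set_mem xc.
    apply: cvgM; first exact: cvg_cst.
    apply: (@cvg_comp _ _ _ F h) (cF x) _; apply: ch.
    move: xc; rewrite !in_itv/= => /andP[x0 x1].
    by apply/andP; split; [rewrite /F mulr_ge0// ltW|rewrite /F -[leRHS]mul1r ler_wpM2r// ltW].
  + apply: continuous_compact_integrable; first exact: segment_compact.
    apply: continuous_in_subspaceT => x /set_mem xc.
    apply: (@cvg_comp _ _ _ F h) (cF x) _; apply: ch.
    move: xc; rewrite !in_itv/= => /andP[x0 x1].
    by apply/andP; split; [rewrite /F mulr_ge0// ltW|rewrite /F -[leRHS]mul1r ler_wpM2r// ltW].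
- by move=> x y _ _ xy; rewrite /F ltr_pM2r.
- by rewrite F' => x _; exact: cvg_cst.
- by rewrite F'; apply: is_cvg_cst.
- by rewrite F'; apply: is_cvg_cst.
- split.
  + by move=> x _; apply: ex_derive.
  + by apply: cvg_at_right_filter; exact: cF.
  + by apply: cvg_at_left_filter; exact: cF.
- by apply: continuous_in_subspaceT => x /set_mem; exact: ch.
Qed.

Lemma ctri_hyp1 (y : R) : y \in `[0, b] -> ctri (a * (1 - y / b), y).
Proof.
rewrite in_itv/= => /andP[y0 yb]; split => //=.
- by apply: mulr_ge0; [exact: ltW|rewrite subr_ge0 ler_pdivrMr// mul1r].
- by rewrite mulrAC mulfV ?gt_eqF// mul1r subrK.
Qed.

Lemma ctri_slice1 (x y : R) : y \in `[0, b] -> x \in `[0, a * (1 - y / b)] -> ctri (x, y).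
Proof.
rewrite !in_itv/= => /andP[y0 yb] /andP[x0 xa]; split => //=.
by rewrite -lerBrDr ler_pdivrMr// mulrC.
Qed.

Lemma ctri_slice2 (x y : R) : x \in `[0, a] -> y \in `[0, b * (1 - x / a)] -> ctri (x, y).
Proof.
rewrite !in_itv/= => /andP[x0 xb] /andP[y0 ya]; split => //=.
by rewrite -lerBrDl ler_pdivrMr// mulrC.
Qed.

Lemma integrable_itv01 (h : R -> R) : (forall t, t \in `[0, 1] -> {for t, continuous h}) ->
  mu.-integrable `[0, 1] (EFin \o h).
Proof.
move=> ch; apply: continuous_compact_integrable; first exact: segment_compact.
by apply: continuous_in_subspaceT => x /set_mem; exact: ch.
Qed.

Lemma param_ctri s (t : R) : t \in `[0, 1] -> ctri (param a b s t).
Proof.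
rewrite in_itv/= => /andP[t0 t1].
have ta : 0 <= t * a by rewrite mulr_ge0// ltW.
have tb : 0 <= t * b by rewrite mulr_ge0// ltW.
have ta' : 0 <= (1 - t) * a by rewrite mulr_ge0 ?subr_ge0// ltW.
case: s; split => //=; rewrite ?mul0r ?addr0 ?add0r ?mulfK ?gt_eqF//.
by rewrite subrK.
Qed.

Lemma cont_param s : continuous (param a b s : R -> R * R).
Proof.
have cm (c : R) : continuous (fun t : R => t * c).
  by move=> t; apply: cvgM; [exact: cvg_id|exact: cvg_cst].
have cm' (c : R) : continuous (fun t : R => (1 - t) * c).
  by move=> t; apply: cvgM; [apply: cvgB; [exact: cvg_cst|exact: cvg_id]|exact: cvg_cst].
case: s => t.
- exact: (cvg_pair (cm a t) (cvg_cst (0 : R))).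
- exact: (cvg_pair (cvg_cst (0 : R)) (cm b t)).
- exact: (cvg_pair (cm' a t) (cm b t)).
Qed.

Lemma ccont_param f s t : ccont f -> t \in `[0, 1] -> {for t, continuous (fun t => f (param a b s t))}.
Proof.
move=> cf t01; apply: (@cvg_comp _ _ _ (param a b s) f) (@cont_param s t) _.
exact/cf/param_ctri.
Qed.

(** Fubini: on every horizontal slice the fundamental theorem of calculus
    leaves the difference of the values of [F] on the hypotenuse and on [OB]. *)
Lemma green1 F G : ccont F -> ccont G ->
  (forall x, ctri x -> is_derive x (dir false) F (G x)) ->
  \int[leb2]_(x in tri a b) G x =
  b * (\int[mu]_(t in `[0, 1]) F (param a b AB t) - \int[mu]_(t in `[0, 1]) F (param a b OB t)).
Proof.
move=> cF cG dF.
have iG := ccont_integrable a0 b0 cG.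
have mT := measurable_tri a b.
have iG' : (@leb2 R).-integrable setT (fun x => ((G \_ (tri a b)) x)%:E).
  by have := iG; rewrite integrable_mkcond// restrict_EFin.
pose h y := F (a * (1 - y / b), y) - F (0, y).
have ch y : y \in `[0, b] -> {for y, continuous h}.
  move=> yb; apply: cvgB.
    have c1 : (fun y => a * (1 - y / b)) @ y --> a * (1 - y / b).
      apply: cvgM; first exact: cvg_cst.
      apply: cvgB; first exact: cvg_cst.
      by apply: cvgM; [exact: cvg_id|exact: cvg_cst].
    exact: (cvg_comp _ F (cvg_pair c1 (@cvg_id _ (nbhs y))) (cF _ (ctri_hyp1 yb))).
  apply: continuous_slice2; apply: cF; move: yb; rewrite in_itv => /andP[? ?].
  by split => //=; rewrite mul0r add0r ler_pdivrMr// mul1r.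
rewrite Rintegral_mkcond /Rintegral -(integral21_prod_meas1 iG').
rewrite (_ : (fun _ => _) = (fun y => ((h \_ `]0, b[) y)%:E)); last first.
  apply/funext => y; rewrite /fubini_G [in RHS]patchE; case: ifPn => [/set_mem /= yb|yb].
    have yb' := subset_itv_oo_cc yb.
    move: yb; rewrite in_itv/= => /andP[y0 yb].
    have c0 : 0 < a * (1 - y / b) by rewrite mulr_gt0// subr_gt0 ltr_pdivrMr// mul1r.
    have FT : (\int[mu]_(x in `]0%R, (a * (1 - y / b))%R[) (G (x, y))%:E = (h y)%:E)%E.
      apply: (@FTC_segment (a * (1 - y / b)) (fun x => F (x, y))) => // t tc.
      - by apply: continuous_slice1; exact/cF/ctri_slice1.
      - by apply: continuous_slice1; exact/cG/ctri_slice1.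
      - by apply/is_derive_dir1; exact/dF/ctri_slice1.
    rewrite -FT.
    - rewrite [RHS]integral_mkcond; apply: eq_integral => x _.
      rewrite [in RHS]patchE [in LHS]patchE.
      suff -> : ((x, y) \in tri a b) = (x \in `]0, (a * (1 - y / b))[%classic) by case: ifPn.
      apply/idP/idP => /set_mem H; apply/mem_set.
        case: H => /= x0 _; rewrite in_itv/= x0/=.
        by rewrite -ltrBrDr ltr_pdivrMr// mulrC.
      move: H; rewrite /= in_itv/= => /andP[x0 xa]; split => //=.
      by rewrite -ltrBrDr ltr_pdivrMr// mulrC.
  rewrite integral0_eq// => x _; rewrite patchE ifN//; apply/negP => /set_mem[/= x0 y0 xy].
  move/negP : yb; apply; apply/mem_set; rewrite /= in_itv/= y0/=.
  have : 0 <= x / a by rewrite divr_ge0// ltW.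
  by rewrite -[ltRHS]mul1r -ltr_pdivrMr//; lra.
rewrite (_ : (fun y => ((h \_ `]0, b[) y)%:E) = (EFin \o h) \_ `]0, b[); last first.
  by rewrite restrict_EFin.
rewrite -integral_mkcond (Rintegral_scale b0 ch)/=; congr (_ * _).
rewrite -RintegralB//.
- apply: eq_Rintegral => t _; rewrite /h /= mulfK ?gt_eqF//.
  by rewrite [a * _]mulrC.
- by apply: integrable_itv01 => t; exact: (@ccont_param F AB).
- by apply: integrable_itv01 => t; exact: (@ccont_param F OB).
Qed.

(** Slicing vertically runs through the hypotenuse in the direction opposite
    to its parametrisation, whence the change of variable [1 - t]. *)
Lemma green2 F G : ccont F -> ccont G ->
  (forall x, ctri x -> is_derive x (dir true) F (G x)) ->
  \int[leb2]_(x in tri a b) G x =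
  a * (\int[mu]_(t in `[0, 1]) F (param a b AB t) - \int[mu]_(t in `[0, 1]) F (param a b OA t)).
Proof.
move=> cF cG dF.
have iG := ccont_integrable a0 b0 cG.
have mT := measurable_tri a b.
have iG' : (@leb2 R).-integrable setT (fun x => ((G \_ (tri a b)) x)%:E).
  by have := iG; rewrite integrable_mkcond// restrict_EFin.
pose h x := F (x, b * (1 - x / a)) - F (x, 0).
have hyp x : x \in `[0, a] -> ctri (x, b * (1 - x / a)).
  move=> xa; apply: ctri_slice2 => //; move: xa; rewrite !in_itv/= lexx andbT => /andP[x0 xa].
  by apply: mulr_ge0; [exact: ltW|rewrite subr_ge0 ler_pdivrMr// mul1r].
have ch x : x \in `[0, a] -> {for x, continuous h}.
  move=> xa; apply: cvgB.
    have c1 : (fun x => b * (1 - x / a)) @ x --> b * (1 - x / a).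
      apply: cvgM; first exact: cvg_cst.
      apply: cvgB; first exact: cvg_cst.
      by apply: cvgM; [exact: cvg_id|exact: cvg_cst].
    exact: (cvg_comp _ F (cvg_pair (@cvg_id _ (nbhs x)) c1) (cF _ (hyp x xa))).
  apply: continuous_slice1; apply: cF; move: xa; rewrite in_itv => /andP[? ?].
  by split => //=; rewrite mul0r addr0 ler_pdivrMr// mul1r.
transitivity (a * \int[mu]_(t in `[0, 1]) h (t * a)); last first.
  congr (_ * _).
  have iAB (s : side) : mu.-integrable `[0, 1] (EFin \o (fun t => F (param a b s t))).
    by apply: integrable_itv01 => t; exact: (@ccont_param F s).
  have -> : \int[mu]_(t in `[0, 1]) F (param a b AB t) =
            \int[mu]_(t in `[0, 1]) F (t * a, (1 - t) * b).
    have := @Rintegration_by_substitution_onem R (fun t => F (param a b AB t)) 1.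
    rewrite lexx ler01 /= => ->//.
      rewrite /unstable.onem subrr; apply: eq_Rintegral => t _ /=.
      by rewrite opprB addrC subrK.
    by apply: continuous_in_subspaceT => t /set_mem; exact: (@ccont_param F AB).
  rewrite -RintegralB//.
  - by apply: eq_Rintegral => t _; rewrite /h /= mulfK ?gt_eqF// [b * _]mulrC.
  - apply: integrable_itv01 => t t01.
    have c1 : (fun t : R => t * a) @ t --> t * a by apply: cvgM; [exact: cvg_id|exact: cvg_cst].
    have c2 : (fun t : R => (1 - t) * b) @ t --> (1 - t) * b.
      by apply: cvgM; [apply: cvgB; [exact: cvg_cst|exact: cvg_id]|exact: cvg_cst].
    apply: (cvg_comp _ F (cvg_pair c1 c2)).
    apply: cF; move: t01; rewrite in_itv/= => /andP[t0 t1]; split => /=.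
    + by rewrite mulr_ge0// ltW.
    + by rewrite mulr_ge0// ?subr_ge0// ltW.
    + by rewrite !mulfK ?gt_eqF// addrC subrK.
rewrite Rintegral_mkcond /Rintegral -(integral12_prod_meas1 iG').
rewrite (_ : (fun _ => _) = (fun x => ((h \_ `]0, a[) x)%:E)); last first.
  apply/funext => x; rewrite /fubini_F [in RHS]patchE; case: ifPn => [/set_mem /= xa|xa].
    have xa' := subset_itv_oo_cc xa.
    move: xa; rewrite in_itv/= => /andP[x0 xa].
    have c0 : 0 < b * (1 - x / a) by rewrite mulr_gt0// subr_gt0 ltr_pdivrMr// mul1r.
    have FT : (\int[mu]_(y in `]0%R, (b * (1 - x / a))%R[) (G (x, y))%:E = (h x)%:E)%E.
      apply: (@FTC_segment (b * (1 - x / a)) (fun y => F (x, y))) => // t tc.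
      - by apply: continuous_slice2; exact/cF/ctri_slice2.
      - by apply: continuous_slice2; exact/cG/ctri_slice2.
      - by apply/is_derive_dir2; exact/dF/ctri_slice2.
    rewrite -FT.
    - rewrite [RHS]integral_mkcond; apply: eq_integral => y _.
      rewrite [in RHS]patchE [in LHS]patchE.
      suff -> : ((x, y) \in tri a b) = (y \in `]0, (b * (1 - x / a))[%classic) by case: ifPn.
      apply/idP/idP => /set_mem H; apply/mem_set.
        case: H => /= _ y0; rewrite in_itv/= y0/=.
        by rewrite -ltrBrDl ltr_pdivrMr// mulrC.
      move: H; rewrite /= in_itv/= => /andP[y0 yb]; split => //=.
      by rewrite -ltrBrDl ltr_pdivrMr// mulrC.
  rewrite integral0_eq// => y _; rewrite patchE ifN//; apply/negP => /set_mem[/= x0 y0 xy].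
  move/negP : xa; apply; apply/mem_set; rewrite /= in_itv/= x0/=.
  have : 0 <= y / b by rewrite divr_ge0// ltW.
  by rewrite -[ltRHS]mul1r -ltr_pdivrMr//; lra.
rewrite (_ : (fun x => ((h \_ `]0, a[) x)%:E) = (EFin \o h) \_ `]0, a[); last first.
  by rewrite restrict_EFin.
by rewrite -integral_mkcond (Rintegral_scale a0 ch).
Qed.

End Green.

(** * Averages along the first coordinate *)

Lemma fst_cvg (T U : topologicalType) (z : T * U) : fst @ z --> z.1.
Proof. by case: z => x y; exact: cvg_fst. Qed.

Lemma snd_cvg (T U : topologicalType) (z : T * U) : snd @ z --> z.2.
Proof. by case: z => x y; exact: cvg_snd. Qed.

Lemma cvg_comp_pair (R : realType) (T : Type) (F : set_system T) {FF : Filter F}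
    (k1 k2 : T -> R) (g : R * R -> R) (u v : R) :
  k1 @ F --> u -> k2 @ F --> v -> {for (u, v), continuous g} ->
  (fun t => g (k1 t, k2 t)) @ F --> g (u, v).
Proof. by move=> c1 c2; exact: cvg_comp (cvg_pair c1 c2). Qed.

Section Average.
Context {R : realType}.
Notation mu := (@lebesgue_measure R).
Implicit Types (g : R * R -> R) (h : R).

Definition avg h g (z : R * R) : R := \int[mu]_(s in `[0, 1]) g (z.1 + h * s, z.2).

Lemma continuous_shift g h : continuous g -> continuous (fun z : R * R => g (z.1 + h, z.2)).
Proof.
move=> cg z; apply: cvg_comp_pair (cg _); last exact: snd_cvg.
by apply: cvgD; [exact: fst_cvg|exact: cvg_cst].
Qed.

Lemma continuous_line g h (z : R * R) : continuous g ->
  continuous (fun s : R => g (z.1 + h * s, z.2)).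
Proof.
move=> cg s; apply: cvg_comp_pair (cg _); last exact: cvg_cst.
by apply: cvgD; [exact: cvg_cst|apply: cvgM; [exact: cvg_cst|exact: cvg_id]].
Qed.

Lemma Rintegral01_cst (c : R) : \int[mu]_(s in `[0, 1]) (cst c s) = c.
Proof.
rewrite Rintegral_cst//= lebesgue_measure_itv/= lte_fin ltr01.
by rewrite -EFinB/= subr0 mulr1.
Qed.

Lemma dist_Rintegral01 (k1 k2 : R -> R) (e : R) :
  continuous k1 -> continuous k2 -> (forall s, s \in `[0, 1] -> `|k1 s - k2 s| <= e) ->
  `|\int[mu]_(s in `[0, 1]) k1 s - \int[mu]_(s in `[0, 1]) k2 s| <= e.
Proof.
move=> c1 c2 H.
have i1 : mu.-integrable `[0, 1] (EFin \o k1) by apply: integrable_itv01 => t _; exact: c1.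
have i2 : mu.-integrable `[0, 1] (EFin \o k2) by apply: integrable_itv01 => t _; exact: c2.
have cd : continuous (fun s => k1 s - k2 s) by move=> t; apply: cvgB; [exact: c1|exact: c2].
rewrite -RintegralB// (le_trans (le_normr_Rintegral _ _))//.
  by apply: integrable_itv01 => t _; exact: cd.
rewrite -[leRHS](Rintegral01_cst e).
apply: le_Rintegral => //.
- by apply: integrable_itv01 => t _; apply: cvg_norm; exact: cd.
- by apply: integrable_itv01 => t _; exact: cvg_cst.
Qed.

Lemma continuous_avg g h : continuous g -> continuous (avg h g).
Proof.
move=> cg z0; apply/cvgrPdist_le => /= e e0.
suff : \forall z \near z0, `[0, 1] `<=` (fun s => `|g (z0.1 + h * s, z0.2) - g (z.1 + h * s, z.2)| <= e).
  by apply: filterS => z H; apply: dist_Rintegral01 => //; exact: continuous_line.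
have /compact_near_coveringP/(_ _ (nbhs z0) (fun z s => `|g (z0.1 + h * s, z0.2) - g (z.1 + h * s, z.2)| <= e) _) := @segment_compact R 0 1.
apply => s _.
have p1 : fst @ nbhs ((s, z0) : R * (R * R)) --> s by exact: fst_cvg.
have p2 : snd @ nbhs ((s, z0) : R * (R * R)) --> z0 by exact: snd_cvg.
have p21 : (fun p : R * (R * R) => p.2.1) @ nbhs ((s, z0) : R * (R * R)) --> z0.1.
  by have := cvg_comp _ _ p2 (@fst_cvg R R z0).
have p22 : (fun p : R * (R * R) => p.2.2) @ nbhs ((s, z0) : R * (R * R)) --> z0.2.
  by have := cvg_comp _ _ p2 (@snd_cvg R R z0).
have p3 : (fun p : R * (R * R) => p.2.1 + h * p.1) @ nbhs ((s, z0) : R * (R * R)) --> z0.1 + h * s.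
  by apply: cvgD p21 _; apply: cvgM p1; exact: cvg_cst.
have cG : (fun p : R * (R * R) => g (p.2.1 + h * p.1, p.2.2)) @ nbhs ((s, z0) : R * (R * R))
    --> g (z0.1 + h * s, z0.2) by exact: cvg_comp_pair p3 p22 (cg _).
have p4 : (fun p : R * (R * R) => z0.1 + h * p.1) @ nbhs ((s, z0) : R * (R * R)) --> z0.1 + h * s.
  by apply: cvgD; [exact: cvg_cst|apply: cvgM p1; exact: cvg_cst].
have cH : (fun p : R * (R * R) => g (z0.1 + h * p.1, z0.2)) @ nbhs ((s, z0) : R * (R * R))
    --> g (z0.1 + h * s, z0.2) by apply: cvg_comp_pair p4 _ (cg _); exact: cvg_cst.
have cHG : (fun p : R * (R * R) => g (z0.1 + h * p.1, z0.2) - g (p.2.1 + h * p.1, p.2.2))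
    @ nbhs ((s, z0) : R * (R * R)) --> (0 : R).
  by rewrite -(subrr (g (z0.1 + h * s, z0.2))); apply: cvgB.
move/cvgrPdist_le : cHG => /(_ _ e0) /=.
by apply: filterS => p; rewrite sub0r normrN.
Qed.

(** Uniform continuity on a compact set, in the form of a tube lemma for the
    compact set [K `*` `[0, 1]] and the parameter [h]. *)
Lemma avg_unif (K : set (R * R)) g (e : R) : compact K -> continuous g -> 0 < e ->
  \forall h \near (0 : R), forall z, K z -> `|avg h g z - g z| <= e.
Proof.
move=> cK cg e0.
have cKI : compact (K `*` (`[0, 1] : set R)).
  by apply: (@compact_setX (R * R)%type R) => //; exact: segment_compact.
have /compact_near_coveringP/(_ _ (nbhs (0 : R)) (fun (h : R) p => `|g (p.1.1 + h * p.2, p.1.2) - g p.1| <= e) _) := cKI.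
have H : forall x : R * R * R, (K `*` (`[0, 1] : set R)) x ->
   \forall x' \near x & i \near (0 : R), `|g (x'.1.1 + i * x'.2, x'.1.2) - g x'.1| <= e.
  move=> [z s] _.
  pose NN := nbhs (((z, s), 0 : R) : (R * R) * R * R).
  have f1 : fst @ NN --> (z, s) by exact: fst_cvg.
  have f2 : snd @ NN --> (0 : R) by exact: snd_cvg.
  have f11 : (fun p : (R * R) * R * R => p.1.1) @ NN --> z.
    by have := cvg_comp _ _ f1 (@fst_cvg (R * R)%type R (z, s)).
  have f12 : (fun p : (R * R) * R * R => p.1.2) @ NN --> s.
    by have := cvg_comp _ _ f1 (@snd_cvg (R * R)%type R (z, s)).
  have f111 : (fun p : (R * R) * R * R => p.1.1.1) @ NN --> z.1.
    by have := cvg_comp _ _ f11 (@fst_cvg R R z).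
  have f112 : (fun p : (R * R) * R * R => p.1.1.2) @ NN --> z.2.
    by have := cvg_comp _ _ f11 (@snd_cvg R R z).
  have f3 : (fun p : (R * R) * R * R => p.1.1.1 + p.2 * p.1.2) @ NN --> z.1 + 0 * s.
    by apply: cvgD f111 _; apply: cvgM.
  have cG : (fun p : R * R * R * R => g (p.1.1.1 + p.2 * p.1.2, p.1.1.2)) @ NN --> g (z.1 + 0 * s, z.2).
    exact: cvg_comp_pair f3 f112 (cg _).
  have cH : (fun p : R * R * R * R => g p.1.1) @ NN --> g z.
    by have := cvg_comp _ g f11 (cg _).
  have cGH : (fun p : R * R * R * R => g (p.1.1.1 + p.2 * p.1.2, p.1.1.2) - g p.1.1) @ NN --> (0 : R).
    rewrite -(subrr (g z)); apply: cvgB => //.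
    by rewrite mul0r addr0 -surjective_pairing in cG.
  move/cvgrPdist_le : cGH => /(_ _ e0) /=.
  by apply: filterS => p; rewrite sub0r normrN.
move/(_ H); apply: filterS => h Kh z Kz.
rewrite -[X in _ - X](Rintegral01_cst (g z)).
apply: dist_Rintegral01.
- exact: continuous_line.
- by move=> t; exact: cvg_cst.
- by move=> s s01; exact: (Kh (z, s)).
Qed.

(** The half-line starts at -1 so that 0 is an interior point: [der_avg] is used
    on the whole closed triangle, including the leg where [z.1 = 0]. *)
Lemma primitive_exists (k : R -> R) : continuous k ->
  exists Q : R -> R, forall t : R, -1 < t -> is_derive t 1 Q (k t).
Proof.
move=> ck; exists (fun t => \int[mu]_(s in `[-1, t]) k s) => t t1.
have tu : t < t + 1 by rewrite ltrDl.
have int : mu.-integrable `[-1, t + 1] (EFin \o k).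
  apply: continuous_compact_integrable; first exact: segment_compact.
  exact: continuous_subspaceT.
have [|d1 d2] := @continuous_FTC1 R k (BLeft (-1)%R) t (t + 1) tu int _ (ck t).
  by rewrite /= lte_fin.
split; first exact: d1.
by rewrite -derive1E; exact: d2.
Qed.

(** Averaging gains a derivative: [avg h g] is the difference quotient of a
    primitive of [g], hence differentiable although [g] is only continuous. *)
Lemma der_avg g h (z : R * R) : continuous g -> 0 < h -> 0 <= z.1 ->
  is_derive z (dir false) (avg h g) (h^-1 * (g (z.1 + h, z.2) - g z)).
Proof.
case: z => x y /= cg h0 x0.
have [Q dQ] : exists Q : R -> R, forall t : R, -1 < t -> is_derive t 1 Q (g (t, y)).
  apply: (@primitive_exists (fun t => g (t, y))) => t; exact: continuous_slice1 (cg (t, y)).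
apply/is_derive_dir1.
have E (t : R) : -1 < t -> h^-1 * (Q (t + h) - Q t) = avg h g (t, y).
  move=> t1.
  have lt (s : R) : s \in `[0, 1] -> -1 < t + h * s.
    by rewrite in_itv/= => /andP[s0 _]; rewrite ltr_wpDr// mulr_ge0// ltW.
  have dQ' (s : R) : s \in `[0, 1] -> is_derive s 1 (fun s => h^-1 * Q (t + h * s)) (g (t + h * s, y)).
    move=> s01.
    have d0 : is_derive s 1 (fun s => t + h * s) h.
      apply: (der_eq (derD (is_derive_cst t s 1) (derM (is_derive_cst h s 1) (is_derive_id s 1)))) => //.
      by rewrite add0r mulr0 mulr1 addr0.
    have d1 := @is_derive1_comp R Q (fun s => t + h * s) s _ _ (dQ _ (lt s s01)) d0.
    apply: (der_eq (derM (is_derive_cst h^-1 s 1) d1)) => //.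
    by rewrite mulr0 addr0 mulrC mulfK// gt_eqF.
  have cl : continuous (fun s : R => g (t + h * s, y)) by exact: (@continuous_line g h (t, y) cg).
  have mF : measurable_fun (`]0, 1[ : set R) (EFin \o (fun s : R => g (t + h * s, y))).
    by apply/measurable_EFinP; apply: measurable_funTS; exact: continuous_measurable_fun.
  have := integral_itv_bndoo true false mF.
  rewrite (@FTC_segment R 1 (fun s => h^-1 * Q (t + h * s)) (fun s => g (t + h * s, y)) ltr01)//.
  - by rewrite /avg /Rintegral /= => -> /=; rewrite mulr1 mulr0 addr0 mulrBr.
  - move=> s s01; apply: differentiable_continuous; apply/derivable1_diffP.
    by have [] := dQ' s s01.
  - by move=> s _; exact: cl.
have dx : is_derive x 1 (fun t => h^-1 * (Q (t + h) - Q t)) (h^-1 * (g (x + h, y) - g (x, y))).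
  have l1 : -1 < x + h by lra.
  have l2 : -1 < x by lra.
  have d0 : is_derive x 1 (fun t => t + h) 1.
    by apply: (der_eq (derD (is_derive_id x 1) (is_derive_cst h x 1))) => //; rewrite addr0.
  have d1 := @is_derive1_comp R Q (fun t => t + h) x _ _ (dQ _ l1) d0.
  apply: (der_eq (derM (is_derive_cst h^-1 x 1) (derB d1 (dQ _ l2)))) => //.
  by rewrite mulr0 addr0 mulr1.
apply: near_eq_is_derive dx.
have l2 : -1 < x by lra.
near=> t; apply: E; near: t.
by apply: lt_nbhsr.
Unshelve. all: by end_near. Qed.

(** The average of a derivative is a difference quotient.  In
    [jacobian_le_bd] this expresses the average of one partial derivative of
    [Phi] without any second derivative. *)
Lemma avg_difference g g1 h (z : R * R) : continuous g -> continuous g1 -> 0 < h ->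
  (forall x, is_derive x (dir false) g (g1 x)) ->
  avg h g1 z = h^-1 * (g (z.1 + h, z.2) - g z).
Proof.
case: z => x y /= cg cg1 h0 dg; rewrite /avg /=.
have dQ (s : R) : is_derive s 1 (fun s => h^-1 * g (x + h * s, y)) (g1 (x + h * s, y)).
  have d0 : is_derive s 1 (fun s => x + h * s) h.
    apply: (der_eq (derD (is_derive_cst x s 1) (derM (is_derive_cst h s 1) (is_derive_id s 1)))) => //.
    by rewrite add0r mulr0 mulr1 addr0.
  have /is_derive_dir1 d1 := dg (x + h * s, y).
  have d2 := @is_derive1_comp R (fun t => g (t, y)) (fun s => x + h * s) s _ _ d1 d0.
  apply: (der_eq (derM (is_derive_cst h^-1 s 1) d2)) => //.
  by rewrite mulr0 addr0 mulrC mulfK// gt_eqF.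
have cl : continuous (fun s : R => g1 (x + h * s, y)) by exact: (@continuous_line g1 h (x, y) cg1).
have mF : measurable_fun (`]0, 1[ : set R) (EFin \o (fun s : R => g1 (x + h * s, y))).
  by apply/measurable_EFinP; apply: measurable_funTS; exact: continuous_measurable_fun.
have := integral_itv_bndoo true false mF.
rewrite (@FTC_segment R 1 (fun s => h^-1 * g (x + h * s, y)) (fun s => g1 (x + h * s, y)) ltr01)//.
- by rewrite /Rintegral /= => -> /=; rewrite mulr1 mulr0 addr0 mulrBr.
- move=> s s01; apply: cvgM; first exact: cvg_cst.
  exact: (@continuous_line g h (x, y) cg).
- by move=> s _; exact: cl.
Qed.

End Average.

(** * Functions of class C^1 and a boundary estimate for Jacobians *)

Section C1On.
Context {R : realType} (D : set (R * R)).
Implicit Types (f g : R * R -> R).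

(** The partial derivatives are explicit arguments, so that the product and
    chain rules compute them. *)
Definition C1on f f1 f2 :=
  [/\ conton D f, conton D f1, conton D f2,
      forall x, D x -> is_derive x (dir false) f (f1 x) &
      forall x, D x -> is_derive x (dir true) f (f2 x)].

Definition pd (j : bool) f (x : R * R) : R := 'D_(dir j) f x.

Lemma Ck1_derive f j x : Ck 1 f -> is_derive x (dir j) f (pd j f x).
Proof. by move=> [_ /(_ j) [df _]]; split. Qed.

Lemma Ck1_continuous f : Ck 1 f -> continuous f.
Proof. by case. Qed.

Lemma Ck1_pd_continuous f j : Ck 1 f -> continuous (pd j f).
Proof. by move=> [_ /(_ j) [_ []]]. Qed.

Lemma Ck1_C1on f : Ck 1 f -> C1on f (pd false f) (pd true f).
Proof.
move=> hf; split=> x _; try exact: Ck1_derive.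
- exact: Ck1_continuous.
- exact: Ck1_pd_continuous.
- exact: Ck1_pd_continuous.
Qed.

Lemma C1onM f f1 f2 g g1 g2 : C1on f f1 f2 -> C1on g g1 g2 ->
  C1on (fun x => f x * g x) (fun x => f x * g1 x + g x * f1 x) (fun x => f x * g2 x + g x * f2 x).
Proof.
move=> [cf cf1 cf2 df1 df2] [cg cg1 cg2 dg1 dg2]; split.
- exact: ccontM.
- by apply: ccontD; exact: ccontM.
- by apply: ccontD; exact: ccontM.
- by move=> x tx; apply: derM; [exact: df1|exact: dg1].
- by move=> x tx; apply: derM; [exact: df2|exact: dg2].
Qed.

Lemma C1onD f f1 f2 g g1 g2 : C1on f f1 f2 -> C1on g g1 g2 ->
  C1on (fun x => f x + g x) (fun x => f1 x + g1 x) (fun x => f2 x + g2 x).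
Proof.
move=> [cf cf1 cf2 df1 df2] [cg cg1 cg2 dg1 dg2]; split.
- exact: ccontD.
- exact: ccontD.
- exact: ccontD.
- by move=> x tx; apply: derD; [exact: df1|exact: dg1].
- by move=> x tx; apply: derD; [exact: df2|exact: dg2].
Qed.

Lemma C1on_lin (c1 c2 c0 : R) :
  C1on (fun x => c1 * x.1 + c2 * x.2 + c0) (fun=> c1) (fun=> c2).
Proof.
split; try by move=> x _; exact: cvg_cst.
- by move=> x _; exact: cont_lin.
- by move=> x _; exact: (der_coord c1 c2 c0 x false).
- by move=> x _; exact: (der_coord c1 c2 c0 x true).
Qed.

Lemma C1on_cst (c : R) : C1on (fun=> c) (fun=> 0) (fun=> 0).
Proof.
by split=> x _; try exact: cvg_cst; exact: is_derive_cst.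
Qed.

Lemma C1on_eq f f1 f2 g g1 g2 : C1on f f1 f2 -> f =1 g -> f1 =1 g1 -> f2 =1 g2 ->
  C1on g g1 g2.
Proof. by move=> h /funext <- /funext <- /funext <-. Qed.

Lemma C1onV f f1 f2 : (forall x, D x -> f x != 0) -> C1on f f1 f2 ->
  C1on (fun x => (f x)^-1) (fun x => - (f x) ^- 2 * f1 x) (fun x => - (f x) ^- 2 * f2 x).
Proof.
move=> f0 [cf cf1 cf2 df1 df2].
have c2 : conton D (fun x => - (f x) ^- 2).
  by apply: ccontN; apply: ccontV; [move=> x tx; rewrite expf_neq0// f0|exact: ccontX].
split.
- exact: ccontV.
- exact: ccontM.
- exact: ccontM.
- by move=> x tx; apply: derV; [exact: f0|exact: df1].
- by move=> x tx; apply: derV; [exact: f0|exact: df2].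
Qed.

End C1On.

Section C1Triangle.
Context {R : realType} (a b : R) (a0 : 0 < a) (b0 : 0 < b).
Implicit Types (f g : R * R -> R).
Notation mu := (@lebesgue_measure R).
Notation ccont := (conton (ctri a b)).
Notation ctri := (ctri a b).
Notation tri := (tri a b).
Notation C1on := (C1on ctri).

(** The integral over the boundary with respect to the parameter of each
    side, which is comparable to arc length. *)
Definition bdint f : R := \int[mu]_(t in `[0, 1]) f (param a b AB t) +
  (\int[mu]_(t in `[0, 1]) f (param a b OA t) + \int[mu]_(t in `[0, 1]) f (param a b OB t)).

Lemma ccont_integrable_side f s : ccont f ->
  mu.-integrable `[0, 1] (EFin \o (fun t => f (param a b s t))).
Proof. by move=> cf; apply: integrable_itv01 => t; exact: (@ccont_param _ a b a0 b0 f s). Qed.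

Lemma ccont_norm f : ccont f -> ccont (fun x => `|f x|).
Proof. by move=> cf x tx; apply: cvg_norm; exact: cf. Qed.

Lemma side_weight_le f g (M : R) s : ccont f -> ccont g -> (forall x, ctri x -> `|g x| <= M) ->
  `|\int[mu]_(t in `[0, 1]) (f (param a b s t) * g (param a b s t))| <=
  M * \int[mu]_(t in `[0, 1]) `|f (param a b s t)|.
Proof.
move=> cf cg gM.
have i1 := ccont_integrable_side s (ccontM cf cg).
have i2 := ccont_integrable_side s (ccont_norm cf).
rewrite (le_trans (le_normr_Rintegral _ i1))// -RintegralZl//.
apply: le_Rintegral => //.
- exact: (ccont_integrable_side s (ccont_norm (ccontM cf cg))).
- by have := ccont_integrable_side s (ccontM (@ccont_cst _ ctri M) (ccont_norm cf)).
- move=> t t01; rewrite normrM mulrC ler_wpM2r//; apply: gM.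
  exact: (param_ctri a0 b0).
Qed.

(** If [Phi] were of class C^2, the Jacobian [W1 * d2 Phi - W2 * d1 Phi] would
    be the divergence of [(W * d2 Phi, - W * d1 Phi)], and the estimate would
    follow from the divergence theorem.  For [Phi] of class C^1 the partial
    derivatives are replaced by their averages [E] and [F] over a length [h]
    in the first direction: the derivative of [E] in the first direction and
    that of [F] in the second one are the same difference quotient, so that
    [(W * E, - W * F)] has the right divergence, and [E], [F] are uniformly
    close to the partial derivatives.  The constant does not depend on [W],
    which allows approximations of [W^{1,2}] functions. *)
Lemma jacobian_le_bd (Phi : R * R -> R) : Ck 1 Phi ->
  exists2 C : R, 0 <= C & forall W W1 W2, C1on W W1 W2 ->
    `|\int[leb2]_(x in tri) (W1 x * pd true Phi x - W2 x * pd false Phi x)| <=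
    C * bdint (fun x => `|W x|).
Proof.
move=> hP; set g1 := pd false Phi; set g2 := pd true Phi.
have cg1 : continuous g1 := Ck1_pd_continuous hP.
have cg2 : continuous g2 := Ck1_pd_continuous hP.
have cP : continuous Phi := Ck1_continuous hP.
have ccg1 : ccont g1 by move=> x _; exact: cg1.
have ccg2 : ccont g2 by move=> x _; exact: cg2.
have [M1 M10 gM1] := ccont_bounded a0 b0 ccg1.
have [M2 M20 gM2] := ccont_bounded a0 b0 ccg2.
pose M := M1 + M2 + 1.
have M0 : 0 <= M by rewrite /M !addr_ge0// ltW.
exists (M * (a + b)) => [|W W1 W2 [cW cW1 cW2 dW1 dW2]].
  by rewrite mulr_ge0// addr_ge0// ltW.
set K := \int[leb2]_(x in tri) (`|W1 x| + `|W2 x|).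
have K0 : 0 <= K by apply: Rintegral_ge0 => x _; rewrite addr_ge0.
suff main (e : R) : 0 < e -> e <= 1 ->
  `|\int[leb2]_(x in tri) (W1 x * g2 x - W2 x * g1 x)| <= M * (a + b) * bdint (fun x => `|W x|) + e * K.
  apply/ler_addgt0Pr => e e0.
  (* [K] bounds the error made by the averages, and may be 0 *)
  pose e' := Num.min 1 (e / (K + 1)).
  have K1 : 0 < K + 1 by lra.
  have e'0 : 0 < e' by rewrite lt_min ltr01 divr_gt0.
  have e'1 : e' <= 1 by rewrite ge_min lexx.
  rewrite (le_trans (main e' e'0 e'1))// lerD2l.
  have : e' <= e / (K + 1) by rewrite ge_min lexx orbT.
  rewrite ler_pdivlMr// => h; rewrite (le_trans _ h)// ler_wpM2l// ?ltW//.
  lra.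
move=> e0 e1.
have eM1 : e + M1 <= M by rewrite /M; lra.
have eM2 : e + M2 <= M by rewrite /M; lra.
have [h [h0 u1 u2]] : exists h : R, [/\ 0 < h, forall z, ctri z -> `|avg h g1 z - g1 z| <= e &
    forall z, ctri z -> `|avg h g2 z - g2 z| <= e].
  have h1 := avg_unif (compact_ctri a0 b0) cg1 e0.
  have h2 := avg_unif (compact_ctri a0 b0) cg2 e0.
  have nb : nbhs (0 : R) [set h | (forall z, ctri z -> `|avg h g1 z - g1 z| <= e) /\
     (forall z, ctri z -> `|avg h g2 z - g2 z| <= e)] by exact: filterI h1 h2.
  have [d /= d0 hd] := (nbhs_ballP (0 : R) _).1 nb.
  have d2 : ball (0 : R) d (d / 2).
    by rewrite /ball/= sub0r normrN gtr0_norm ?divr_gt0// ltr_pdivrMr// ltr_pMr// ltr1n.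
  have [H1 H2] := hd _ d2.
  by exists (d / 2); split => //; rewrite divr_gt0.
set E := avg h g2; set F := avg h g1.
have cE : ccont E by move=> x _; exact: continuous_avg.
have cF : ccont F by move=> x _; exact: continuous_avg.
pose D z := h^-1 * (g2 (z.1 + h, z.2) - g2 z).
have cD : ccont D.
  apply: ccontM; first exact: ccont_cst.
  by apply: ccontB ccg2 => x _; exact: continuous_shift.
have dE x : ctri x -> is_derive x (dir false) E (D x).
  by move=> [x0 _ _]; exact: der_avg.
have FE : (fun z => h^-1 * (Phi (z.1 + h, z.2) - Phi z)) =1 F.
  by move=> z; apply/esym/avg_difference => // x; exact: Ck1_derive.
have dF x : ctri x -> is_derive x (dir true) F (D x).
  move=> _; have dP := Ck1_derive true x hP.
  have dS : is_derive x (dir true) (fun z => Phi (z.1 + h, z.2)) (g2 (x.1 + h, x.2)).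
    case: x {dP} => x y; apply/is_derive_dir2 => /=.
    by have := Ck1_derive true (x + h, y) hP => /is_derive_dir2.
  apply: (der_eq (derM (is_derive_cst h^-1 x (dir true)) (derB dS dP))) => //.
  by rewrite mulr0 addr0.
have {}u2 z : ctri z -> `|E z - g2 z| <= e := u2 z.
have {}u1 z : ctri z -> `|F z - g1 z| <= e := u1 z.
clear FE; clearbody E F D.
have gr1 := green1 a0 b0 (ccontM cW cE) (ccontD (ccontM cW cD) (ccontM cE cW1))
  (fun x tx => derM (dW1 x tx) (dE x tx)).
have gr2 := green2 a0 b0 (ccontM cW cF) (ccontD (ccontM cW cD) (ccontM cF cW2))
  (fun x tx => derM (dW2 x tx) (dF x tx)).
have eq1 : \int[leb2]_(x in tri) (W1 x * E x - W2 x * F x) =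
   b * (\int[mu]_(t in `[0, 1]) (W (param a b AB t) * E (param a b AB t)) -
        \int[mu]_(t in `[0, 1]) (W (param a b OB t) * E (param a b OB t))) -
   a * (\int[mu]_(t in `[0, 1]) (W (param a b AB t) * F (param a b AB t)) -
        \int[mu]_(t in `[0, 1]) (W (param a b OA t) * F (param a b OA t))).
  rewrite -gr1 -gr2 -RintegralB//.
  - by apply: eq_Rintegral => x _; ring.
  - exact: measurable_tri.
  - exact: ccont_integrable (ccontD (ccontM cW cD) (ccontM cE cW1)).
  - exact: ccont_integrable (ccontD (ccontM cW cD) (ccontM cF cW2)).
have EM x : ctri x -> `|E x| <= M.
  move=> tx; rewrite -(subrK (g2 x) (E x)) (le_trans (ler_normD _ _))//.
  by apply: le_trans eM2; apply: lerD; [exact: u2|exact: gM2].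
have FM x : ctri x -> `|F x| <= M.
  move=> tx; rewrite -(subrK (g1 x) (F x)) (le_trans (ler_normD _ _))//.
  by apply: le_trans eM1; apply: lerD; [exact: u1|exact: gM1].
have bnd : `|\int[leb2]_(x in tri) (W1 x * E x - W2 x * F x)| <= M * (a + b) * bdint (fun x => `|W x|).
  rewrite eq1.
  have := side_weight_le AB cW cE EM; have := side_weight_le OB cW cE EM.
  have := side_weight_le AB cW cF FM; have := side_weight_le OA cW cF FM.
  have bd0 s : 0 <= \int[mu]_(t in `[0, 1]) `|W (param a b s t)| by apply: Rintegral_ge0.
  have := bd0 AB; have := bd0 OA; have := bd0 OB; rewrite /bdint.
  move: (\int[mu]_(t in `[0, 1]) `|W (param a b AB t)|) (\int[mu]_(t in `[0, 1]) `|W (param a b OA t)|)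
    (\int[mu]_(t in `[0, 1]) `|W (param a b OB t)|) => w1 w2 w3.
  move: (\int[mu]_(t in `[0, 1]) (W (param a b AB t) * E (param a b AB t)))
   (\int[mu]_(t in `[0, 1]) (W (param a b OB t) * E (param a b OB t)))
   (\int[mu]_(t in `[0, 1]) (W (param a b AB t) * F (param a b AB t)))
   (\int[mu]_(t in `[0, 1]) (W (param a b OA t) * F (param a b OA t))) => t1 t2 t3 t4 w30 w20 w10 q4 q3 q2 q1.
  rewrite (le_trans (ler_normB _ _))// !normrM (gtr0_norm a0) (gtr0_norm b0).
  apply: (@le_trans _ _ (b * (M * w1 + M * w3) + a * (M * w1 + M * w2))).
    by apply: lerD; [apply: (ler_wpM2l (ltW b0))|apply: (ler_wpM2l (ltW a0))];
      apply: (le_trans (ler_normB _ _)); exact: lerD.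
  rewrite -!mulrDr -subr_ge0.
  rewrite (_ : _ - _ = M * (a * w3 + b * w2)); last by ring.
  by rewrite mulr_ge0// addr_ge0// mulr_ge0// ltW.
have iE : L1 tri (fun x => W1 x * E x - W2 x * F x).
  exact: ccont_integrable (ccontB (ccontM cW1 cE) (ccontM cW2 cF)).
have ig : L1 tri (fun x => W1 x * g2 x - W2 x * g1 x).
  exact: ccont_integrable (ccontB (ccontM cW1 ccg2) (ccontM cW2 ccg1)).
have iD : L1 tri (fun x => W1 x * (g2 x - E x) - W2 x * (g1 x - F x)).
  exact: ccont_integrable (ccontB (ccontM cW1 (ccontB ccg2 cE)) (ccontM cW2 (ccontB ccg1 cF))).
have mT := measurable_tri a b.
have -> : \int[leb2]_(x in tri) (W1 x * g2 x - W2 x * g1 x) =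
   \int[leb2]_(x in tri) (W1 x * E x - W2 x * F x) +
   \int[leb2]_(x in tri) (W1 x * (g2 x - E x) - W2 x * (g1 x - F x)).
  by rewrite -RintegralD//; apply: eq_Rintegral => x _; ring.
rewrite (le_trans (ler_normD _ _))// lerD//.
rewrite (le_trans (le_normr_Rintegral _ iD))// /K -RintegralZl//; last first.
  exact: ccont_integrable (ccontD (ccont_norm cW1) (ccont_norm cW2)).
apply: le_Rintegral => //.
- by apply: ccont_integrable => //; apply: ccont_norm;
  exact: (ccontB (ccontM cW1 (ccontB ccg2 cE)) (ccontM cW2 (ccontB ccg1 cF))).
- exact: ccont_integrable (ccontM (@ccont_cst _ ctri e) (ccontD (ccont_norm cW1) (ccont_norm cW2))).
- move=> x /tri_sub_ctri tx; rewrite (le_trans (ler_normB _ _))// !normrM mulrDr [e * _]mulrC [e * `|W2 x|]mulrC.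
  by apply: lerD; rewrite ler_wpM2l// distrC; [exact: u2|exact: u1].
Unshelve. all: by end_near. Qed.

(** Expand [0 <= (f2 - q * f) ^+ 2] and integrate the cross term [2 q f f2] by
    parts. *)
Lemma riccati2 f f1 f2 q q2 : C1on f f1 f2 -> ccont q -> ccont q2 ->
  (forall x, ctri x -> is_derive x (dir true) q (q2 x)) ->
  a * (\int[mu]_(t in `[0, 1]) (q (param a b AB t) * f (param a b AB t) ^+ 2) -
       \int[mu]_(t in `[0, 1]) (q (param a b OA t) * f (param a b OA t) ^+ 2)) <=
  \int[leb2]_(x in tri) (f2 x ^+ 2) + \int[leb2]_(x in tri) ((q2 x + q x ^+ 2) * f x ^+ 2).
Proof.
move=> [cf cf1 cf2 df1 df2] cq cq2 dq.
have cG := ccontD (ccontM cq (ccontD (ccontM cf cf2) (ccontM cf cf2))) (ccontM (ccontM cf cf) cq2).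
have gr := green2 a0 b0 (ccontM cq (ccontM cf cf)) cG
  (fun x tx => derM (dq x tx) (derM (df2 x tx) (df2 x tx))).
under [X in _ * (X - _)]eq_Rintegral do rewrite expr2.
under [X in _ * (_ - X)]eq_Rintegral do rewrite expr2.
rewrite -gr -RintegralD//; last 3 first.
- exact: measurable_tri.
- exact: ccont_integrable (@ccontX _ ctri _ 2 cf2).
- exact: ccont_integrable (ccontM (ccontD cq2 (@ccontX _ ctri _ 2 cq)) (@ccontX _ ctri _ 2 cf)).
apply: le_Rintegral => //.
- exact: measurable_tri.
- exact: (ccont_integrable a0 b0 cG).
- exact: ccont_integrable (ccontD (@ccontX _ ctri _ 2 cf2) (ccontM (ccontD cq2 (@ccontX _ ctri _ 2 cq)) (@ccontX _ ctri _ 2 cf))).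
- by move=> x _; have := sqr_ge0 (f2 x - q x * f x); nra.
Qed.

Lemma riccati1 f f1 f2 q q1 : C1on f f1 f2 -> ccont q -> ccont q1 ->
  (forall x, ctri x -> is_derive x (dir false) q (q1 x)) ->
  b * (\int[mu]_(t in `[0, 1]) (q (param a b AB t) * f (param a b AB t) ^+ 2) -
       \int[mu]_(t in `[0, 1]) (q (param a b OB t) * f (param a b OB t) ^+ 2)) <=
  \int[leb2]_(x in tri) (f1 x ^+ 2) + \int[leb2]_(x in tri) ((q1 x + q x ^+ 2) * f x ^+ 2).
Proof.
move=> [cf cf1 cf2 df1 df2] cq cq1 dq.
have cG := ccontD (ccontM cq (ccontD (ccontM cf cf1) (ccontM cf cf1))) (ccontM (ccontM cf cf) cq1).
have gr := green1 a0 b0 (ccontM cq (ccontM cf cf)) cG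
  (fun x tx => derM (dq x tx) (derM (df1 x tx) (df1 x tx))).
under [X in _ * (X - _)]eq_Rintegral do rewrite expr2.
under [X in _ * (_ - X)]eq_Rintegral do rewrite expr2.
rewrite -gr -RintegralD//; last 3 first.
- exact: measurable_tri.
- exact: ccont_integrable (@ccontX _ ctri _ 2 cf1).
- exact: ccont_integrable (ccontM (ccontD cq1 (@ccontX _ ctri _ 2 cq)) (@ccontX _ ctri _ 2 cf)).
apply: le_Rintegral => //.
- exact: measurable_tri.
- exact: (ccont_integrable a0 b0 cG).
- exact: ccont_integrable (ccontD (@ccontX _ ctri _ 2 cf1) (ccontM (ccontD cq1 (@ccontX _ ctri _ 2 cq)) (@ccontX _ ctri _ 2 cf))).
- by move=> x _; have := sqr_ge0 (f1 x - q x * f x); nra.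
Qed.

End C1Triangle.

(** * The weighted Jacobian form and its insensitivity to trace zero *)

Section C1Intro.
Context {R : realType}.
Implicit Types (f : R * R -> R).

Lemma C1on_Ck1 f f1 f2 : C1on setT f f1 f2 -> Ck 1 f.
Proof.
move=> [cf cf1 cf2 df1 df2]; split; first by move=> x; exact: cf.
case; split.
- by move=> x; have [] := df2 x I.
- split => //; rewrite (_ : (fun _ => _) = f2); first by move=> x; exact: cf2.
  by apply/funext => x; apply: derive_val; exact: df2.
- by move=> x; have [] := df1 x I.
- split => //; rewrite (_ : (fun _ => _) = f1); first by move=> x; exact: cf1.
  by apply/funext => x; apply: derive_val; exact: df1.
Qed.

Lemma C1on_pd D f f1 f2 : C1on D f f1 f2 ->
  {in D, pd false f =1 f1} /\ {in D, pd true f =1 f2}.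
Proof.
move=> [_ _ _ df1 df2]; split => x /set_mem Dx; apply: derive_val; [exact: df1|exact: df2].
Qed.

Lemma C1onS D f f1 f2 : C1on setT f f1 f2 -> C1on D f f1 f2.
Proof.
move=> [cf cf1 cf2 df1 df2]; split => x _; [exact: cf|exact: cf1|exact: cf2|exact: df1|exact: df2].
Qed.

Lemma Ck1_C1onS D f : Ck 1 f -> C1on D f (pd false f) (pd true f).
Proof. by move=> h; apply: C1onS; exact: Ck1_C1on. Qed.

Lemma Ck1_comb f g (c d : R) : Ck 1 f -> Ck 1 g -> Ck 1 (fun x => c * f x + d * g x) /\
  forall j, pd j (fun x => c * f x + d * g x) = (fun x => c * pd j f x + d * pd j g x).
Proof.
move=> hf hg.
have h := C1onD (C1onM (C1on_cst setT c) (Ck1_C1on setT hf)) (C1onM (C1on_cst setT d) (Ck1_C1on setT hg)).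
split; first exact: C1on_Ck1 h.
have [h1 h2] := C1on_pd h.
by case; apply/funext => x; rewrite ?h1 ?h2 ?inE// !mulr0 !addr0.
Qed.

End C1Intro.

(** With [c] a weight, [p], [q] functions, and the suffixes 1, 2 their partial
    derivatives, this is
    [2 c jac(p, q) + p jac(c, q) - q jac(c, p)].  It is antisymmetric in
    [(p, q)], hence unchanged when a constant rotation is applied to the pair
    of functions, and for [c = 1] it is twice the Jacobian. *)
Definition kform {R : realType} (c c1 c2 p p1 p2 q q1 q2 : R) : R :=
  2 * c * (p1 * q2 - p2 * q1) + p * (c1 * q2 - c2 * q1) - q * (c1 * p2 - c2 * p1).

Section Limits.
Context {R : realType} (a b : R) (a0 : 0 < a) (b0 : 0 < b).
Notation mu := (@lebesgue_measure R).
Notation ctri := (ctri a b).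
Notation ccont := (conton ctri).
Notation tri := (tri a b).
Notation sqc := (@sqcvg _ _ R (@leb2 R) tri).
Notation intc := (@intcvg _ _ R (@leb2 R) tri).

(** Convergence of a sequence of C^1 functions in [W^{1,2}]; [f1] and [f2] are
    the limits of the partial derivatives. *)
Definition h1lim (f_ : nat -> R * R -> R) (f f1 f2 : R * R -> R) :=
  [/\ forall n, Ck 1 (f_ n), sqc f_ f, sqc (fun n => pd false (f_ n)) f1 &
      sqc (fun n => pd true (f_ n)) f2].

Definition trace_to s (f_ : nat -> R * R -> R) (g : R -> R) :=
  sqcvg mu `[0, 1] (fun n t => f_ n (param a b s t)) g.

Lemma h1lim_comb (f_ g_ : nat -> R * R -> R) f f1 f2 g g1 g2 (c d : R) :
  h1lim f_ f f1 f2 -> h1lim g_ g g1 g2 ->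
  h1lim (fun n x => c * f_ n x + d * g_ n x) (fun x => c * f x + d * g x)
    (fun x => c * f1 x + d * g1 x) (fun x => c * f2 x + d * g2 x).
Proof.
move=> [cf sf sf1 sf2] [cg sg sg1 sg2]; split.
- by move=> n; have [] := Ck1_comb c d (cf n) (cg n).
- by apply: sqcvg_comb => //; exact: measurable_tri.
- rewrite (_ : (fun n => _) = fun n x => c * pd false (f_ n) x + d * pd false (g_ n) x).
    by apply: sqcvg_comb => //; exact: measurable_tri.
  by apply/funext => n; have [_ ->] := Ck1_comb c d (cf n) (cg n).
- rewrite (_ : (fun n => _) = fun n x => c * pd true (f_ n) x + d * pd true (g_ n) x).
    by apply: sqcvg_comb => //; exact: measurable_tri.
  by apply/funext => n; have [_ ->] := Ck1_comb c d (cf n) (cg n).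
Qed.

Lemma trace_comb s (f_ g_ : nat -> R * R -> R) f g (c d : R) :
  trace_to s f_ f -> trace_to s g_ g ->
  trace_to s (fun n x => c * f_ n x + d * g_ n x) (fun x => c * f x + d * g x).
Proof. by move=> cf cg; apply: sqcvg_comb. Qed.

Lemma ccont_intcvg (r : R * R -> R) (f_ g_ : nat -> R * R -> R) f g :
  ccont r -> sqc f_ f -> sqc g_ g ->
  intc (fun n x => r x * (f_ n x * g_ n x)) (fun x => r x * (f x * g x)).
Proof.
move=> cr cf cg; have [M rM] := ccont_weight a0 b0 cr.
by apply: intcvg_mul rM cf cg; exact: measurable_tri.
Qed.

Lemma kform_intcvg (c c1 c2 : R * R -> R) (p_ p1_ p2_ q_ q1_ q2_ : nat -> R * R -> R)
    (p p1 p2 q q1 q2 : R * R -> R) : ccont c -> ccont c1 -> ccont c2 ->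
  sqc p_ p -> sqc p1_ p1 -> sqc p2_ p2 -> sqc q_ q -> sqc q1_ q1 -> sqc q2_ q2 ->
  intc (fun n x => kform (c x) (c1 x) (c2 x) (p_ n x) (p1_ n x) (p2_ n x) (q_ n x) (q1_ n x) (q2_ n x))
   (fun x => kform (c x) (c1 x) (c2 x) (p x) (p1 x) (p2 x) (q x) (q1 x) (q2 x)).
Proof.
move=> hc hc1 hc2 hp hp1 hp2 hq hq1 hq2.
have mT := measurable_tri a b.
have k2 : ccont (fun x => 2 * c x) by apply: ccontM => //; exact: ccont_cst.
have i1 := ccont_intcvg k2 hp1 hq2.
have i2 := ccont_intcvg (ccontN k2) hp2 hq1.
have i3 := ccont_intcvg hc1 hp hq2.
have i4 := ccont_intcvg (ccontN hc2) hp hq1.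
have i5 := ccont_intcvg (ccontN hc1) hq hp2.
have i6 := ccont_intcvg hc2 hq hp1.
apply: (intcvg_eq mT (intcvgD mT (intcvgD mT (intcvgD mT (intcvgD mT (intcvgD mT i1 i2) i3) i4) i5) i6)).
- by move=> n x _; rewrite /kform; ring.
- by move=> x _; rewrite /kform; ring.
Qed.

(** On the sides other than [s] the weight [r] vanishes, and on [s] the trace
    of [w] does. *)
Lemma bdint_cvg0 s (r : R * R -> R) (w_ g_ : nat -> R * R -> R) (g : R -> R) :
  ccont r -> (forall s' t, s' <> s -> t \in `[0, 1] -> r (param a b s' t) = 0) ->
  trace_to s w_ (fun=> 0) -> trace_to s g_ g ->
  (fun n => bdint a b (fun x => `|r x * w_ n x * g_ n x|)) @ \oo --> (0 : R).
Proof.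
move=> cr r0 cw cg.
have cside s' : (fun n => \int[mu]_(t in `[0, 1]) `|r (param a b s' t) * w_ n (param a b s' t) * g_ n (param a b s' t)|)
   @ \oo --> (0 : R).
  have [->|s's] := pselect (s' = s).
    have [M M0 rM] := ccont_bounded a0 b0 (ccont_norm cr).
    have rw : bounded_weight (`[0, 1] : set (measurableTypeR R)) (fun t => `|r (param a b s t)|) M.
      split; last by move=> t t01; apply: rM; exact: (param_ctri a0 b0).
      apply: (@subspace_continuous_measurable_fun R) => //.
      apply: continuous_in_subspaceT => t /set_mem t01; apply: cvg_norm.
      exact: (@ccont_param _ a b a0 b0 r s).
    have m01 : measurable (`[0, 1]%classic : set (measurableTypeR R)) := measurable_itv _.
    have := sqcvg_mul m01 rw (sqcvg_norm m01 cw) (sqcvg_norm m01 cg).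
    rewrite (_ : \int[mu]_(x in _) _ = 0); last first.
      rewrite -[RHS](Rintegral01_cst (0 : R)); apply: eq_Rintegral => t _.
      by rewrite normr0 mul0r mulr0.
    by under eq_fun do under eq_Rintegral do rewrite -normrM -normrM mulrA.
  rewrite (_ : (fun n => _) = fun=> 0); first exact: cvg_cst.
  apply/funext => n; rewrite -[RHS](Rintegral01_cst (0 : R)); apply: eq_Rintegral => t t01.
  by rewrite r0 ?mul0r ?normr0//; exact: set_mem.
rewrite -[X in _ --> X](_ : 0 + (0 + 0) = 0); last by rewrite !addr0.
by apply: cvgD; [exact: cside|apply: cvgD; exact: cside].
Qed.

(** The double limit is taken one variable at a time: [jacobian_le_bd] needs a
    fixed C^1 function in the second place, so first [W_n] converges, and then
    [g_m]. *)
Lemma jacobian_limit0 (W_ W1_ W2_ : nat -> R * R -> R) (W1 W2 : R * R -> R)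
    (g_ : nat -> R * R -> R) g g1 g2 :
  (forall n, C1on ctri (W_ n) (W1_ n) (W2_ n)) -> sqc W1_ W1 -> sqc W2_ W2 ->
  (fun n => bdint a b (fun x => `|W_ n x|)) @ \oo --> (0 : R) ->
  h1lim g_ g g1 g2 ->
  \int[leb2]_(x in tri) (W1 x * g2 x - W2 x * g1 x) = 0.
Proof.
move=> cW sW1 sW2 bW [cg sg sg1 sg2].
have mT := measurable_tri a b.
have w1 : ccont (fun=> 1) by exact: ccont_cst.
have wm : ccont (fun=> -1) by exact: ccont_cst.
have icv (p_ q_ r_ t_ : nat -> R * R -> R) p q r t : sqc p_ p -> sqc q_ q -> sqc r_ r -> sqc t_ t ->
    (fun n => \int[leb2]_(x in tri) (p_ n x * q_ n x - r_ n x * t_ n x)) @ \oo -->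
    \int[leb2]_(x in tri) (p x * q x - r x * t x).
  move=> hp hq hr ht.
  have [_ _] : intc (fun n x => p_ n x * q_ n x - r_ n x * t_ n x) (fun x => p x * q x - r x * t x).
    apply: (intcvg_eq mT (intcvgD mT (ccont_intcvg w1 hp hq) (ccont_intcvg wm hr ht))).
    - by move=> n x _; rewrite mul1r mulN1r.
    - by move=> x _; rewrite mul1r mulN1r.
  by [].
have z m : \int[leb2]_(x in tri) (W1 x * pd true (g_ m) x - W2 x * pd false (g_ m) x) = 0.
  have [C C0 HC] := jacobian_le_bd a0 b0 (cg m).
  have s1 : sqint (@leb2 R) tri (pd false (g_ m)) by have [h _ _] := sg1; exact: h.
  have s2 : sqint (@leb2 R) tri (pd true (g_ m)) by have [h _ _] := sg2; exact: h.
  have L := icv _ _ _ _ _ _ _ _ sW1 (sqcvg_const mT s2) sW2 (sqcvg_const mT s1).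
  apply: (cvg_unique (@Rhausdorff R) L).
  apply: norm_cvg0; apply: (@squeeze_cvgr _ _ _ _ (fun=> 0) (fun n => C * bdint a b (fun x => `|W_ n x|))).
  - by apply: nearW => n; rewrite normr_ge0/=; exact: HC (cW n).
  - exact: cvg_cst.
  - by rewrite -[X in _ --> X](mulr0 C); apply: cvgM => //; exact: cvg_cst.
have [h1 h2 _] := sW1; have [k1 k2 _] := sW2.
have L := icv _ _ _ _ _ _ _ _ (sqcvg_const mT h2) sg2 (sqcvg_const mT k2) sg1.
apply: (cvg_unique (@Rhausdorff R) L).
rewrite (_ : (fun n => _) = fun=> 0); first exact: cvg_cst.
by apply/funext => n; exact: z.
Qed.

(** The form with weight [p * k] equals
    [2 jac(p k w, g) - jac(k, p w g) - jac(p, k w g)].  In the first Jacobian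
    the function [p k w] has zero boundary values in the limit
    ([jacobian_limit0]); in the other two a fixed C^1 function faces a product
    with the same property ([jacobian_le_bd]).  Splitting the weight into two
    factors is what makes this possible: [w g] itself does not vanish on the
    sides other than [s], but the factor that stays with it does. *)
Lemma kform_trace0 s (p k : R * R -> R) p1 p2 k1 k2 (w_ g_ : nat -> R * R -> R) w w1 w2 g g1 g2 (tg : R -> R) :
  C1on setT p p1 p2 -> C1on setT k k1 k2 ->
  (forall s' t, s' <> s -> t \in `[0, 1] -> p (param a b s' t) = 0) ->
  (forall s' t, s' <> s -> t \in `[0, 1] -> k (param a b s' t) = 0) ->
  h1lim w_ w w1 w2 -> h1lim g_ g g1 g2 -> trace_to s w_ (fun=> 0) -> trace_to s g_ tg ->
  \int[leb2]_(x in tri) kform (p x * k x) (p x * k1 x + k x * p1 x) (p x * k2 x + k x * p2 x)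
     (w x) (w1 x) (w2 x) (g x) (g1 x) (g2 x) = 0.
Proof.
move=> hp hk p0 k0 hw hg tw tg0.
have mT := measurable_tri a b.
have [cw sw sw1 sw2] := hw; have [cg sg sg1 sg2] := hg.
have [Hp Hp1 Hp2 _ _] := C1onS ctri hp; have [Hk Hk1 Hk2 _ _] := C1onS ctri hk.
have Hc := ccontM Hp Hk.
have Hc1 := ccontD (ccontM Hp Hk1) (ccontM Hk Hp1).
have Hc2 := ccontD (ccontM Hp Hk2) (ccontM Hk Hp2).
have [_ iK L] := kform_intcvg Hc Hc1 Hc2 sw sw1 sw2 sg sg1 sg2.
apply: (cvg_unique (@Rhausdorff R) L) => {L}.
have cpk := C1onM (C1onS ctri hp) (C1onS ctri hk).
have cW n := C1onM cpk (Ck1_C1onS ctri (cw n)).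
have sWi (c d : R * R -> R) (f_ h_ : nat -> R * R -> R) f h : ccont c -> ccont d -> sqc f_ f -> sqc h_ h ->
    sqc (fun n x => c x * f_ n x + h_ n x * d x) (fun x => c x * f x + h x * d x).
  move=> Hc' Hd sf sh; have [M cM] := ccont_weight a0 b0 Hc'; have [N dN] := ccont_weight a0 b0 Hd.
  have sc := sqcvg_comb mT 1 1 (sqcvg_weight mT cM sf) (sqcvg_weight mT dN sh).
  apply: (sqcvg_eq mT sc).
  - by move=> n x _; rewrite !mul1r [d x * _]mulrC.
  - by move=> x _; rewrite !mul1r [d x * _]mulrC.
have sW1 := sWi _ _ _ _ _ _ Hc Hc1 sw1 sw.
have sW2 := sWi _ _ _ _ _ _ Hc Hc2 sw2 sw.
have tone : trace_to s (fun _ _ => 1) (fun=> 1).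
  apply: sqcvg_const => //; split; first exact: measurable_cst.
  by apply: integrable_itv01 => t _; exact: cvg_cst.
have bW : (fun n => bdint a b (fun x => `|p x * k x * w_ n x|)) @ \oo --> (0 : R).
  have := @bdint_cvg0 s (fun x => p x * k x) w_ (fun _ _ => 1) (fun=> 1) Hc _ tw tone.
  under eq_fun do under eq_fun do rewrite mulr1.
  by apply => s' t s's t01; rewrite p0 ?mul0r.
have J0 := jacobian_limit0 cW sW1 sW2 bW hg.
have [iJ _ LJ] : intc
  (fun n x => (p x * k x * pd false (w_ n) x + w_ n x * (p x * k1 x + k x * p1 x)) * pd true (g_ n) x -
     (p x * k x * pd true (w_ n) x + w_ n x * (p x * k2 x + k x * p2 x)) * pd false (g_ n) x)
  (fun x => (p x * k x * w1 x + w x * (p x * k1 x + k x * p1 x)) * g2 x -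
     (p x * k x * w2 x + w x * (p x * k2 x + k x * p2 x)) * g1 x).
  apply: (intcvg_eq mT (intcvgD mT (ccont_intcvg (@ccont_cst _ ctri 1) sW1 sg2)
     (ccont_intcvg (@ccont_cst _ ctri (-1)) sW2 sg1))).
  - by move=> n x _; rewrite mul1r mulN1r.
  - by move=> x _; rewrite mul1r mulN1r.
rewrite J0 in LJ.
have [Cp Cp0 HCp] := jacobian_le_bd a0 b0 (C1on_Ck1 hp).
have [Ck0 Ck00 HCk] := jacobian_le_bd a0 b0 (C1on_Ck1 hk).
have bp := bdint_cvg0 Hp p0 tw tg0; have bk := bdint_cvg0 Hk k0 tw tg0.
have cwg n := C1onM (Ck1_C1onS ctri (cw n)) (Ck1_C1onS ctri (cg n)).
have cA n := C1onM (C1onS ctri hp) (cwg n).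
have cB n := C1onM (C1onS ctri hk) (cwg n).
have [pk1 pk2] := C1on_pd hk; have [pp1 pp2] := C1on_pd hp.
pose A n x := (p x * (w_ n x * pd false (g_ n) x + g_ n x * pd false (w_ n) x) + w_ n x * g_ n x * p1 x) * k2 x
  - (p x * (w_ n x * pd true (g_ n) x + g_ n x * pd true (w_ n) x) + w_ n x * g_ n x * p2 x) * k1 x.
pose B n x := (k x * (w_ n x * pd false (g_ n) x + g_ n x * pd false (w_ n) x) + w_ n x * g_ n x * k1 x) * p2 x
  - (k x * (w_ n x * pd true (g_ n) x + g_ n x * pd true (w_ n) x) + w_ n x * g_ n x * k2 x) * p1 x.
have cA0 n : ccont (A n).
  by have [_ h1 h2 _ _] := cA n; exact: (ccontB (ccontM h1 Hk2) (ccontM h2 Hk1)).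
have cB0 n : ccont (B n).
  by have [_ h1 h2 _ _] := cB n; exact: (ccontB (ccontM h1 Hp2) (ccontM h2 Hp1)).
have sq0 (F_ bd_ : nat -> R) (C : R) : (forall n, `|F_ n| <= C * bd_ n) -> bd_ @ \oo --> (0 : R) -> F_ @ \oo --> (0 : R).
  move=> FC b0'; apply: norm_cvg0; apply: (@squeeze_cvgr _ _ _ _ (fun=> 0) (fun n => C * bd_ n)).
  - by apply: nearW => n; rewrite normr_ge0/=.
  - exact: cvg_cst.
  - by rewrite -[X in _ --> X](mulr0 C); apply: cvgM => //; exact: cvg_cst.
have LA : (fun n => \int[leb2]_(x in tri) A n x) @ \oo --> (0 : R).
  apply: (sq0 _ _ Ck0 _ bp) => n; have := HCk _ _ _ (cA n).
  rewrite (_ : \int[leb2]_(x in tri) _ = \int[leb2]_(x in tri) A n x).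
    by under [X in _ <= _ * bdint _ _ X]eq_fun do rewrite mulrA.
  by apply: eq_Rintegral => x _; rewrite pk1 ?pk2 ?inE.
have LB : (fun n => \int[leb2]_(x in tri) B n x) @ \oo --> (0 : R).
  apply: (sq0 _ _ Cp _ bk) => n; have := HCp _ _ _ (cB n).
  rewrite (_ : \int[leb2]_(x in tri) _ = \int[leb2]_(x in tri) B n x).
    by under [X in _ <= _ * bdint _ _ X]eq_fun do rewrite mulrA.
  by apply: eq_Rintegral => x _; rewrite pp1 ?pp2 ?inE.
pose J n := \int[leb2]_(x in tri)
   ((p x * k x * pd false (w_ n) x + w_ n x * (p x * k1 x + k x * p1 x)) * pd true (g_ n) x -
     (p x * k x * pd true (w_ n) x + w_ n x * (p x * k2 x + k x * p2 x)) * pd false (g_ n) x).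
pose Q n := 2 * J n + (\int[leb2]_(x in tri) A n x + \int[leb2]_(x in tri) B n x).
have LQ : Q @ \oo --> (0 : R).
  have <- : 2 * 0 + (0 + 0) = 0 :> R by rewrite mulr0 !addr0.
  by apply: cvgD; [apply: cvgM LJ; exact: cvg_cst|exact: cvgD].
rewrite (_ : (fun n => _) = Q)//.
apply/funext => n.
have iA := ccont_integrable a0 b0 (cA0 n); have iB := ccont_integrable a0 b0 (cB0 n).
rewrite /Q /J.
rewrite -RintegralZl// -RintegralD// -RintegralD//.
- by apply: eq_Rintegral => x _; rewrite /kform /A /B; ring.
- exact: (integrable_scale mT 2 (iJ n)).
- exact: ccont_integrable (ccontD (cA0 n) (cB0 n)).
Qed.

End Limits.

(** * Sobolev functions on the triangle: one-sided inequalities *)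

Section H1Data.
Context {R : realType} (a b : R) (a0 : 0 < a) (b0 : 0 < b).
Notation mu := (@lebesgue_measure R).
Notation ctri := (ctri a b).
Notation ccont := (conton ctri).
Notation tri := (tri a b).
Notation sqc := (@sqcvg _ _ R (@leb2 R) tri).
Notation intc := (@intcvg _ _ R (@leb2 R) tri).
Let mT : measurable (tri : set (plane R)) := measurable_tri a b.
Let m01 : measurable (`[0, 1]%classic : set (measurableTypeR R)) := measurable_itv _.

(** A real [W^{1,2}] function together with a C^1 sequence that defines its
    trace.  Keeping the sequence is what lets boundary terms be computed: every
    estimate is proved for its members and then passes to the limit. *)
Record H1 := MkH1 {
  h1_seq : nat -> R * R -> R;
  h1_fun : R * R -> R;
  h1_grad : bool -> R * R -> R;
  h1_trace : side -> R -> R;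
  h1_limP : h1lim a b h1_seq h1_fun (h1_grad false) (h1_grad true);
  h1_traceP : forall s, trace_to a b s h1_seq (h1_trace s) }.

Definition h1comb (c : R) (f : H1) (d : R) (g : H1) : H1 :=
  @MkH1 (fun n x => c * h1_seq f n x + d * h1_seq g n x)
    (fun x => c * h1_fun f x + d * h1_fun g x)
    (fun j x => c * h1_grad f j x + d * h1_grad g j x)
    (fun s t => c * h1_trace f s t + d * h1_trace g s t)
    (h1lim_comb c d (h1_limP f) (h1_limP g))
    (fun s => trace_comb c d (h1_traceP f s) (h1_traceP g s)).

Definition trace0 s (f : H1) := trace_to a b s (h1_seq f) (fun=> 0).

Lemma h1_sqc (f : H1) : sqc (h1_seq f) (h1_fun f).
Proof. by have [] := h1_limP f. Qed.

Lemma h1_sqc_grad (f : H1) j : sqc (fun n => pd j (h1_seq f n)) (h1_grad f j).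
Proof. by have [_ _ h1 h2] := h1_limP f; case: j. Qed.

Lemma h1_Ck (f : H1) n : Ck 1 (h1_seq f n).
Proof. by have [] := h1_limP f. Qed.

Lemma h1_sqint (f : H1) : sqint (@leb2 R) tri (h1_fun f).
Proof. by have [] := h1_sqc f. Qed.

Lemma h1_sqint_grad (f : H1) j : sqint (@leb2 R) tri (h1_grad f j).
Proof. by have [] := h1_sqc_grad f j. Qed.

(** The boundary term disappears in the limit because [w] has trace zero on
    [s]. *)
Lemma riccati_limit (w : H1) s j (q r : R * R -> R) (c : R) :
  ccont q -> ccont r -> trace0 s w ->
  (forall n, - (c * \int[mu]_(t in `[0, 1]) (q (param a b s t) * h1_seq w n (param a b s t) ^+ 2)) <=
     \int[leb2]_(x in tri) (pd j (h1_seq w n) x ^+ 2) +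
     \int[leb2]_(x in tri) (r x * h1_seq w n x ^+ 2)) ->
  0 <= \int[leb2]_(x in tri) (h1_grad w j x ^+ 2) + \int[leb2]_(x in tri) (r x * h1_fun w x ^+ 2).
Proof.
move=> cq cr w0 H.
have L1 := sqcvg_sq mT (h1_sqc_grad w j).
have [_ _ L2] := ccont_intcvg a0 b0 cr (h1_sqc w) (h1_sqc w).
have [M M0 qM] := ccont_bounded a0 b0 cq.
have qw : bounded_weight (`[0, 1] : set (measurableTypeR R)) (fun t => q (param a b s t)) M.
  split; last by move=> t t01; apply: qM; exact: (param_ctri a0 b0).
  apply: (@subspace_continuous_measurable_fun R) => //.
  apply: continuous_in_subspaceT => t /set_mem t01.
  exact: (@ccont_param _ a b a0 b0 q s).
have L3 := sqcvg_mul m01 qw w0 w0.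
rewrite (_ : \int[mu]_(x in _) _ = 0) in L3; last first.
  rewrite -[RHS](Rintegral01_cst (0 : R)); apply: eq_Rintegral => t _.
  by rewrite mul0r mulr0.
have -> : (0 : R) = - (c * 0) by rewrite mulr0 oppr0.
under [X in _ <= _ + X]eq_Rintegral do rewrite expr2.
have H' : forall n, - (c * \int[mu]_(t in `[0, 1]) (q (param a b s t) * (h1_seq w n (param a b s t) * h1_seq w n (param a b s t)))) <=
     \int[leb2]_(x in tri) (pd j (h1_seq w n) x ^+ 2) +
     \int[leb2]_(x in tri) (r x * (h1_seq w n x * h1_seq w n x)).
  move=> n; have := H n.
  under [X in - (_ * X)]eq_Rintegral do rewrite expr2.
  by under [X in _ <= _ + X]eq_Rintegral do rewrite expr2.
apply: (@ler_cvg_to _ _ _ _ _ _ _ _ _ (cvgD L1 L2)).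
- by apply: cvgN; apply: cvgM L3; exact: cvg_cst.
- by apply: nearW => n; exact: H'.
Qed.

(** The length of the segment from [x] to the side [s] in the direction [j].
    A leg parallel to [j] is never met, and [crossing] excludes it. *)
Definition height (s : side) (j : bool) (x : R * R) : R :=
  match s with
  | OA => x.2
  | OB => x.1
  | AB => if j then b * (1 - x.1 / a) - x.2 else a * (1 - x.2 / b) - x.1
  end.

Definition crossing (s : side) (j : bool) : Prop :=
  match s with OA => j = true | OB => j = false | AB => True end.

Lemma height_ge0 s j x : ctri x -> 0 <= height s j x.
Proof.
move=> [x0 y0 xy]; case: s => //=; case: j; rewrite subr_ge0.
- by rewrite -ler_pdivrMl// mulrC; lra.
- by rewrite -ler_pdivrMl// mulrC; lra.
Qed.

Lemma C1on_height s j : crossing s j ->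
  exists h1 h2 : R, C1on ctri (height s j) (fun=> h1) (fun=> h2) /\
    (if j then h2 else h1) = if s is AB then -1 else 1.
Proof.
have E (c1 c2 c0 : R) f : f =1 (fun x : R * R => c1 * x.1 + c2 * x.2 + c0) -> C1on ctri f (fun=> c1) (fun=> c2).
  by move=> fE; apply: C1on_eq (C1on_lin ctri c1 c2 c0) _ _ _ => // x; rewrite fE.
case: s => /=; [move=> ->|move=> ->|move=> _].
- by exists 0, 1; split => //; apply: (E _ _ 0) => x; rewrite mul0r mul1r add0r addr0.
- by exists 1, 0; split => //; apply: (E _ _ 0) => x; rewrite mul0r mul1r !addr0.
- case: j.
  + exists (- (b / a)), (-1); split => //; apply: (E _ _ b) => x /=; ring.
  + exists (-1), (- (a / b)); split => //; apply: (E _ _ a) => x /=; ring.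
Qed.

(** The Riccati estimate with [q = A / T - B T], where [T = height + e], up to
    the sign [ep] that orients [T].  For such [q] the term [q' + q^2] is
    explicit.  The hypothesis relating [A] and [B] makes [A / T - B T] nonnegative, so
    that the boundary term on the side opposite to [s], where nothing is known
    about [w], can be dropped.  [A = 1/2], [B = 0] gives Hardy's inequality and
    [A = 1] Poincare's. *)
Lemma onesided (w : H1) s j (A B e : R) : crossing s j -> trace0 s w ->
  0 <= A -> 0 <= B -> 0 < e ->
  (forall x, ctri x -> B * (height s j x + e) ^+ 2 <= A) ->
  0 <= \int[leb2]_(x in tri) (h1_grad w j x ^+ 2) +
       \int[leb2]_(x in tri) (((A ^+ 2 - A) * (height s j x + e) ^- 2 - B - 2 * A * B +
           B ^+ 2 * (height s j x + e) ^+ 2) * h1_fun w x ^+ 2).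
Proof.
move=> cr w0 A0 B0 e0 BA.
have [h1 [h2 [ch hj]]] := C1on_height cr.
set ep : R := if s is AB then -1 else 1 in hj.
pose T x := height s j x + e.
have T0 x : ctri x -> 0 < T x by move=> tx; rewrite /T ltr_wpDl// height_ge0.
have cT : C1on ctri T (fun=> h1 + 0) (fun=> h2 + 0) by exact: C1onD ch (C1on_cst ctri e).
have cTV := C1onV (fun x tx => lt0r_neq0 (T0 x tx)) cT.
have cq := C1onM (C1on_cst ctri ep) (C1onD (C1onM (C1on_cst ctri A) cTV) (C1onM (C1on_cst ctri (- B)) cT)).
set q := (fun x => ep * (A * (T x)^-1 + - B * T x)) in cq.
have phi0 x : ctri x -> 0 <= A * (T x)^-1 + - B * T x.
  move=> tx; have := BA x tx; rewrite -/(T x) => h.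
  rewrite mulNr subr_ge0 ler_pdivlMr ?T0//.
  by rewrite -mulrA -expr2.
pose r x := (A ^+ 2 - A) * (T x) ^- 2 - B - 2 * A * B + B ^+ 2 * (T x) ^+ 2.
have cTc : ccont T by have [] := cT.
have cT2 : ccont (fun x => (T x) ^- 2).
  by apply: ccontV; [move=> x tx; rewrite expf_neq0// gt_eqF// T0|exact: ccontX].
have crr : ccont r.
  apply: ccontD; last by apply: ccontM; [exact: ccont_cst|exact: ccontX].
  apply: ccontB; last exact: ccont_cst.
  apply: ccontB; last exact: ccont_cst.
  by apply: ccontM => //; exact: ccont_cst.
have cqc : ccont q by have [] := cq.
have ep2 : ep * ep = 1 by rewrite /ep; case: (s); ring.
have rE x : ctri x -> ep * ((A * (- T x ^- 2 * ep)) + (- B) * ep) + q x ^+ 2 = r x.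
  move=> tx; rewrite /r /q.
  have Tn : T x != 0 by rewrite gt_eqF// T0.
  rewrite exprMn [ep ^+ 2]expr2 ep2 mul1r.
  rewrite (_ : ep * _ = (ep * ep) * (A * - T x ^- 2 - B)); last by ring.
  by rewrite ep2; field.
apply: (@riccati_limit w s j q r (if s is AB then - (if j then a else b) else (if j then a else b))) => // n.
have cw := Ck1_C1onS ctri (h1_Ck w n).
have nonneg s' : 0 <= ep * \int[mu]_(t in `[0, 1]) (q (param a b s' t) * h1_seq w n (param a b s' t) ^+ 2).
  have i : mu.-integrable `[0, 1] (EFin \o (fun t => q (param a b s' t) * h1_seq w n (param a b s' t) ^+ 2)).
    have [c _ _ _ _] := cw.
    exact: (ccont_integrable_side a0 b0 s' (ccontM cqc (@ccontX _ ctri _ 2 c))).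
  rewrite -RintegralZl//; apply: Rintegral_ge0 => t t01.
  rewrite mulrA /q [ep * (ep * _)]mulrA ep2 mul1r mulr_ge0 ?sqr_ge0//; apply: phi0.
  exact: (param_ctri a0 b0).
have fin (q2 : R * R -> R) : (forall x, ctri x -> q2 x + q x ^+ 2 = r x) ->
    \int[leb2]_(x in tri) ((q2 x + q x ^+ 2) * h1_seq w n x ^+ 2) =
    \int[leb2]_(x in tri) (r x * h1_seq w n x ^+ 2).
  by move=> q2r; apply: eq_Rintegral => x /set_mem/tri_sub_ctri tx; rewrite q2r.
have nAB := nonneg AB; have nOA := nonneg OA; have nOB := nonneg OB.
have [_ cq1 cq2 dq1 dq2] := cq.
have jb : j = true \/ j = false by case: (j); [left|right].
case: jb => jE; subst j.
- have R2 := riccati2 a0 b0 cw cqc cq2 dq2.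
  rewrite fin in R2; last first.
    by move=> x tx; rewrite -(rE x tx) -hj /=; ring.
  apply: le_trans R2 => /=.
  have [sE|sE|sE] : [\/ s = OA, s = OB | s = AB] by case: (s); [constructor 1|constructor 2|constructor 3].
  + rewrite sE -mulrN ler_wpM2l ?(ltW a0)// -[leLHS]add0r lerD2r.
    by move: nAB; rewrite /ep sE mul1r.
  + by move: cr; rewrite sE.
  + rewrite sE mulNr opprK ler_wpM2l ?(ltW a0)// lerDl.
    by move: nOA; rewrite /ep sE mulN1r.
- have R1 := riccati1 a0 b0 cw cqc cq1 dq1.
  rewrite fin in R1; last first.
    by move=> x tx; rewrite -(rE x tx) -hj /=; ring.
  apply: le_trans R1 => /=.
  have [sE|sE|sE] : [\/ s = OA, s = OB | s = AB] by case: (s); [constructor 1|constructor 2|constructor 3].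
  + by move: cr; rewrite sE.
  + rewrite sE -mulrN ler_wpM2l ?(ltW b0)// -[leLHS]add0r lerD2r.
    by move: nAB; rewrite /ep sE mul1r.
  + rewrite sE mulNr opprK ler_wpM2l ?(ltW b0)// lerDl.
    by move: nOB; rewrite /ep sE mulN1r.
Qed.

Lemma hardy_regularized (w : H1) s j (e : R) : crossing s j -> trace0 s w -> 0 < e ->
  \int[leb2]_(x in tri) ((height s j x + e) ^- 2 * h1_fun w x ^+ 2) <=
  4 * \int[leb2]_(x in tri) (h1_grad w j x ^+ 2).
Proof.
move=> cr w0 e0.
have H := onesided cr w0 (ltac:(lra) : 0 <= (2^-1 : R)) (lexx 0) e0 _.
have {}H := H (fun x _ => ltac:(by rewrite mul0r; lra)).
have [h1 [h2 [ch _]]] := C1on_height cr.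
have c2 : ccont (fun x => (height s j x + e) ^- 2).
  apply: ccontV => [x tx|].
    by rewrite expf_neq0// gt_eqF// ltr_wpDl// height_ge0.
  by apply: ccontX; apply: ccontD; [have [] := ch|exact: ccont_cst].
have [M rM] := ccont_weight a0 b0 c2.
have i2 := sqint_mul_weight mT rM (h1_sqint w) (h1_sqint w).
have E : \int[leb2]_(x in tri) (((2^-1 ^+ 2 - 2^-1) * (height s j x + e) ^- 2 - 0 - 2 * 2^-1 * 0 +
           0 ^+ 2 * (height s j x + e) ^+ 2) * h1_fun w x ^+ 2) =
   - 4^-1 * \int[leb2]_(x in tri) ((height s j x + e) ^- 2 * h1_fun w x ^+ 2).
  rewrite -RintegralZl//.
  by apply: eq_Rintegral => x _; move: ((height s j x + e) ^- 2) => X; field.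
rewrite E in H; move: H.
move: (\int[leb2]_(x in tri) (h1_grad w j x ^+ 2)) (\int[leb2]_(x in tri) ((height s j x + e) ^- 2 * h1_fun w x ^+ 2)).
by move=> p q; lra.
Qed.

(** The sharp constant [pi^2 / 4] would require a tangent for [q]; the rational
    choice [q = 1 / T - B T] with [e = L / 4] gives 32/25 and is enough. *)
Lemma poincare (w : H1) s j (L : R) : crossing s j -> trace0 s w -> 0 < L ->
  (forall x, ctri x -> height s j x <= L) ->
  32 / 25 * \int[leb2]_(x in tri) (h1_fun w x ^+ 2) <=
  L ^+ 2 * \int[leb2]_(x in tri) (h1_grad w j x ^+ 2).
Proof.
move=> cr w0 L0 hL.
(* [B] is as large as the sign condition on [q] allows; then the constant
   [2 * B] is [(32 / 25) / L ^+ 2]. *)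
pose e := L / 4; pose B := (L + e) ^- 2.
have e0 : 0 < e by rewrite divr_gt0.
have Le : L + e = 5 / 4 * L by rewrite /e; field.
have B0 : 0 <= B by rewrite invr_ge0 sqr_ge0.
have BT x : ctri x -> B * (height s j x + e) ^+ 2 <= 1.
  move=> tx; rewrite /B mulrC ler_pdivrMr ?mul1r ?exprn_gt0 ?addr_gt0//.
  have h0 := height_ge0 s j tx; have h1 := hL x tx.
  by rewrite lerXn2r ?nnegrE ?lerD2r// addr_ge0// ltW.
have H := onesided cr w0 ler01 B0 e0 BT.
have [h1 [h2 [ch _]]] := C1on_height cr.
have chc : ccont (height s j) by have [] := ch.
have cT2 : ccont (fun x => (height s j x + e) ^- 2).
  apply: ccontV => [x tx|].
    by rewrite expf_neq0// gt_eqF// ltr_wpDl// height_ge0.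
  by apply: ccontX; apply: ccontD => //; exact: ccont_cst.
have cr2 : ccont (fun x => ((1 ^+ 2 - 1) * (height s j x + e) ^- 2 - B - 2 * 1 * B +
           B ^+ 2 * (height s j x + e) ^+ 2)).
  apply: ccontD; last by apply: ccontM; [exact: ccont_cst|apply: ccontX; apply: ccontD => //; exact: ccont_cst].
  apply: ccontB; last exact: ccont_cst.
  apply: ccontB; last exact: ccont_cst.
  by apply: ccontM => //; exact: ccont_cst.
have [M rM] := ccont_weight a0 b0 cr2.
have i2 := sqint_mul_weight mT rM (h1_sqint w) (h1_sqint w).
have iw := (h1_sqint w).2.
have le2 : \int[leb2]_(x in tri) (((1 ^+ 2 - 1) * (height s j x + e) ^- 2 - B - 2 * 1 * B +
           B ^+ 2 * (height s j x + e) ^+ 2) * h1_fun w x ^+ 2) <=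
   (- 2 * B) * \int[leb2]_(x in tri) (h1_fun w x ^+ 2).
  rewrite -RintegralZl//; apply: le_Rintegral => //.
  - exact: (integrable_scale mT (- 2 * B) iw).
  - move=> x /tri_sub_ctri tx; apply: ler_wpM2r; first exact: sqr_ge0.
    have h := BT x tx; rewrite expr1n subrr mul0r.
    have : B * (B * (height s j x + e) ^+ 2) <= B * 1 by rewrite ler_wpM2l.
    by rewrite mulrA -expr2; lra.
have L2 : 0 < L ^+ 2 by rewrite exprn_gt0.
have BE : B = 16 / 25 / L ^+ 2 by rewrite /B Le; field; rewrite gt_eqF.
move: (le_trans H (lerD (lexx _) le2)); rewrite BE.
move: (\int[leb2]_(x in tri) (h1_grad w j x ^+ 2)) (\int[leb2]_(x in tri) (h1_fun w x ^+ 2)).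
move=> p q; rewrite (_ : p + _ = (L ^+ 2 * p - 32 / 25 * q) / L ^+ 2); last first.
  by field; rewrite gt_eqF.
by rewrite pmulr_lge0 ?invr_gt0// subr_ge0.
Qed.

End H1Data.

(** * Hardy inequality and the boundary condition *)

Section JacobianBalance.
Context {R : realType} (a b : R) (a0 : 0 < a) (b0 : 0 < b).
Notation mu := (@lebesgue_measure R).
Notation ctri := (ctri a b).
Notation ccont := (conton ctri).
Notation tri := (tri a b).
Notation H1 := (H1 a b).
Notation height := (height a b).
Let mT : measurable (tri : set (plane R)) := measurable_tri a b.

Lemma height_gt0 s j x : tri x -> 0 < height s j x.
Proof.
move=> [x0 y0 xy]; case: s => //=; case: j; rewrite subr_gt0.
- by rewrite -ltr_pdivrMl// mulrC; lra.
- by rewrite -ltr_pdivrMl// mulrC; lra.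
Qed.

(** Monotone convergence in [hardy_regularized] as the regularisation tends
    to 0. *)
Lemma hardy (w : H1) s j : crossing s j -> trace0 s w ->
  L1 tri (fun x => (height s j x) ^- 2 * h1_fun w x ^+ 2).
Proof.
move=> cr w0.
pose e n : R := n.+1%:R^-1.
have e0 n : 0 < e n by rewrite invr_gt0.
pose K x := (height s j x) ^- 2 * h1_fun w x ^+ 2.
rewrite -/K.
pose F n x := (height s j x + e n) ^- 2 * h1_fun w x ^+ 2.
have [h1 [h2 [ch _]]] := C1on_height a b cr.
have hc : ccont (height s j) by have [] := ch.
have c2 n : ccont (fun x => (height s j x + e n) ^- 2).
  apply: ccontV => [x tx|].
    by rewrite expf_neq0// gt_eqF// ltr_wpDl// (height_ge0 a0 b0).
  by apply: ccontX; apply: ccontD => //; exact: ccont_cst.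
have iF n : L1 tri (F n).
  have [M rM] := ccont_weight a0 b0 (c2 n).
  exact: (sqint_mul_weight mT rM (h1_sqint w) (h1_sqint w)).
have mF n : measurable_fun tri (EFin \o F n) by have /integrableP[] := iF n.
have F0 n x : tri x -> (0 <= (EFin \o F n) x)%E.
  by move=> tx; rewrite lee_fin mulr_ge0 ?sqr_ge0// invr_ge0 sqr_ge0.
have ndF x : tri x -> {homo (fun n => (EFin \o F n) x) : n m / (n <= m)%N >-> (n <= m)%E}.
  move=> tx n m nm; rewrite lee_fin; apply: ler_wpM2r; first exact: sqr_ge0.
  have h0 := height_gt0 s j tx.
  rewrite lef_pV2 ?posrE ?exprn_gt0 ?addr_gt0//.
  rewrite lerXn2r ?nnegrE ?lerD2l//; try by rewrite ltW// addr_gt0.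
  by rewrite lef_pV2 ?posrE ?ltr0n// ler_nat ltnS.
have limF x : tri x -> (EFin \o F n) x @[n --> \oo] --> (EFin \o K) x.
  move=> tx; apply: cvg_EFin; first exact: nearW.
  apply: cvgM; last exact: cvg_cst.
  have hn : height s j x != 0 by rewrite gt_eqF// height_gt0.
  apply: cvgV; first by rewrite expf_neq0.
  rewrite expr2; under eq_fun do rewrite expr2.
  have ce : (fun n => height s j x + e n) @ \oo --> height s j x.
    rewrite -[X in _ --> X]addr0; apply: cvgD; first exact: cvg_cst.
    exact: cvg_harmonic.
  exact: cvgM.
have := @cvg_monotone_convergence _ _ R (@leb2 R) tri mT (fun n => EFin \o F n) mF F0 ndF.
set G := (fun x => limn _) => cG.
have GE x : tri x -> G x = (EFin \o K) x.
  by move=> tx; apply/cvg_lim => //; exact: limF.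
have mG : measurable_fun tri (EFin \o K).
  by apply: (emeasurable_fun_cvg (fun n => EFin \o F n)).
apply/integrableP; split => //.
rewrite (_ : (\int[_]_(x in _) _)%E = (\int[@leb2 R]_(x in tri) G x)%E); last first.
  apply: eq_integral => x /set_mem tx; rewrite GE//= ger0_norm//.
  by rewrite mulr_ge0 ?sqr_ge0// invr_ge0 sqr_ge0.
apply: (@le_lt_trans _ _ (4 * \int[leb2]_(x in tri) (h1_grad w j x ^+ 2))%:E); last exact: ltry.
apply: (cvge_to_le cG).
apply: nearW => n; have H := hardy_regularized a0 b0 cr w0 (e0 n).
rewrite -lee_fin in H; apply: le_trans H; rewrite /Rintegral fineK//.
by apply: integrable_fin_num => //; exact: iF.
Qed.

(** The boundary condition reads [psi2 = (cs + i sn) psi1]: on the side [s] the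
    second component is the first one rotated by the angle with this cosine
    and sine. *)
Definition cs (s : side) : R := - (outward_normal a b s).2.
Definition sn (s : side) : R := (outward_normal a b s).1.

Let h := Num.sqrt (a ^+ 2 + b ^+ 2).
Let hyp2_gt0 : 0 < a ^+ 2 + b ^+ 2. Proof. by rewrite addr_gt0// exprn_gt0. Qed.
Let h0 : 0 < h. Proof. by rewrite sqrtr_gt0. Qed.
Let h2 : h ^+ 2 = a ^+ 2 + b ^+ 2. Proof. by rewrite sqr_sqrtr// ltW. Qed.

Lemma cs_sn s : cs s ^+ 2 + sn s ^+ 2 = 1.
Proof.
case: s; rewrite /cs /sn /=; [by ring|by ring|].
rewrite -/h sqrrN !exprMn exprVn h2 -mulrDl mulfV// gt_eqF//.
Qed.

(** Two sides of the triangle make an angle of at least a right angle between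
    their outward normals. *)
Lemma normal_separation s s' : s <> s' -> 2 <= (cs s - cs s') ^+ 2 + (sn s - sn s') ^+ 2.
Proof.
have hn : h != 0 by rewrite gt_eqF.
have ab : (a / h) ^+ 2 + (b / h) ^+ 2 = 1 by have := cs_sn AB; rewrite /cs /sn /= -/h sqrrN.
have ah : 0 <= a / h by rewrite divr_ge0// ltW.
have bh : 0 <= b / h by rewrite divr_ge0// ltW.
by case: s; case: s' => // _; rewrite /cs /sn /= -?/h; nra.
Qed.

Definition kf (c c1 c2 : R * R -> R) (f g : H1) x := kform (c x) (c1 x) (c2 x)
  (h1_fun f x) (h1_grad f false x) (h1_grad f true x) (h1_fun g x) (h1_grad g false x) (h1_grad g true x).

Lemma kf_integrable c c1 c2 (f g : H1) : ccont c -> ccont c1 -> ccont c2 ->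
  L1 tri (kf c c1 c2 f g).
Proof.
move=> h0' h1 h2'.
by have [_ i _] := kform_intcvg a0 b0 h0' h1 h2' (h1_sqc f) (h1_sqc_grad f false) (h1_sqc_grad f true)
  (h1_sqc g) (h1_sqc_grad g false) (h1_sqc_grad g true).
Qed.

Section BoundaryCondition.
Variables (u1 u2 v1 v2 : H1).

Definition rot1 s := h1comb (cs s) u1 (- sn s) u2.
Definition rot2 s := h1comb (sn s) u1 (cs s) u2.
(** The deviation of [(v1, v2)] from the pair that the boundary condition of the
    side [s] prescribes; [dev1] and [dev2] have trace zero on [s] only. *)
Definition dev1 s := h1comb 1 v1 (-1) (rot1 s).
Definition dev2 s := h1comb 1 v2 (-1) (rot2 s).

Hypothesis bc : forall s, trace0 s (dev1 s) /\ trace0 s (dev2 s).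

(** Replacing first [v1] and then [v2] by the rotated functions changes [kf] by
    terms in which one entry has trace zero on [s]; for the rotated pair [kf]
    has the value that it has for [(u1, u2)]. *)
Lemma kf_side s (p k : R * R -> R) p1 p2 k1 k2 :
  C1on setT p p1 p2 -> C1on setT k k1 k2 ->
  (forall s' t, s' <> s -> t \in `[0, 1] -> p (param a b s' t) = 0) ->
  (forall s' t, s' <> s -> t \in `[0, 1] -> k (param a b s' t) = 0) ->
  \int[leb2]_(x in tri) kf (fun x => p x * k x) (fun x => p x * k1 x + k x * p1 x)
      (fun x => p x * k2 x + k x * p2 x) v1 v2 x =
  \int[leb2]_(x in tri) kf (fun x => p x * k x) (fun x => p x * k1 x + k x * p1 x)
      (fun x => p x * k2 x + k x * p2 x) u1 u2 x.
Proof.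
move=> hp hk p0 k0; have [bc1 bc2] := bc s.
have z1 := kform_trace0 a0 b0 hp hk p0 k0 (h1_limP (dev1 s)) (h1_limP v2) bc1 (h1_traceP v2 s).
have z2 := kform_trace0 a0 b0 hp hk p0 k0 (h1_limP (dev2 s)) (h1_limP (rot1 s)) bc2 (h1_traceP (rot1 s) s).
have [Hp Hp1 Hp2 _ _] := C1onS ctri hp; have [Hk Hk1 Hk2 _ _] := C1onS ctri hk.
have Hc := ccontM Hp Hk.
have Hc1 := ccontD (ccontM Hp Hk1) (ccontM Hk Hp1).
have Hc2 := ccontD (ccontM Hp Hk2) (ccontM Hk Hp2).
have iu := kf_integrable u1 u2 Hc Hc1 Hc2.
have i1 := kf_integrable (dev1 s) v2 Hc Hc1 Hc2.
have i2 := kf_integrable (dev2 s) (rot1 s) Hc Hc1 Hc2.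
rewrite -[RHS]addr0 -[X in _ + X](subrr 0) -{1}z1 -z2 -RintegralB// -RintegralD//; last first.
  exact: (integrable_sub mT i1 i2).
apply: eq_Rintegral => x _; rewrite /kf /kform /=.
have := cs_sn s; move: (cs s) (sn s) => c d cd.
move: (p x) (k x) (p1 x) (p2 x) (k1 x) (k2 x) => P K P1 P2 K1 K2.
set X := P * K; set X1 := P * K1 + _; set X2 := P * K2 + _.
move: X X1 X2 => X X1 X2.
move: (h1_fun u1 x) (h1_fun u2 x) (h1_fun v1 x) (h1_fun v2 x) => U1 U2 V1 V2.
move: (h1_grad u1 false x) (h1_grad u2 false x) (h1_grad v1 false x) (h1_grad v2 false x) => U11 U21 V11 V21.
move: (h1_grad u1 true x) (h1_grad u2 true x) (h1_grad v1 true x) (h1_grad v2 true x) => U12 U22 V12 V22.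
have d2 : d ^+ 2 = 1 - c ^+ 2 by rewrite -cd addrC addKr.
by ring: d2.
Qed.

End BoundaryCondition.

End JacobianBalance.

(** * A partition into weights localised on the sides *)

Section Cutoff.
Context {R : realType} (a b : R) (a0 : 0 < a) (b0 : 0 < b).
Notation ctri := (ctri a b).
Notation ccont := (conton ctri).
Notation tri := (tri a b).
Notation H1 := (H1 a b).
Let mT : measurable (tri : set (plane R)) := measurable_tri a b.

Definition bary (s : side) (x : R * R) : R :=
  match s with OA => x.2 / b | OB => x.1 / a | AB => 1 - x.1 / a - x.2 / b end.

Definition bary_grad (j : bool) (s : side) : R :=
  match s with
  | OA => if j then b^-1 else 0
  | OB => if j then 0 else a^-1
  | AB => if j then - b^-1 else - a^-1
  end.

Definition others (s : side) : side * side :=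
  match s with OA => (OB, AB) | OB => (OA, AB) | AB => (OA, OB) end.

Lemma C1on_bary s : C1on setT (bary s) (fun=> bary_grad false s) (fun=> bary_grad true s).
Proof.
have E (c1 c2 c0 : R) f : f =1 (fun x : R * R => c1 * x.1 + c2 * x.2 + c0) -> C1on setT f (fun=> c1) (fun=> c2).
  by move=> fE; apply: C1on_eq (C1on_lin setT c1 c2 c0) _ _ _ => // x; rewrite fE.
case: s => /=.
- by apply: (E 0 b^-1 0) => x /=; ring.
- by apply: (E a^-1 0 0) => x /=; ring.
- by apply: (E (- a^-1) (- b^-1) 1) => x /=; ring.
Qed.

Lemma bary_sum x : bary OA x + bary OB x + bary AB x = 1.
Proof. by rewrite /=; ring. Qed.

Lemma bary_gt0 s x : tri x -> 0 < bary s x.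
Proof. by move=> [x0 y0 xy]; case: s => /=; [rewrite divr_gt0|rewrite divr_gt0|lra]. Qed.

Lemma bary_side s t : bary s (param a b s t) = 0.
Proof.
case: s => /=; [by rewrite mul0r|by rewrite mul0r|].
by rewrite !mulfK ?gt_eqF//; ring.
Qed.

(** Vanishes on the two sides other than [s]. *)
Definition bump s x := bary (others s).1 x * bary (others s).2 x.
Definition bump_grad j s x := bary (others s).1 x * bary_grad j (others s).2 +
  bary (others s).2 x * bary_grad j (others s).1.

Lemma C1on_bump s : C1on setT (bump s) (bump_grad false s) (bump_grad true s).
Proof. exact: C1onM (C1on_bary _) (C1on_bary _). Qed.

Lemma bump_side s s' t : s' <> s -> bump s (param a b s' t) = 0.
Proof.
rewrite /bump => ss'.
have [E|E] : s' = (others s).1 \/ s' = (others s).2.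
  by case: s ss'; case: s' => //= _; auto.
- by rewrite -E bary_side mul0r.
- by rewrite -E bary_side mulr0.
Qed.

(** Positive except at the corners, where all three bumps vanish. *)
Definition bump_sum x := bump OA x ^+ 2 + bump OB x ^+ 2 + bump AB x ^+ 2.
Definition bump_sum_grad j x := 2 * (bump OA x * bump_grad j OA x + bump OB x * bump_grad j OB x +
  bump AB x * bump_grad j AB x).

Lemma C1on_bump_sum : C1on setT bump_sum (bump_sum_grad false) (bump_sum_grad true).
Proof.
have h s := C1onM (C1on_bump s) (C1on_bump s).
apply: C1on_eq (C1onD (C1onD (h OA) (h OB)) (h AB)) _ _ _ => x.
- by rewrite /bump_sum; ring.
- by rewrite /bump_sum_grad; ring.
- by rewrite /bump_sum_grad; ring.
Qed.

Lemma bump_sum_ge0 x : 0 <= bump_sum x.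
Proof. by rewrite /bump_sum !addr_ge0// sqr_ge0. Qed.

Lemma bump_sum_gt0 x : tri x -> 0 < bump_sum x.
Proof.
move=> tx; rewrite /bump_sum ltr_wpDl ?exprn_gt0 ?addr_ge0 ?sqr_ge0//.
by rewrite /bump mulr_gt0// bary_gt0.
Qed.

Lemma bump_sum_grad_le : exists2 C : R, 0 < C & forall j x, ctri x ->
  bump_sum_grad j x ^+ 2 <= C * bump_sum x.
Proof.
have cg j s : ccont (bump_grad j s).
  by have [_ h1 h2 _ _] := C1onS ctri (C1on_bump s); case: j.
have cG j : ccont (fun x => bump_grad j OA x ^+ 2 + bump_grad j OB x ^+ 2 + bump_grad j AB x ^+ 2).
  by apply: ccontD; [apply: ccontD|]; exact: ccontX.
have [M1 M10 H1] := ccont_bounded a0 b0 (cG true).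
have [M2 M20 H2] := ccont_bounded a0 b0 (cG false).
exists (4 * (M1 + M2)) => [|j x tx]; first by rewrite mulr_gt0// addr_gt0.
have CS (p q r p' q' r' : R) : (p * p' + q * q' + r * r') ^+ 2 <= (p ^+ 2 + q ^+ 2 + r ^+ 2) * (p' ^+ 2 + q' ^+ 2 + r' ^+ 2).
  rewrite -subr_ge0 (_ : _ - _ = (p * q' - q * p') ^+ 2 + (p * r' - r * p') ^+ 2 + (q * r' - r * q') ^+ 2); last by ring.
  by rewrite !addr_ge0// sqr_ge0.
rewrite /bump_sum_grad exprMn (_ : 2 ^+ 2 = 4 :> R); last by ring.
rewrite -[leRHS]mulrA ler_wpM2l// (le_trans (CS _ _ _ _ _ _))// -/(bump_sum x) mulrC ler_wpM2r ?bump_sum_ge0//.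
case: j.
- by rewrite (le_trans (ler_norm _))// (le_trans (H1 x tx))// lerDl ltW.
- by rewrite (le_trans (ler_norm _))// (le_trans (H2 x tx))// lerDr ltW.
Qed.

Section Delta.
Variables (e : R) (e0 : 0 < e).

Definition cut x := (bump_sum x + e)^-1.
Definition cut_grad j x := - (bump_sum x + e) ^- 2 * bump_sum_grad j x.

Lemma cut_den_gt0 x : 0 < bump_sum x + e.
Proof. by rewrite ltr_wpDl// bump_sum_ge0. Qed.

Lemma C1on_cut : C1on setT cut (cut_grad false) (cut_grad true).
Proof.
have h := C1onD C1on_bump_sum (C1on_cst setT e).
apply: C1on_eq (C1onV _ h) _ _ _ => // x.
- by move=> _; rewrite gt_eqF// cut_den_gt0.
- by rewrite /cut_grad addr0.
- by rewrite /cut_grad addr0.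
Qed.

Variables (u1 u2 v1 v2 : H1).
Hypothesis bc : forall s, trace0 s (dev1 u1 u2 v1 s) /\ trace0 s (dev2 u1 u2 v2 s).

(** The weights [bump s ^+ 2 * cut], each localised on one side, add up to
    [bump_sum * cut = 1 - e * cut], and [kf_side] applies to each of them. *)
Lemma kf_cut :
  \int[leb2]_(x in tri) kf (fun=> 1) (fun=> 0) (fun=> 0) v1 v2 x -
  \int[leb2]_(x in tri) (e * kf cut (cut_grad false) (cut_grad true) v1 v2 x) =
  \int[leb2]_(x in tri) kf (fun=> 1) (fun=> 0) (fun=> 0) u1 u2 x -
  \int[leb2]_(x in tri) (e * kf cut (cut_grad false) (cut_grad true) u1 u2 x).
Proof.
pose k s x := bump s x * cut x.
pose kg j s x := bump s x * cut_grad j x + cut x * bump_grad j s x.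
have ck s : C1on setT (k s) (kg false s) (kg true s) by exact: C1onM (C1on_bump s) C1on_cut.
pose X s x := bump s x * k s x.
pose Xg j s x := bump s x * kg j s x + k s x * bump_grad j s x.
have side s : \int[leb2]_(x in tri) kf (X s) (Xg false s) (Xg true s) v1 v2 x =
              \int[leb2]_(x in tri) kf (X s) (Xg false s) (Xg true s) u1 u2 x.
  apply: (kf_side a0 b0 bc (s := s) (C1on_bump s) (ck s)).
  - by move=> s' t ss' _; exact: (bump_side t ss').
  - by move=> s' t ss' _; rewrite /k (bump_side t ss') mul0r.
have cX s : ccont (X s) /\ forall j, ccont (Xg j s).
  have [h1 h2 h3 _ _] := C1onM (C1onS ctri (C1on_bump s)) (C1onS ctri (ck s)).
  by split => //; case.
have iX s (f g : H1) : L1 tri (kf (X s) (Xg false s) (Xg true s) f g).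
  by have [h1 h2] := cX s; exact: (kf_integrable a0 b0 f g h1 (h2 false) (h2 true)).
have [cc cc1 cc2 _ _] := C1onS ctri C1on_cut.
have split3 (f g : H1) :
  \int[leb2]_(x in tri) kf (fun=> 1) (fun=> 0) (fun=> 0) f g x -
  \int[leb2]_(x in tri) (e * kf cut (cut_grad false) (cut_grad true) f g x) =
  \int[leb2]_(x in tri) kf (X OA) (Xg false OA) (Xg true OA) f g x +
  \int[leb2]_(x in tri) kf (X OB) (Xg false OB) (Xg true OB) f g x +
  \int[leb2]_(x in tri) kf (X AB) (Xg false AB) (Xg true AB) f g x.
  have i1 : L1 tri (kf (fun=> 1) (fun=> 0) (fun=> 0) f g).
    by apply: kf_integrable => //; exact: ccont_cst.
  have i2 : L1 tri (fun x => e * kf cut (cut_grad false) (cut_grad true) f g x).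
    exact: (integrable_scale mT e (kf_integrable a0 b0 f g cc cc1 cc2)).
  have i3 : L1 tri (fun x => kf (X OA) (Xg false OA) (Xg true OA) f g x +
     kf (X OB) (Xg false OB) (Xg true OB) f g x).
    exact: (integrable_add mT (iX OA f g) (iX OB f g)).
  rewrite -RintegralB// -RintegralD// -RintegralD//.
  apply: eq_Rintegral => x _.
  have D0 := cut_den_gt0 x.
  rewrite /kf /X /Xg /kg /k /cut_grad /cut.
  have Sg j : bump_sum_grad j x = 2 * (bump OA x * bump_grad j OA x + bump OB x * bump_grad j OB x +
     bump AB x * bump_grad j AB x) by [].
  rewrite !Sg /kform; move: D0; rewrite /bump_sum.
  move: (bump OA x) (bump OB x) (bump AB x) => B1 B2 B3 D0.
  move: (bump_grad false OA x) (bump_grad false OB x) (bump_grad false AB x) => B11 B21 B31.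
  move: (bump_grad true OA x) (bump_grad true OB x) (bump_grad true AB x) => B12 B22 B32.
  move: (h1_fun f x) (h1_fun g x) (h1_grad f false x) (h1_grad f true x) (h1_grad g false x) (h1_grad g true x).
  move=> p q p1 p2 q1 q2.
  by field; rewrite gt_eqF.
by rewrite !split3 !side.
Qed.

End Delta.
End Cutoff.

(** * Equality of the Jacobian integrals *)

Section CutoffLimit.
Context {R : realType} (a b : R) (a0 : 0 < a) (b0 : 0 < b).
Notation ctri := (ctri a b).
Notation ccont := (conton ctri).
Notation tri := (tri a b).
Notation H1 := (H1 a b).
Notation bump_sum := (bump_sum a b).
Notation cut := (cut a b).
Notation cut_grad := (cut_grad a b).
Let mT : measurable (tri : set (plane R)) := measurable_tri a b.

Lemma kform_young (c c1 c2 p p1 p2 q q1 q2 K : R) : `|c| <= 1 -> c1 ^+ 2 <= K -> c2 ^+ 2 <= K ->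
  `|kform c c1 c2 p p1 p2 q q1 q2| <=
  2 * (p1 ^+ 2 + p2 ^+ 2 + q1 ^+ 2 + q2 ^+ 2) + K * (p ^+ 2 + q ^+ 2).
Proof.
move=> hc h1 h2; rewrite /kform.
have y (s t r : R) : `|r| <= 1 -> `|2 * (r * (s * t))| <= s ^+ 2 + t ^+ 2.
  move=> r1; rewrite !normrM (ger0_norm (_ : 0 <= 2)) //.
  rewrite -(real_normK (num_real s)) -(real_normK (num_real t)).
  have := sqr_ge0 (`|s| - `|t|); have := normr_ge0 s; have := normr_ge0 t; have := normr_ge0 r.
  move: (`|r|) (`|s|) (`|t|) r1 => {}r {}s {}t r1 r0 t0 s0 H.
  have st : 0 <= s * t by rewrite mulr_ge0.
  have : r * (s * t) <= 1 * (s * t) by rewrite ler_wpM2r.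
  by nra.
have z (s d t : R) : d ^+ 2 <= K -> `|s * (d * t)| <= 2^-1 * (K * s ^+ 2 + t ^+ 2).
  move=> dK; have H : 2 * `|(d * s) * t| <= (d * s) ^+ 2 + t ^+ 2.
    have := y (d * s) t 1; rewrite normr1 lexx mul1r normrM (ger0_norm (_ : 0 <= 2)) //.
    by apply.
  rewrite mulrCA mulrA; rewrite exprMn in H.
  have : d ^+ 2 * s ^+ 2 <= K * s ^+ 2 by rewrite ler_wpM2r ?sqr_ge0.
  by lra.
have := y p1 q2 c hc; have := y p2 q1 c hc; have := z p c1 q2 h1; have := z p c2 q1 h2.
have := z q c1 p2 h1; have := z q c2 p1 h2.
rewrite (_ : _ - q * _ = 2 * (c * (p1 * q2)) - 2 * (c * (p2 * q1)) + p * (c1 * q2) - p * (c2 * q1)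
  - q * (c1 * p2) + q * (c2 * p1)); last by ring.
move: (2 * (c * (p1 * q2))) (2 * (c * (p2 * q1))) (p * (c1 * q2)) (p * (c2 * q1)) (q * (c1 * p2)) (q * (c2 * p1)).
move=> t1 t2 t3 t4 t5 t6; rewrite !ler_norml.
move=> /andP[? ?] /andP[? ?] /andP[? ?] /andP[? ?] /andP[? ?] /andP[? ?].
by apply/andP; split; lra.
Qed.

(** The factor [e * cut] tends to 0 pointwise and is at most 1, and its gradient
    is at most a constant over the square root of [bump_sum], whatever [e];
    this gives both the pointwise limit 0 and an integrable bound. *)
Lemma cut_vanish (f g : H1) :
  L1 tri (fun x => h1_fun f x ^+ 2 / bump_sum x) ->
  L1 tri (fun x => h1_fun g x ^+ 2 / bump_sum x) ->
  (fun n => \int[leb2]_(x in tri) (n.+1%:R^-1 *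
     kf (cut n.+1%:R^-1) (cut_grad n.+1%:R^-1 false) (cut_grad n.+1%:R^-1 true) f g x)) @ \oo --> (0 : R).
Proof.
move=> iff igg.
pose e n : R := n.+1%:R^-1.
have e0 n : 0 < e n by rewrite invr_gt0.
have [C C0 gC] := bump_sum_grad_le a0 b0.
pose F n x := e n * kf (cut (e n)) (cut_grad (e n) false) (cut_grad (e n) true) f g x.
rewrite -[X in X @ _](_ : (fun n => \int[leb2]_(x in tri) F n x) = _)//.
have iF n : L1 tri (F n).
  have [cc cc1 cc2 _ _] := C1onS ctri (C1on_cut a b (e0 n)).
  exact: (integrable_scale mT (e n) (kf_integrable a0 b0 f g cc cc1 cc2)).
pose G x := (2 * (h1_grad f false x ^+ 2 + h1_grad f true x ^+ 2) + 2 * (h1_grad g false x ^+ 2 + h1_grad g true x ^+ 2)) +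
  (C * (h1_fun f x ^+ 2 / bump_sum x) + C * (h1_fun g x ^+ 2 / bump_sum x)).
have iG : L1 tri G.
  have s2 (w : H1) : L1 tri (fun x => h1_grad w false x ^+ 2 + h1_grad w true x ^+ 2).
    exact: (integrable_add mT (h1_sqint_grad w false).2 (h1_sqint_grad w true).2).
  have i1 := integrable_comb mT 2 2 (s2 f) (s2 g).
  have i2 := integrable_comb mT C C iff igg.
  exact: (integrable_add mT i1 i2).
have FG n x : tri x -> `|F n x| <= G x.
  move=> tx; have S0 := bump_sum_gt0 a0 b0 tx; have T0 := cut_den_gt0 a b (e0 n) x.
  have ctx := tri_sub_ctri tx.
  have -> : F n x = kform (e n * cut (e n) x) (e n * cut_grad (e n) false x) (e n * cut_grad (e n) true x)
      (h1_fun f x) (h1_grad f false x) (h1_grad f true x) (h1_fun g x) (h1_grad g false x) (h1_grad g true x).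
    by rewrite /F /kf /kform; ring.
  (* [e * t / (t + e) ^+ 2 <= 1], applied with [t = bump_sum x] *)
  have cj j : (e n * cut_grad (e n) j x) ^+ 2 <= C / bump_sum x.
    rewrite /cut_grad ler_pdivlMr//.
    rewrite (_ : (e n * _) ^+ 2 = e n ^+ 2 * ((bump_sum x + e n) ^- 2 ^+ 2 * bump_sum_grad a b j x ^+ 2)); last first.
      by move: ((bump_sum x + e n)^- 2) (bump_sum_grad a b j x) => X Y; ring.
    apply: (@le_trans _ _ (e n ^+ 2 * ((bump_sum x + e n) ^- 2 ^+ 2 * (C * bump_sum x)) * bump_sum x)).
      apply: ler_wpM2r; first exact: ltW.
      apply: ler_wpM2l; first exact: sqr_ge0.
      by apply: ler_wpM2l; [exact: sqr_ge0|exact: gC].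
    rewrite (_ : _ * bump_sum x = C * ((e n * bump_sum x) / (bump_sum x + e n) ^+ 2) ^+ 2); last first.
      by rewrite expr_div_n; field; rewrite gt_eqF.
    rewrite -[leRHS]mulr1 ler_wpM2l ?(ltW C0)// expr_le1//; last first.
      by rewrite divr_ge0// ?sqr_ge0// mulr_ge0// ltW.
    rewrite ler_pdivrMr ?exprn_gt0// mul1r.
    by have := sqr_ge0 (bump_sum x - e n); have := mulr_ge0 (ltW S0) (ltW (e0 n)); nra.
  have c1 : `|e n * cut (e n) x| <= 1.
    rewrite /cut ger0_norm; last by rewrite divr_ge0// ltW.
    by rewrite ler_pdivrMr// mul1r lerDr ltW.
  apply: (le_trans (kform_young _ _ _ _ _ _ c1 (cj false) (cj true))).
  by rewrite /G le_eqVlt; apply/orP; left; apply/eqP; ring.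
have := @dominated_convergence _ _ R (@leb2 R) tri mT (fun n => EFin \o F n) (cst 0%E) (EFin \o G).
move=> /(_ _ _ _ iG _)[].
- by move=> n; have /integrableP[] := iF n.
- exact: measurable_cst.
- apply: aeW => x tx.
  have S0 := bump_sum_gt0 a0 b0 tx.
  suff cF : (fun n => F n x) @ \oo --> (0 : R) by apply: cvg_EFin; [exact: nearW|exact: cF].
  pose A : R := 2 * (h1_grad f false x * h1_grad g true x - h1_grad f true x * h1_grad g false x).
  pose B : R := - (h1_fun f x * (bump_sum_grad a b false x * h1_grad g true x - bump_sum_grad a b true x * h1_grad g false x)
     - h1_fun g x * (bump_sum_grad a b false x * h1_grad f true x - bump_sum_grad a b true x * h1_grad f false x)).
  rewrite (_ : (fun n => _) = fun n => e n * (A * (bump_sum x + e n)^-1 + B * (bump_sum x + e n) ^- 2)); last first.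
    apply/funext => n; rewrite /F /kf /kform /cut /cut_grad /A /B.
    move: ((bump_sum x + e n)^-1) => X.
    by ring.
  have ce : e @ \oo --> (0 : R) by exact: cvg_harmonic.
  have <- : 0 * (A * (bump_sum x + 0)^-1 + B * (bump_sum x + 0) ^- 2) = 0 by rewrite mul0r.
  have cS : (fun n => bump_sum x + e n) @ \oo --> bump_sum x + 0.
    by apply: cvgD => //; exact: cvg_cst.
  have Sn : bump_sum x + 0 != 0 by rewrite addr0 gt_eqF.
  apply: cvgM => //; apply: cvgD; apply: cvgM; try exact: cvg_cst.
    exact: cvgV.
  apply: cvgV; first by rewrite expf_neq0.
  rewrite expr2; under eq_fun do rewrite expr2.
  exact: cvgM.
- by apply: aeW => x n tx; rewrite lee_fin; exact: FG.
- move=> _ _; rewrite integral0 => H.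
  have := fine_cvg H; exact.
Qed.

End CutoffLimit.

Section Balance.
Context {R : realType} (a b : R) (a0 : 0 < a) (b0 : 0 < b).
Notation ctri := (ctri a b).
Notation ccont := (conton ctri).
Notation tri := (tri a b).
Notation H1 := (H1 a b).
Notation bary := (bary a b).
Let mT : measurable (tri : set (plane R)) := measurable_tri a b.

Lemma hardy_bary (w : H1) s : trace0 s w ->
  L1 tri (fun x => h1_fun w x ^+ 2 / bary s x ^+ 2).
Proof.
move=> w0.
have [j [c [cr c0 E]]] : exists j c, [/\ crossing s j, 0 < c & forall x, height a b s j x = c * bary s x].
  case: s w0 => _.
  - by exists true, b; split => //= x; rewrite mulrCA mulfV ?gt_eqF// mulr1.
  - by exists false, a; split => //= x; rewrite mulrCA mulfV ?gt_eqF// mulr1.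
  - by exists true, b; split => //= x; field; rewrite !gt_eqF.
have := integrableZl mT (c ^+ 2) (hardy a0 b0 cr w0).
apply: eq_integrable => // x /set_mem tx /=; congr EFin.
by rewrite E; field; rewrite !gt_eqF// (bary_gt0 a0 b0).
Qed.

Section Spinor.
Variables (u1 u2 v1 v2 : H1).
Notation dev1 := (dev1 u1 u2 v1).
Notation dev2 := (dev2 u1 u2 v2).
Hypothesis bc : forall s, trace0 s (dev1 s) /\ trace0 s (dev2 s).

Definition density (x : R * R) := h1_fun u1 x ^+ 2 + h1_fun u2 x ^+ 2 + h1_fun v1 x ^+ 2 + h1_fun v2 x ^+ 2.
Definition devsq s (x : R * R) := h1_fun (dev1 s) x ^+ 2 + h1_fun (dev2 s) x ^+ 2.

(** Two rotations that differ by at least a right angle: the difference of the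
    deviations of two sides determines [u], and then [v]. *)
Lemma density_le_dev s s' x : s <> s' -> density x <= 5 * (devsq s x + devsq s' x).
Proof.
move=> ss'; rewrite /density /devsq /=.
have sep := normal_separation a0 b0 ss'.
have cs1 := cs_sn a0 b0 s; have cs2 := cs_sn a0 b0 s'.
move: (cs a b s) (sn a b s) (cs a b s') (sn a b s') sep cs1 cs2 => c d c' d' sep cs1 cs2.
move: (h1_fun u1 x) (h1_fun u2 x) (h1_fun v1 x) (h1_fun v2 x) => U1 U2 V1 V2.
set W1 := 1 * V1 + _; set W2 := 1 * V2 + _; set Z1 := 1 * V1 + _; set Z2 := 1 * V2 + _.
have hu : U1 ^+ 2 + U2 ^+ 2 <= W1 ^+ 2 + W2 ^+ 2 + (Z1 ^+ 2 + Z2 ^+ 2).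
  have e : (W1 - Z1) ^+ 2 + (W2 - Z2) ^+ 2 = ((c - c') ^+ 2 + (d - d') ^+ 2) * (U1 ^+ 2 + U2 ^+ 2).
    by rewrite /W1 /W2 /Z1 /Z2; ring.
  have h2 : 2 * (U1 ^+ 2 + U2 ^+ 2) <= (W1 - Z1) ^+ 2 + (W2 - Z2) ^+ 2.
    by rewrite e ler_wpM2r// addr_ge0// sqr_ge0.
  have := sqr_ge0 (W1 + Z1); have := sqr_ge0 (W2 + Z2).
  by move: h2; clear; move: W1 W2 Z1 Z2 => W1 W2 Z1 Z2; nra.
have hv : V1 ^+ 2 + V2 ^+ 2 <= 2 * (W1 ^+ 2 + W2 ^+ 2) + 2 * (U1 ^+ 2 + U2 ^+ 2).
  have e1 : V1 = W1 + (c * U1 - d * U2) by rewrite /W1; ring.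
  have e2 : V2 = W2 + (d * U1 + c * U2) by rewrite /W2; ring.
  have e : (c * U1 - d * U2) ^+ 2 + (d * U1 + c * U2) ^+ 2 = U1 ^+ 2 + U2 ^+ 2.
    by rewrite -[RHS]mul1r -cs1; ring.
  have := sqr_ge0 (W1 - (c * U1 - d * U2)); have := sqr_ge0 (W2 - (d * U1 + c * U2)).
  move: e; rewrite e1 e2; clear.
  by move: W1 W2 (c * U1 - d * U2) (d * U1 + c * U2) => W1 W2 X Y e H1 H2; nra.
have : 0 <= Z1 ^+ 2 + Z2 ^+ 2 by rewrite addr_ge0// sqr_ge0.
by move: hu hv; clear; lra.
Qed.

(** At every point one barycentric coordinate is at least 1/3.  The deviations
    from the two sides meeting at the corresponding corner then bound the
    density, and [bump_sum] is comparable to the sum of the squares of the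
    other two coordinates. *)
Lemma density_le_hardy x : tri x -> density x / bump_sum a b x <=
  45 * (devsq OA x / bary OA x ^+ 2 + devsq OB x / bary OB x ^+ 2 + devsq AB x / bary AB x ^+ 2).
Proof.
move=> tx; have S0 := bump_sum_gt0 a0 b0 tx.
have d0 s : 0 <= devsq s x by rewrite addr_ge0// sqr_ge0.
have l0 s := bary_gt0 a0 b0 s tx.
have q0 s : 0 <= devsq s x / bary s x ^+ 2 by rewrite divr_ge0// sqr_ge0.
have main s s' s'' : s <> s' -> 3^-1 <= bary s'' x ->
    (bary s'' x * bary s x) ^+ 2 + (bary s'' x * bary s' x) ^+ 2 <= bump_sum a b x ->
    density x / bump_sum a b x <= 45 * (devsq s x / bary s x ^+ 2 + devsq s' x / bary s' x ^+ 2).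
  move=> ss' l3 Sle; rewrite ler_pdivrMr//.
  apply: (le_trans (density_le_dev x ss')).
  have l9 : 9^-1 <= bary s'' x ^+ 2.
    rewrite (_ : 9^-1 = 3^-1 ^+ 2); last by field.
    by rewrite lerXn2r// nnegrE ?invr_ge0// ltW.
  have Sge : 9^-1 * (bary s x ^+ 2 + bary s' x ^+ 2) <= bump_sum a b x.
    by apply: le_trans Sle; rewrite !exprMn -mulrDr ler_wpM2r ?addr_ge0 ?sqr_ge0.
  have p0 := l0 s; have r0 := l0 s'.
  apply: (@le_trans _ _ (45 * (devsq s x / bary s x ^+ 2 + devsq s' x / bary s' x ^+ 2) *
     (9^-1 * (bary s x ^+ 2 + bary s' x ^+ 2)))); last first.
    by apply: ler_wpM2l => //; rewrite mulr_ge0// addr_ge0.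
  rewrite -subr_ge0 (_ : _ - _ = 5 * (devsq s x * (bary s' x / bary s x) ^+ 2 + devsq s' x * (bary s x / bary s' x) ^+ 2)).
    by rewrite mulr_ge0// addr_ge0// mulr_ge0// sqr_ge0.
  by field; rewrite !gt_eqF.
have sum1 := bary_sum a b x.
have [h|[h|h]] : 3^-1 <= bary OA x \/ (3^-1 <= bary OB x \/ 3^-1 <= bary AB x).
  case: (lerP 3^-1 (bary OA x)) => h1; first by left.
  case: (lerP 3^-1 (bary OB x)) => h2; first by right; left.
  by right; right; move: (bary OA x) (bary OB x) (bary AB x) sum1 h1 h2 => p q r; lra.
- apply: (le_trans (main OB AB OA _ h _)) => //.
    rewrite /bump_sum /bump [others OA]/= [others OB]/= [others AB]/= [(_, _).1]/= [(_, _).2]/=.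
    by rewrite -subr_ge0 (_ : _ - _ = (bary OB x * bary AB x) ^+ 2) ?sqr_ge0//; ring.
  by have := q0 OA; lra.
- apply: (le_trans (main OA AB OB _ h _)) => //.
    rewrite /bump_sum /bump /others.
    by rewrite -subr_ge0 (_ : _ - _ = (bary OA x * bary AB x) ^+ 2) ?sqr_ge0//; ring.
  by have := q0 OB; lra.
- apply: (le_trans (main OA OB AB _ h _)) => //.
    rewrite /bump_sum /bump /others.
    by rewrite -subr_ge0 (_ : _ - _ = (bary OA x * bary OB x) ^+ 2) ?sqr_ge0//; ring.
  by have := q0 AB; lra.
Qed.

Lemma integrable_over_bump (f : H1) : (forall x, h1_fun f x ^+ 2 <= density x) ->
  L1 tri (fun x => h1_fun f x ^+ 2 / bump_sum a b x).
Proof.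
move=> fd.
have iw s : L1 tri (fun x => devsq s x / bary s x ^+ 2).
  have [w1 w2] := bc s.
  have := integrableD mT (hardy_bary w1) (hardy_bary w2).
  by apply: eq_integrable => // x _ /=; rewrite /devsq mulrDl EFinD.
have iS : L1 tri (fun x => 45 * (devsq OA x / bary OA x ^+ 2 +
    devsq OB x / bary OB x ^+ 2 + devsq AB x / bary AB x ^+ 2)).
  have := integrableZl mT 45 (integrableD mT (integrableD mT (iw OA) (iw OB)) (iw AB)).
  by apply: eq_integrable => // x _ /=; rewrite EFinM !EFinD.
apply: (integrable_le mT _ iS).
- apply: measurable_funM; first by apply: measurable_funX; exact: (h1_sqint f).1.
  apply: open_continuous_measurable2; first exact: open_tri.
  move=> x tx; apply: cvgV; first by rewrite gt_eqF// bump_sum_gt0.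
  by have [h _ _ _ _] := C1on_bump_sum a b; exact: h.
- move=> x tx; have S0 := bump_sum_gt0 a0 b0 tx.
  rewrite ger0_norm ?divr_ge0 ?sqr_ge0 ?(ltW S0)//.
  apply: le_trans (density_le_hardy tx).
  by rewrite ler_wpM2r ?invr_ge0 ?(ltW S0).
Qed.

Lemma jacobian_balance :
  \int[leb2]_(x in tri) (h1_grad v1 false x * h1_grad v2 true x - h1_grad v1 true x * h1_grad v2 false x) =
  \int[leb2]_(x in tri) (h1_grad u1 false x * h1_grad u2 true x - h1_grad u1 true x * h1_grad u2 false x).
Proof.
have sq (x : R) := sqr_ge0 x.
have iv1 : L1 tri (fun x => h1_fun v1 x ^+ 2 / bump_sum a b x).
  by apply: integrable_over_bump => x; rewrite /density; have := sq (h1_fun u1 x); have := sq (h1_fun u2 x); have := sq (h1_fun v2 x); lra.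
have iv2 : L1 tri (fun x => h1_fun v2 x ^+ 2 / bump_sum a b x).
  by apply: integrable_over_bump => x; rewrite /density; have := sq (h1_fun u1 x); have := sq (h1_fun u2 x); have := sq (h1_fun v1 x); lra.
have iu1 : L1 tri (fun x => h1_fun u1 x ^+ 2 / bump_sum a b x).
  by apply: integrable_over_bump => x; rewrite /density; have := sq (h1_fun v1 x); have := sq (h1_fun u2 x); have := sq (h1_fun v2 x); lra.
have iu2 : L1 tri (fun x => h1_fun u2 x ^+ 2 / bump_sum a b x).
  by apply: integrable_over_bump => x; rewrite /density; have := sq (h1_fun u1 x); have := sq (h1_fun v1 x); have := sq (h1_fun v2 x); lra.
pose I n (f g : H1) := \int[leb2]_(x in tri) (n.+1%:R^-1 *
   kf (cut a b n.+1%:R^-1) (cut_grad a b n.+1%:R^-1 false) (cut_grad a b n.+1%:R^-1 true) f g x).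
have Lv : (fun n => I n v1 v2) @ \oo --> (0 : R) := cut_vanish a0 b0 iv1 iv2.
have Lu : (fun n => I n u1 u2) @ \oo --> (0 : R) := cut_vanish a0 b0 iu1 iu2.
pose Iv := \int[leb2]_(x in tri) kf (fun=> 1) (fun=> 0) (fun=> 0) v1 v2 x.
pose Iu := \int[leb2]_(x in tri) kf (fun=> 1) (fun=> 0) (fun=> 0) u1 u2 x.
have E : Iv = Iu.
  have L : (fun=> Iv - Iu) @ \oo --> (0 : R).
    rewrite (_ : (fun=> Iv - Iu) = fun n => I n v1 v2 - I n u1 u2).
      by have <- : 0 - 0 = 0 :> R by [rewrite subrr]; exact: cvgB.
    apply/funext => n.
    have e0 : 0 < n.+1%:R^-1 :> R by rewrite invr_gt0.
    have := kf_cut a0 b0 e0 bc; rewrite -/Iv -/Iu -/(I n v1 v2) -/(I n u1 u2).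
    by move: (I n v1 v2) (I n u1 u2) => p q; lra.
  have : Iv - Iu = 0 by apply: (cvg_unique (@Rhausdorff R) _ L); exact: cvg_cst.
  by move/eqP; rewrite subr_eq0 => /eqP.
have E2 (f g : H1) : \int[leb2]_(x in tri) kf (fun=> 1) (fun=> 0) (fun=> 0) f g x =
  2 * \int[leb2]_(x in tri) (h1_grad f false x * h1_grad g true x - h1_grad f true x * h1_grad g false x).
  have i1 := sqint_mul mT (h1_sqint_grad f false) (h1_sqint_grad g true).
  have i2 := sqint_mul mT (h1_sqint_grad f true) (h1_sqint_grad g false).
  rewrite -RintegralZl//; last exact: (integrable_sub mT i1 i2).
  by apply: eq_Rintegral => x _; rewrite /kf /kform; ring.
by move: E; rewrite /Iv /Iu !E2 => /(mulfI (lt0r_neq0 (ltr0Sn _ 1))).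
Qed.

End Spinor.
End Balance.

(** * Boundary term and spectral gap *)

Section Energy.
Context {R : realType} (a b : R) (a0 : 0 < a) (b0 : 0 < b).
Notation mu := (@lebesgue_measure R).
Notation ctri := (ctri a b).
Notation ccont := (conton ctri).
Notation tri := (tri a b).
Notation H1 := (H1 a b).
Notation cs := (cs a b).
Notation sn := (sn a b).
Let mT : measurable (tri : set (plane R)) := measurable_tri a b.
Let m01 : measurable (`[0, 1]%classic : set (measurableTypeR R)) := measurable_itv _.

Variables (u1 u2 v1 v2 : H1).
Hypothesis tr1 : forall s t, h1_trace v1 s t = cs s * h1_trace u1 s t - sn s * h1_trace u2 s t.
Hypothesis tr2 : forall s t, h1_trace v2 s t = sn s * h1_trace u1 s t + cs s * h1_trace u2 s t.

Lemma dev_trace0 s : trace0 s (dev1 u1 u2 v1 s) /\ trace0 s (dev2 u1 u2 v2 s).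
Proof.
split.
- apply: (sqcvg_eq m01 (h1_traceP (dev1 u1 u2 v1 s) s)) => // t _ /=.
  by rewrite tr1; ring.
- apply: (sqcvg_eq m01 (h1_traceP (dev2 u1 u2 v2 s) s)) => // t _ /=.
  by rewrite tr2; ring.
Qed.

(** The coefficient of [2 m] in [|T psi|^2]; each group of two terms is the
    derivative of a product. *)
Definition cross x :=
  h1_fun u1 x * h1_grad v2 false x + h1_fun v2 x * h1_grad u1 false x
  - (h1_fun u2 x * h1_grad v1 false x + h1_fun v1 x * h1_grad u2 false x)
  - (h1_fun u1 x * h1_grad v1 true x + h1_fun v1 x * h1_grad u1 true x)
  - (h1_fun u2 x * h1_grad v2 true x + h1_fun v2 x * h1_grad u2 true x).

Lemma weight1 (D : set (measurableTypeR R)) : bounded_weight D (fun=> 1 : R) 1.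
Proof. by split; [exact: measurable_cst|move=> *; rewrite normr1]. Qed.

Lemma product_limit (f g : H1) j :
  intcvg (@leb2 R) tri (fun n x => h1_seq f n x * pd j (h1_seq g n) x + h1_seq g n x * pd j (h1_seq f n) x)
    (fun x => h1_fun f x * h1_grad g j x + h1_fun g x * h1_grad f j x).
Proof.
have c1 : ccont (fun=> 1) by exact: ccont_cst.
apply: (intcvg_eq mT (intcvgD mT (ccont_intcvg a0 b0 c1 (h1_sqc f) (h1_sqc_grad g j))
  (ccont_intcvg a0 b0 c1 (h1_sqc g) (h1_sqc_grad f j)))).
- by move=> n x _; rewrite !mul1r.
- by move=> x _; rewrite !mul1r.
Qed.

Lemma trace_product (f g : H1) s :
  (fun n => \int[mu]_(t in `[0, 1]) (h1_seq f n (param a b s t) * h1_seq g n (param a b s t))) @ \oo -->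
  \int[mu]_(t in `[0, 1]) (h1_trace f s t * h1_trace g s t).
Proof.
have := sqcvg_mul m01 (weight1 _) (h1_traceP f s) (h1_traceP g s).
under eq_fun do under eq_Rintegral do rewrite mul1r.
by under [X in _ --> X]eq_Rintegral do rewrite mul1r.
Qed.

Lemma trace_integrable (f g : H1) s :
  mu.-integrable `[0, 1] (EFin \o (fun t => h1_trace f s t * h1_trace g s t)).
Proof. by have [_ h1 _] := h1_traceP f s; have [_ h2 _] := h1_traceP g s; exact: sqint_mul. Qed.

Lemma green_product1 (f g : H1) :
  \int[leb2]_(x in tri) (h1_fun f x * h1_grad g false x + h1_fun g x * h1_grad f false x) =
  b * (\int[mu]_(t in `[0, 1]) (h1_trace f AB t * h1_trace g AB t) -
       \int[mu]_(t in `[0, 1]) (h1_trace f OB t * h1_trace g OB t)).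
Proof.
have [_ _ L] := product_limit f g false.
apply: (cvg_unique (@Rhausdorff R) L).
rewrite (_ : (fun n => _) = fun n => b * (\int[mu]_(t in `[0, 1]) (h1_seq f n (param a b AB t) * h1_seq g n (param a b AB t)) -
   \int[mu]_(t in `[0, 1]) (h1_seq f n (param a b OB t) * h1_seq g n (param a b OB t)))).
  by apply: cvgM; [exact: cvg_cst|apply: cvgB; exact: trace_product].
apply/funext => n.
have [c c1 _ d _] := C1onM (Ck1_C1onS ctri (h1_Ck f n)) (Ck1_C1onS ctri (h1_Ck g n)).
exact: (green1 a0 b0 c c1 d).
Qed.

Lemma green_product2 (f g : H1) :
  \int[leb2]_(x in tri) (h1_fun f x * h1_grad g true x + h1_fun g x * h1_grad f true x) =
  a * (\int[mu]_(t in `[0, 1]) (h1_trace f AB t * h1_trace g AB t) -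
       \int[mu]_(t in `[0, 1]) (h1_trace f OA t * h1_trace g OA t)).
Proof.
have [_ _ L] := product_limit f g true.
apply: (cvg_unique (@Rhausdorff R) L).
rewrite (_ : (fun n => _) = fun n => a * (\int[mu]_(t in `[0, 1]) (h1_seq f n (param a b AB t) * h1_seq g n (param a b AB t)) -
   \int[mu]_(t in `[0, 1]) (h1_seq f n (param a b OA t) * h1_seq g n (param a b OA t)))).
  by apply: cvgM; [exact: cvg_cst|apply: cvgB; exact: trace_product].
apply/funext => n.
have [c _ c1 _ d] := C1onM (Ck1_C1onS ctri (h1_Ck f n)) (Ck1_C1onS ctri (h1_Ck g n)).
exact: (green2 a0 b0 c c1 d).
Qed.

Lemma integrable_product (f g : H1) j : (@leb2 R).-integrable tri
  (EFin \o (fun x => h1_fun f x * h1_grad g j x + h1_fun g x * h1_grad f j x)).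
Proof. by have [_ h _] := product_limit f g j. Qed.

Lemma integrable_cross : L1 tri cross.
Proof.
have := integrableB mT (integrableB mT (integrableB mT (integrable_product u1 v2 false)
  (integrable_product u2 v1 false)) (integrable_product u1 v1 true)) (integrable_product u2 v2 true).
by apply: eq_integrable.
Qed.

(** By the divergence theorem and the boundary condition this is the integral of
    [u1 ^+ 2 + u2 ^+ 2] over the boundary. *)
Lemma cross_ge0 : 0 <= \int[leb2]_(x in tri) cross x.
Proof.
have iB f g := @integrable_sub _ _ R (@leb2 R) tri mT f g.
have i1 := integrable_product u1 v2 false; have i2 := integrable_product u2 v1 false.
have i3 := integrable_product u1 v1 true; have i4 := integrable_product u2 v2 true.
have i12 := iB _ _ i1 i2; have i123 := iB _ _ i12 i3.
rewrite /cross RintegralB// RintegralB// RintegralB//.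
rewrite !green_product1 !green_product2.
pose P s := \int[mu]_(t in `[0, 1]) (h1_trace u1 s t ^+ 2 + h1_trace u2 s t ^+ 2).
have P0 s : 0 <= P s by apply: Rintegral_ge0 => t _; rewrite addr_ge0 ?sqr_ge0.
have iT f g s := trace_integrable f g s.
have iP s : mu.-integrable `[0, 1] (EFin \o (fun t => h1_trace u1 s t ^+ 2 + h1_trace u2 s t ^+ 2)).
  exact: (integrable_add m01 (iT u1 u1 s) (iT u2 u2 s)).
have E1 s : \int[mu]_(t in `[0, 1]) (h1_trace u1 s t * h1_trace v2 s t) -
    \int[mu]_(t in `[0, 1]) (h1_trace u2 s t * h1_trace v1 s t) = sn s * P s.
  rewrite -RintegralB// /P -RintegralZl//.
  by apply: eq_Rintegral => t _; rewrite tr1 tr2; ring.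
have E2 s : \int[mu]_(t in `[0, 1]) (h1_trace u1 s t * h1_trace v1 s t) +
    \int[mu]_(t in `[0, 1]) (h1_trace u2 s t * h1_trace v2 s t) = cs s * P s.
  rewrite -RintegralD// /P -RintegralZl//.
  by apply: eq_Rintegral => t _; rewrite tr1 tr2; ring.
rewrite (_ : _ - _ = b * (sn AB * P AB - sn OB * P OB) - a * (cs AB * P AB - cs OA * P OA)); last first.
  by rewrite -!E1 -!E2; ring.
have h0 : 0 < Num.sqrt (a ^+ 2 + b ^+ 2) by rewrite sqrtr_gt0 addr_gt0// exprn_gt0.
rewrite /sn /cs /= (_ : _ - _ = (b * (b / Num.sqrt (a ^+ 2 + b ^+ 2)) + a * (a / Num.sqrt (a ^+ 2 + b ^+ 2))) * P AB +
  b * P OB + a * P OA); last by ring.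
have A0 := ltW a0; have B0 := ltW b0; have H0 := ltW h0.
by apply: addr_ge0; [apply: addr_ge0|]; apply: mulr_ge0 => //; apply: addr_ge0; apply: mulr_ge0 => //; apply: divr_ge0.
Qed.

Definition grad_density j x := h1_grad u1 j x ^+ 2 + h1_grad u2 j x ^+ 2 + h1_grad v1 j x ^+ 2 + h1_grad v2 j x ^+ 2.

(** For opposite rotations, [(c', d') = (- c, - d)], the sum of the two squared
    deviations is exactly [2 * r] by the parallelogram law.  The hypothesis
    measures the failure of the rotations to be opposite. *)
Lemma parallelogram_gap (c d c' d' e U1 U2 V1 V2 : R) : 0 <= e ->
  c ^+ 2 + d ^+ 2 = 1 -> c' ^+ 2 + d' ^+ 2 = 1 -> (c + c') ^+ 2 + (d + d') ^+ 2 <= e ^+ 2 ->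
  let W := (1 * V1 + -1 * (c * U1 + - d * U2)) ^+ 2 + (1 * V2 + -1 * (d * U1 + c * U2)) ^+ 2 +
     ((1 * V1 + -1 * (c' * U1 + - d' * U2)) ^+ 2 + (1 * V2 + -1 * (d' * U1 + c' * U2)) ^+ 2) in
  let r := U1 ^+ 2 + U2 ^+ 2 + V1 ^+ 2 + V2 ^+ 2 in
  (2 - e) * r <= W /\ W <= (2 + e) * r.
Proof.
move=> e0 h1 h2 he W r.
set X := V1 * ((c + c') * U1 - (d + d') * U2) + V2 * ((d + d') * U1 + (c + c') * U2).
have WE : W = 2 * r - 2 * X.
  rewrite /W /r /X.
  have -> : 2 * (U1 ^+ 2 + U2 ^+ 2 + V1 ^+ 2 + V2 ^+ 2) = (c ^+ 2 + d ^+ 2 + (c' ^+ 2 + d' ^+ 2)) * (U1 ^+ 2 + U2 ^+ 2) + 2 * (V1 ^+ 2 + V2 ^+ 2).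
    by rewrite h1 h2; ring.
  by ring.
set P := U1 ^+ 2 + U2 ^+ 2; set Q := V1 ^+ 2 + V2 ^+ 2.
have P0 : 0 <= P by rewrite addr_ge0// sqr_ge0.
have Q0 : 0 <= Q by rewrite addr_ge0// sqr_ge0.
have rE : r = P + Q by rewrite /r /P /Q; ring.
have XE : X ^+ 2 <= ((c + c') ^+ 2 + (d + d') ^+ 2) * P * Q.
  rewrite -subr_ge0 (_ : _ - _ = (V1 * ((d + d') * U1 + (c + c') * U2) - V2 * ((c + c') * U1 - (d + d') * U2)) ^+ 2).
    exact: sqr_ge0.
  by rewrite /X /P /Q; ring.
have X2 : (2 * X) ^+ 2 <= (e * r) ^+ 2.
  rewrite exprMn [leRHS]exprMn.
  apply: (@le_trans _ _ (2 ^+ 2 * (e ^+ 2 * (P * Q)))).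
    rewrite ler_wpM2l// (le_trans XE)// -mulrA ler_wpM2r// mulr_ge0//.
  rewrite mulrCA ler_wpM2l ?sqr_ge0// rE.
  by have := sqr_ge0 (P - Q); nra.
have er0 : 0 <= e * r by rewrite mulr_ge0// rE addr_ge0.
have : `|2 * X| <= e * r.
  by rewrite -(ger0_norm er0) -ler_sqr ?nnegrE// -!normrX !ger0_norm ?sqr_ge0.
rewrite ler_norml => /andP[x1 x2]; rewrite WE.
by move: (2 * X) x1 x2 => Y x1 x2; split; nra.
Qed.

(** [544 / 475 = 32 / 25 * (2 - 1 / 9) / (2 + 1 / 9)].  The deviations belonging to
    the two sides are compared with [psi] from below and their derivatives
    with those of [psi] from above. *)
Lemma gap_estimate s s' j (L : R) : crossing s j -> crossing s' j -> 0 < L ->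
  (forall x, ctri x -> height a b s j x <= L) -> (forall x, ctri x -> height a b s' j x <= L) ->
  (cs s + cs s') ^+ 2 + (sn s + sn s') ^+ 2 <= 9^-1 ^+ 2 ->
  544 / 475 * \int[leb2]_(x in tri) density u1 u2 v1 v2 x <= L ^+ 2 * \int[leb2]_(x in tri) grad_density j x.
Proof.
move=> cr cr' L0 hL hL' small.
have [b1 b2] := dev_trace0 s; have [b3 b4] := dev_trace0 s'.
have p1 := poincare a0 b0 cr b1 L0 hL; have p2 := poincare a0 b0 cr b2 L0 hL.
have p3 := poincare a0 b0 cr' b3 L0 hL'; have p4 := poincare a0 b0 cr' b4 L0 hL'.
have i2 (f : H1) := (h1_sqint f).2; have j2 (f : H1) := (h1_sqint_grad f j).2.
have iD f g := @integrable_add _ _ R (@leb2 R) tri mT f g.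
set w1 := dev1 u1 u2 v1 s in b1 p1; set w2 := dev2 u1 u2 v2 s in b2 p2.
set w3 := dev1 u1 u2 v1 s' in b3 p3; set w4 := dev2 u1 u2 v2 s' in b4 p4.
pose Wf x := (h1_fun w1 x ^+ 2 + h1_fun w2 x ^+ 2) + (h1_fun w3 x ^+ 2 + h1_fun w4 x ^+ 2).
pose Wg x := (h1_grad w1 j x ^+ 2 + h1_grad w2 j x ^+ 2) + (h1_grad w3 j x ^+ 2 + h1_grad w4 j x ^+ 2).
have iWf : L1 tri Wf := iD _ _ (iD _ _ (i2 w1) (i2 w2)) (iD _ _ (i2 w3) (i2 w4)).
have iWg : L1 tri Wg := iD _ _ (iD _ _ (j2 w1) (j2 w2)) (iD _ _ (j2 w3) (j2 w4)).
have id : L1 tri (density u1 u2 v1 v2).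
  exact: iD _ _ (iD _ _ (iD _ _ (i2 u1) (i2 u2)) (i2 v1)) (i2 v2).
have ig : L1 tri (grad_density j).
  exact: iD _ _ (iD _ _ (iD _ _ (j2 u1) (j2 u2)) (j2 v1)) (j2 v2).
have e0 : 0 <= 9^-1 :> R by rewrite invr_ge0.
have A1 : (2 - 9^-1) * \int[leb2]_(x in tri) density u1 u2 v1 v2 x <= \int[leb2]_(x in tri) Wf x.
  rewrite -RintegralZl//; apply: le_Rintegral => //.
    exact: (integrable_scale mT (2 - 9^-1) id).
  move=> x _; have [] := parallelogram_gap (h1_fun u1 x) (h1_fun u2 x) (h1_fun v1 x) (h1_fun v2 x)
    e0 (cs_sn a0 b0 s) (cs_sn a0 b0 s') small.
  by [].
have A2 : \int[leb2]_(x in tri) Wg x <= (2 + 9^-1) * \int[leb2]_(x in tri) grad_density j x.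
  rewrite -RintegralZl//; apply: le_Rintegral => //.
    exact: (integrable_scale mT (2 + 9^-1) ig).
  move=> x _; have [] := parallelogram_gap (h1_grad u1 j x) (h1_grad u2 j x) (h1_grad v1 j x) (h1_grad v2 j x)
    e0 (cs_sn a0 b0 s) (cs_sn a0 b0 s') small.
  by [].
have A3 : 32 / 25 * \int[leb2]_(x in tri) Wf x <= L ^+ 2 * \int[leb2]_(x in tri) Wg x.
  rewrite /Wf /Wg RintegralD//; [|exact: iD _ _ (i2 w1) (i2 w2)|exact: iD _ _ (i2 w3) (i2 w4)].
  rewrite RintegralD// RintegralD//.
  rewrite [in leRHS]RintegralD//; [|exact: iD _ _ (j2 w1) (j2 w2)|exact: iD _ _ (j2 w3) (j2 w4)].
  rewrite [in leRHS]RintegralD// [in leRHS]RintegralD//.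
  by rewrite !mulrDr; apply: lerD; exact: lerD.
have L2 : 0 <= L ^+ 2 by exact: sqr_ge0.
have A4 := ler_wpM2l L2 A2.
move: A1 A3 A4; move: (\int[leb2]_(x in tri) density u1 u2 v1 v2 x) (\int[leb2]_(x in tri) grad_density j x)
  (\int[leb2]_(x in tri) Wf x) (\int[leb2]_(x in tri) Wg x) (L ^+ 2) => p q r t l A1 A3 A4.
have : l * ((2 + 9^-1) * q) = (2 + 9^-1) * (l * q) by ring.
by move: A4; move: (l * ((2 + 9^-1) * q)) (l * q) (l * t) A3 => *; lra.
Qed.

End Energy.

(** * From complex spinors to real components *)

Section ComplexParts.
Context {R : realType}.
Notation mu := (@lebesgue_measure R).

Definition cpart (i : bool) (z : R[i]) : R := if i then complex.Im z else complex.Re z.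

Lemma sqmod_parts (z : R[i]) : sqmod z = cpart false z ^+ 2 + cpart true z ^+ 2.
Proof. by []. Qed.

Lemma cpartB i (z w : R[i]) : cpart i (z - w) = cpart i z - cpart i w.
Proof. by case: z => ? ?; case: w => ? ?; case: i. Qed.

Lemma cpart_le i (z : R[i]) : cpart i z ^+ 2 <= sqmod z.
Proof. by case: i; rewrite /sqmod ?lerDl ?lerDr sqr_ge0. Qed.

Lemma sqmod_ge0 (z : R[i]) : 0 <= sqmod z.
Proof. by rewrite addr_ge0// sqr_ge0. Qed.

Section Generic.
Context d (T : measurableType d) (nu : {measure set T -> \bar R}) (D : set T) (mD : measurable D).
Implicit Types (u w : T -> R[i]).

Definition csqint u := forall i, sqint nu D (fun x => cpart i (u x)).

Lemma csqint_intro u : measurable_fun D (fun x => complex.Re (u x)) ->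
  measurable_fun D (fun x => complex.Im (u x)) ->
  (\int[nu]_(x in D) (sqmod (u x))%:E < +oo)%E -> csqint u.
Proof.
move=> m1 m2 fi i.
have mi : measurable_fun D (fun x => cpart i (u x)) by case: i.
have ms : measurable_fun D (fun x => sqmod (u x)).
  by apply: measurable_funD; exact: measurable_funX.
have iss : nu.-integrable D (EFin \o (fun x => sqmod (u x))).
  apply/integrableP; split; first exact/measurable_EFinP.
  by under eq_integral do rewrite /= ger0_norm ?sqmod_ge0//.
split => //; apply: (integrable_le mD _ iss).
- exact: measurable_funX.
- by move=> x _; rewrite ger0_norm ?sqr_ge0// cpart_le.
Qed.

Lemma csqint_sqmod u : csqint u -> nu.-integrable D (EFin \o (fun x => sqmod (u x))).
Proof.
move=> hu; have := integrableD mD (hu false).2 (hu true).2.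
by apply: eq_integrable.
Qed.

Lemma csqint_elim u : csqint u ->
  [/\ measurable_fun D (fun x => complex.Re (u x)), measurable_fun D (fun x => complex.Im (u x)) &
  (\int[nu]_(x in D) (sqmod (u x))%:E < +oo)%E].
Proof.
move=> hu; split; [exact: (hu false).1|exact: (hu true).1|].
have /integrableP[_] := csqint_sqmod hu.
by under eq_integral do rewrite /= ger0_norm ?sqmod_ge0//.
Qed.

Lemma csqintB u w : csqint u -> csqint w -> csqint (fun x => u x - w x).
Proof.
move=> hu hw i; have := sqint_comb mD 1 (-1) (hu i) (hw i).
by congr sqint; apply/funext => x; rewrite cpartB mul1r mulN1r.
Qed.

Lemma csqcvg_part i (u_ : nat -> T -> R[i]) u : (forall n, csqint (u_ n)) -> csqint u ->
  (fun n => \int[nu]_(x in D) sqmod (u_ n x - u x)) @ \oo --> (0 : R) ->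
  sqcvg nu D (fun n x => cpart i (u_ n x)) (fun x => cpart i (u x)).
Proof.
move=> hu_ hu cu; split; [by move=> n; exact: hu_|exact: hu|].
apply: (@squeeze_cvgr _ _ _ _ (fun=> 0) (fun n => \int[nu]_(x in D) sqmod (u_ n x - u x))) => //.
- apply: nearW => n; rewrite ge0_sqint/=.
  have hB := csqintB (hu_ n) hu.
  have E x : (cpart i (u_ n x) - cpart i (u x)) ^+ 2 = cpart i (u_ n x - u x) ^+ 2 by rewrite cpartB.
  under eq_Rintegral do rewrite E.
  apply: le_Rintegral => //; [exact: (hB i).2|exact: csqint_sqmod|].
  by move=> x _; exact: cpart_le.
- exact: cvg_cst.
Qed.

(** The boundary condition only holds almost everywhere on each side, whereas the
    real traces below are prescribed pointwise; changing the limit on a null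
    set reconciles the two. *)
Lemma sqcvg_ae (f_ : nat -> T -> R) f g : sqcvg nu D f_ f -> sqint nu D g ->
  {ae nu, forall x, D x -> f x = g x} -> sqcvg nu D f_ g.
Proof.
move=> [hf_ hf cf] hg fg; split => //.
rewrite (_ : (fun n => _) = (fun n => \int[nu]_(x in D) ((f_ n x - f x) ^+ 2)))//.
apply/funext => n; rewrite /Rintegral; congr fine.
have sB h : sqint nu D h -> measurable_fun D (EFin \o (fun x => (f_ n x - h x) ^+ 2)).
  move=> hh; apply/measurable_EFinP; apply: measurable_funX.
  by apply: measurable_funB; [exact: (hf_ n).1|exact: hh.1].
apply: ae_eq_integral => //; [exact: sB|exact: sB|].
by apply: filterS fg => x /[apply] ->.
Qed.

End Generic.
End ComplexParts.

Section Domain.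
Context {R : realType} (a b : R) (a0 : 0 < a) (b0 : 0 < b).
Notation mu := (@lebesgue_measure R).
Notation ctri := (ctri a b).
Notation ccont := (conton ctri).
Notation tri := (tri a b).
Notation H1 := (H1 a b).
Notation cs := (cs a b).
Notation sn := (sn a b).
Let mT : measurable (tri : set (plane R)) := measurable_tri a b.
Let m01 : measurable (`[0, 1]%classic : set (measurableTypeR R)) := measurable_itv _.

Lemma inL2_csqint (u : R * R -> R[i]) : inL2 tri u -> csqint (@leb2 R) tri u.
Proof. by move=> [m1 m2 fi]; exact: csqint_intro. Qed.

Lemma wderivP (u : R * R -> R[i]) j : W12 tri u -> weak_deriv tri j u (wderiv tri j u).
Proof. by move=> [_ /(_ j) ex]; exact: (xgetPex _ ex). Qed.

Lemma cC1_parts (u : R * R -> R[i]) i : cC1 u -> Ck 1 (fun x => cpart i (u x)).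
Proof. by case: i => -[]. Qed.

Lemma cpart_cderiv (u : R * R -> R[i]) i j x : cpart i (cderiv j u x) = pd j (fun x => cpart i (u x)) x.
Proof. by case: i. Qed.

Lemma csqint_cC1 (u : R * R -> R[i]) : cC1 u -> csqint (@leb2 R) tri u.
Proof.
move=> hu i; apply: ccont_sqint => // x _.
by have := Ck1_continuous (cC1_parts i hu); apply.
Qed.

Lemma csqint_cderiv (u : R * R -> R[i]) j : cC1 u -> csqint (@leb2 R) tri (cderiv j u).
Proof.
move=> hu i; under eq_fun do rewrite cpart_cderiv; apply: ccont_sqint => // x _.
by have := @Ck1_pd_continuous _ _ j (cC1_parts i hu); apply.
Qed.

Lemma csqint_cC1_side (u : R * R -> R[i]) s : cC1 u ->
  csqint mu `[0, 1] (fun t => u (param a b s t)).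
Proof.
move=> hu k; have c : ccont (fun x => cpart k (u x)).
  by move=> x _; have := Ck1_continuous (cC1_parts k hu); apply.
split; last first.
  by have := ccont_integrable_side a0 b0 s (@ccontX _ ctri _ 2 c).
by have /integrableP[/measurable_EFinP] := ccont_integrable_side a0 b0 s c.
Qed.

Lemma trace_to_part (g : R * R -> R[i]) i (un : nat -> R * R -> R[i]) s :
  inL2_bd a b g -> (forall n, cC1 (un n)) ->
  normL2sq_bd a b (un n - g) @[n --> \oo] --> (0 : R) ->
  trace_to a b s (fun n x => cpart i (un n x)) (fun t => cpart i (g (param a b s t))).
Proof.
move=> hg hun cvg.
have cg s' : csqint mu `[0, 1] (fun t => g (param a b s' t)).
  by have [m1 m2 fi] := hg s'; exact: csqint_intro.
have cu n s' : csqint mu `[0, 1] (fun t => un n (param a b s' t)) by exact: csqint_cC1_side.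
apply: csqcvg_part => //.
have l0 s' : 0 < side_length a b s'.
  by case: s' => //=; rewrite sqrtr_gt0 addr_gt0// exprn_gt0.
pose I s' n := \int[mu]_(t in `[0, 1]) sqmod (un n (param a b s' t) - g (param a b s' t)).
have I0 s' n : 0 <= I s' n by apply: Rintegral_ge0 => t _; exact: sqmod_ge0.
apply: (@squeeze_cvgr _ _ _ _ (fun=> 0) (fun n => (side_length a b s)^-1 * normL2sq_bd a b (un n - g))).
- apply: nearW => n; rewrite -/(I s n) I0/= ler_pdivlMl//.
  rewrite /normL2sq_bd /sides !big_cons big_nil addr0.
  have E s' : side_length a b s' * \int[mu]_(t in `[0, 1]) sqmod ((un n - g) (param a b s' t)) = side_length a b s' * I s' n by [].
  rewrite !E; have p0 s' : 0 <= side_length a b s' * I s' n by rewrite mulr_ge0// ltW.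
  have := p0 OA; have := p0 OB; have := p0 AB.
  case: s; move: (side_length a b OA * _) (side_length a b OB * _) (side_length a b AB * _) => x y z; lra.
- exact: cvg_cst.
- by rewrite -[X in _ --> X](mulr0 (side_length a b s)^-1); apply: cvgM => //; exact: cvg_cst.
Qed.

Lemma h1lim_part (u : R * R -> R[i]) i (un : nat -> R * R -> R[i]) :
  W12 tri u -> (forall n, cC1 (un n)) ->
  normL2sq tri (un n - u) @[n --> \oo] --> (0 : R) ->
  (forall j, normL2sq tri (cderiv j (un n) - wderiv tri j u) @[n --> \oo] --> (0 : R)) ->
  h1lim a b (fun n x => cpart i (un n x)) (fun x => cpart i (u x))
    (fun x => cpart i (wderiv tri false u x)) (fun x => cpart i (wderiv tri true u x)).
Proof.
move=> hW hun c0 c1.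
have hd j : csqint (@leb2 R) tri (wderiv tri j u).
  by have [h _ _] := wderivP j hW; exact: inL2_csqint.
have cd j : sqcvg (@leb2 R) tri (fun n x => cpart i (cderiv j (un n) x)) (fun x => cpart i (wderiv tri j u x)).
  apply: csqcvg_part => //; first by move=> n; exact: csqint_cderiv.
  exact: c1.
split.
- by move=> n; exact: cC1_parts.
- apply: csqcvg_part => //; first by move=> n; exact: csqint_cC1.
  by case: hW => h _; exact: inL2_csqint.
- by have := cd false; congr sqcvg; apply/funext => n; apply/funext => x; rewrite cpart_cderiv.
- by have := cd true; congr sqcvg; apply/funext => n; apply/funext => x; rewrite cpart_cderiv.
Qed.

Record is_h1 (f : H1) (u : R * R -> R[i]) (i : bool) : Prop := IsH1 {
  is_h1_fun : h1_fun f = (fun x => cpart i (u x));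
  is_h1_grad : forall j, h1_grad f j = (fun x => cpart i (wderiv tri j u x)) }.

Lemma domain_h1 (psi : (R * R -> R[i]) * (R * R -> R[i])) : dirac_domain a b psi ->
  exists u1 u2 v1 v2 : H1,
    [/\ is_h1 u1 psi.1 false, is_h1 u2 psi.1 true, is_h1 v1 psi.2 false & is_h1 v2 psi.2 true] /\
    ((forall s t, h1_trace v1 s t = cs s * h1_trace u1 s t - sn s * h1_trace u2 s t) /\
     (forall s t, h1_trace v2 s t = sn s * h1_trace u1 s t + cs s * h1_trace u2 s t)).
Proof.
case: psi => u v [/= Wu Wv [g1 [g2 [[hg1 [un [cun un0 un1 unb]]] [hg2 [vn [cvn vn0 vn1 vnb]]] bc]]]].
have tu i s := trace_to_part i s hg1 cun unb.
have tv i s := trace_to_part i s hg2 cvn vnb.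
have hu i := h1lim_part i Wu cun un0 un1.
have hv i := h1lim_part i Wv cvn vn0 vn1.
pose g i s t := cpart i (g1 (param a b s t)).
have sg i s : sqint mu `[0, 1] (g i s) by have [_ h _] := tu i s.
have tv1 s : trace_to a b s (fun n x => cpart false (vn n x)) (fun t => cs s * g false s t + - sn s * g true s t).
  apply: (sqcvg_ae m01 (tv false s)); first exact: sqint_comb.
  apply: (@filterS _ _ (ae_filter_ringOfSetsType mu) _ _ _ (bc s)) => t H t01; rewrite (H t01) /g /cs /sn /=.
  by case: (g1 _) => x y; simpc; rewrite /=; ring.
have tv2 s : trace_to a b s (fun n x => cpart true (vn n x)) (fun t => sn s * g false s t + cs s * g true s t).
  apply: (sqcvg_ae m01 (tv true s)); first exact: sqint_comb.
  apply: (@filterS _ _ (ae_filter_ringOfSetsType mu) _ _ _ (bc s)) => t H t01; rewrite (H t01) /g /cs /sn /=.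
  by case: (g1 _) => x y; simpc; rewrite /=; ring.
pose gr (w : R * R -> R[i]) i j x := cpart i (wderiv tri j w x).
exists (@MkH1 _ a b _ _ (gr u false) (g false) (hu false) (tu false)).
exists (@MkH1 _ a b _ _ (gr u true) (g true) (hu true) (tu true)).
exists (@MkH1 _ a b _ _ (gr v false) _ (hv false) tv1).
exists (@MkH1 _ a b _ _ (gr v true) _ (hv true) tv2).
by split; [split; split|split => s t /=; rewrite ?mulNr].
Qed.

End Domain.

(** * Lower bound for thin triangles *)

Section LowerBound.
Context {R : realType} (a b : R) (a0 : 0 < a) (b0 : 0 < b).
Notation ctri := (ctri a b).
Notation tri := (tri a b).
Notation H1 := (H1 a b).
Notation cs := (cs a b).
Notation sn := (sn a b).
Let mT : measurable (tri : set (plane R)) := measurable_tri a b.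

Lemma sqmod_dirac (m : R) (z1 z2 p1 p2 q1 q2 : R[i]) :
  sqmod (m%:C%C * z1 - 'i%C * (q1 - 'i%C * q2)) + sqmod (- 'i%C * (p1 + 'i%C * p2) - m%:C%C * z2) =
  m ^+ 2 * (sqmod z1 + sqmod z2) + (sqmod p1 + sqmod p2 + sqmod q1 + sqmod q2) +
  2 * ((cpart false q1 * cpart true q2 - cpart false q2 * cpart true q1) -
       (cpart false p1 * cpart true p2 - cpart false p2 * cpart true p1)) +
  2 * m * (cpart false z1 * cpart true q1 + cpart true z2 * cpart false p1
    - (cpart true z1 * cpart false q1 + cpart false z2 * cpart true p1)
    - (cpart false z1 * cpart false q2 + cpart false z2 * cpart false p2)
    - (cpart true z1 * cpart true q2 + cpart true z2 * cpart true p2)).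
Proof.
case: z1 z2 p1 p2 q1 q2 => ? ? [? ?] [? ?] [? ?] [? ?] [? ?].
by simpc; rewrite /sqmod /cpart /=; ring.
Qed.

Lemma dirac_parts (m : R) (z p1 p2 : R[i]) :
  [/\ cpart false (m%:C%C * z - 'i%C * (p1 - 'i%C * p2)) = m * cpart false z + 1 * (1 * cpart true p1 + -1 * cpart false p2),
      cpart true (m%:C%C * z - 'i%C * (p1 - 'i%C * p2)) = m * cpart true z + 1 * (-1 * cpart false p1 + -1 * cpart true p2),
      cpart false (- 'i%C * (p1 + 'i%C * p2) - m%:C%C * z) = - m * cpart false z + 1 * (1 * cpart true p1 + 1 * cpart false p2) &
      cpart true (- 'i%C * (p1 + 'i%C * p2) - m%:C%C * z) = - m * cpart true z + 1 * (-1 * cpart false p1 + 1 * cpart true p2)].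
Proof.
case: z p1 p2 => ? ? [? ?] [? ?].
by simpc; rewrite /cpart /=; split; ring.
Qed.

Lemma csqint_dirac (m : R) (psi : (R * R -> R[i]) * (R * R -> R[i])) : W12 tri psi.1 -> W12 tri psi.2 ->
  csqint (@leb2 R) tri (dirac_op m a b psi).1 /\ csqint (@leb2 R) tri (dirac_op m a b psi).2.
Proof.
move=> W1 W2.
have s1 : csqint (@leb2 R) tri psi.1 by case: W1 => h _; exact: inL2_csqint.
have s2 : csqint (@leb2 R) tri psi.2 by case: W2 => h _; exact: inL2_csqint.
have d1 j : csqint (@leb2 R) tri (wderiv tri j psi.1).
  by have [h _ _] := wderivP j W1; exact: inL2_csqint.
have d2 j : csqint (@leb2 R) tri (wderiv tri j psi.2).
  by have [h _ _] := wderivP j W2; exact: inL2_csqint.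
have C c d (f g : R * R -> R) := @sqint_comb _ _ R (@leb2 R) tri mT f g c d.
split; case.
- have := C m 1 _ _ (s1 true) (C (-1) (-1) _ _ (d2 false false) (d2 true true)).
  congr sqint; apply/funext => x; apply: esym.
  by have [_ E _ _] := dirac_parts m (psi.1 x) (wderiv tri false psi.2 x) (wderiv tri true psi.2 x).
- have := C m 1 _ _ (s1 false) (C 1 (-1) _ _ (d2 false true) (d2 true false)).
  congr sqint; apply/funext => x; apply: esym.
  by have [E _ _ _] := dirac_parts m (psi.1 x) (wderiv tri false psi.2 x) (wderiv tri true psi.2 x).
- have := C (- m) 1 _ _ (s2 true) (C (-1) 1 _ _ (d1 false false) (d1 true true)).
  congr sqint; apply/funext => x; apply: esym.
  by have [_ _ _ E] := dirac_parts m (psi.2 x) (wderiv tri false psi.1 x) (wderiv tri true psi.1 x).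
- have := C (- m) 1 _ _ (s2 false) (C 1 1 _ _ (d1 false true) (d1 true false)).
  congr sqint; apply/funext => x; apply: esym.
  by have [_ _ E _] := dirac_parts m (psi.2 x) (wderiv tri false psi.1 x) (wderiv tri true psi.1 x).
Qed.

Lemma dirac_lower_bound (m : R) psi s s' j (L : R) : 0 <= m ->
  crossing s j -> crossing s' j -> 0 < L ->
  (forall x, ctri x -> height a b s j x <= L) -> (forall x, ctri x -> height a b s' j x <= L) ->
  (cs s + cs s') ^+ 2 + (sn s + sn s') ^+ 2 <= 9^-1 ^+ 2 ->
  dirac_domain a b psi ->
  (m ^+ 2 + 544 / 475 / L ^+ 2) * spinor_normsq a b psi <= spinor_normsq a b (dirac_op m a b psi).
Proof.
move=> m0 cr cr' L0 hL hL' small dom.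
have [u1 [u2 [v1 [v2 [[Hu1 Hu2 Hv1 Hv2] [tr1 tr2]]]]]] := domain_h1 a0 b0 dom.
have [W1 W2 _] := dom.
have [q1 q2] := csqint_dirac m W1 W2.
have bal := jacobian_balance a0 b0 (dev_trace0 tr1 tr2).
have cr0 := cross_ge0 a0 b0 tr1 tr2.
have gap := gap_estimate a0 b0 tr1 tr2 cr cr' L0 hL hL' small.
have iD f g := @integrable_add _ _ R (@leb2 R) tri mT f g.
have iB f g := @integrable_sub _ _ R (@leb2 R) tri mT f g.
have iZ c f := @integrable_scale _ _ R (@leb2 R) tri mT c f.
have i2 (f : H1) := (h1_sqint f).2; have j2 k (f : H1) := (h1_sqint_grad f k).2.
have id : L1 tri (density u1 u2 v1 v2).
  exact: iD _ _ (iD _ _ (iD _ _ (i2 u1) (i2 u2)) (i2 v1)) (i2 v2).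
have ig k : L1 tri (grad_density u1 u2 v1 v2 k).
  exact: iD _ _ (iD _ _ (iD _ _ (j2 k u1) (j2 k u2)) (j2 k v1)) (j2 k v2).
pose jac (f g : H1) x := h1_grad f false x * h1_grad g true x - h1_grad f true x * h1_grad g false x.
have ij (f g : H1) : L1 tri (jac f g).
  exact: iB _ _ (sqint_mul mT (h1_sqint_grad f false) (h1_sqint_grad g true))
    (sqint_mul mT (h1_sqint_grad f true) (h1_sqint_grad g false)).
have ic := integrable_cross a0 b0 u1 u2 v1 v2.
have norm_psi : spinor_normsq a b psi = \int[leb2]_(x in tri) density u1 u2 v1 v2 x.
  have s1 : csqint (@leb2 R) tri psi.1 by case: W1 => h _; exact: inL2_csqint.
  have s2 : csqint (@leb2 R) tri psi.2 by case: W2 => h _; exact: inL2_csqint.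
  rewrite /spinor_normsq /normL2sq -RintegralD//; [|exact: csqint_sqmod|exact: csqint_sqmod].
  apply: eq_Rintegral => x _.
  rewrite /density (is_h1_fun Hu1) (is_h1_fun Hu2) (is_h1_fun Hv1) (is_h1_fun Hv2) !sqmod_parts.
  by ring.
have norm_T : spinor_normsq a b (dirac_op m a b psi) =
    m ^+ 2 * \int[leb2]_(x in tri) density u1 u2 v1 v2 x +
    (\int[leb2]_(x in tri) grad_density u1 u2 v1 v2 false x + \int[leb2]_(x in tri) grad_density u1 u2 v1 v2 true x) +
    2 * (\int[leb2]_(x in tri) jac v1 v2 x - \int[leb2]_(x in tri) jac u1 u2 x) +
    2 * m * \int[leb2]_(x in tri) cross u1 u2 v1 v2 x.
  transitivity (\int[leb2]_(x in tri) (m ^+ 2 * density u1 u2 v1 v2 x +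
    (grad_density u1 u2 v1 v2 false x + grad_density u1 u2 v1 v2 true x) +
    2 * (jac v1 v2 x - jac u1 u2 x) + 2 * m * cross u1 u2 v1 v2 x)); last first.
    have k1 := iZ (m ^+ 2) _ id; have k2 := iD _ _ (ig false) (ig true).
    have k3 := iZ 2 _ (iB _ _ (ij v1 v2) (ij u1 u2)); have k4 := iZ (2 * m) _ ic.
    rewrite RintegralD//; last exact: iD _ _ (iD _ _ k1 k2) k3.
    rewrite RintegralD//; last exact: iD _ _ k1 k2.
    rewrite RintegralD// RintegralD// RintegralZl// RintegralZl//; last exact: iB.
    by rewrite RintegralB// RintegralZl.
  rewrite /spinor_normsq /normL2sq -[in LHS]RintegralD//; [|exact: csqint_sqmod|exact: csqint_sqmod].
  apply: eq_Rintegral => x _.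
  apply: (etrans (sqmod_dirac m (psi.1 x) (psi.2 x) (wderiv tri false psi.1 x) (wderiv tri true psi.1 x)
    (wderiv tri false psi.2 x) (wderiv tri true psi.2 x))).
  rewrite /density /grad_density /jac /cross (is_h1_fun Hu1) (is_h1_fun Hu2) (is_h1_fun Hv1) (is_h1_fun Hv2).
  rewrite !(is_h1_grad Hu1) !(is_h1_grad Hu2) !(is_h1_grad Hv1) !(is_h1_grad Hv2).
  move: (psi.1 x) (psi.2 x) (wderiv tri false psi.1 x) (wderiv tri true psi.1 x)
    (wderiv tri false psi.2 x) (wderiv tri true psi.2 x) => z1 z2 w1 w2 w3 w4.
  rewrite !sqmod_parts.
  by ring.
have g0 k : 0 <= \int[leb2]_(x in tri) grad_density u1 u2 v1 v2 k x.
  by apply: Rintegral_ge0 => x _; rewrite !addr_ge0// sqr_ge0.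
have g1 := g0 false; have g2 := g0 true.
rewrite norm_T norm_psi -/(jac v1 v2) -/(jac u1 u2).
have -> : \int[leb2]_(x in tri) jac v1 v2 x - \int[leb2]_(x in tri) jac u1 u2 x = 0.
  by apply/eqP; rewrite subr_eq0; apply/eqP; exact: bal.
have mc : 0 <= 2 * m * \int[leb2]_(x in tri) cross u1 u2 v1 v2 x by rewrite mulr_ge0// mulr_ge0.
have L2 : 0 < L ^+ 2 by rewrite exprn_gt0.
have gap' : 544 / 475 / L ^+ 2 * \int[leb2]_(x in tri) density u1 u2 v1 v2 x <= \int[leb2]_(x in tri) grad_density u1 u2 v1 v2 j x.
  by rewrite mulrAC ler_pdivrMr// mulrC [leRHS]mulrC mulrC.
have gle : \int[leb2]_(x in tri) grad_density u1 u2 v1 v2 j x <=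
  \int[leb2]_(x in tri) grad_density u1 u2 v1 v2 false x + \int[leb2]_(x in tri) grad_density u1 u2 v1 v2 true x.
  by case: (j); rewrite ?lerDl ?lerDr.
rewrite mulrDl mulr0 addr0.
apply: (@le_trans _ _ (m ^+ 2 * \int[leb2]_(x in tri) density u1 u2 v1 v2 x +
    (\int[leb2]_(x in tri) grad_density u1 u2 v1 v2 false x + \int[leb2]_(x in tri) grad_density u1 u2 v1 v2 true x))).
  by rewrite lerD2l (le_trans gap').
by rewrite lerDl.
Qed.

End LowerBound.

(** * Smooth functions with compact support *)

Section SmoothBump.
Context {R : realType}.
Implicit Types (P : {poly R}) (t : R).

(** The function [P(1/t) exp(-1/t)] on the positive half-line, extended by
    zero; this family is stable under differentiation. *)
Definition flat P t : R := if 0 < t then P.[t^-1] * expR (- t^-1) else 0.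

Definition flat_der P : {poly R} := 'X^2 * (P - P^`()%R).

(** Quadratic decay at 0 gives both continuity and a zero derivative there; it
    follows from [s ^+ n <= n! exp s] applied to every monomial. *)
Lemma flat_quadratic P : exists2 C : R, 0 <= C & forall t, `|flat P t| <= C * t ^+ 2.
Proof.
exists (\sum_(i < size P) `|P`_i| * (i.+2)`!%:R).
  by apply: sumr_ge0 => i _; rewrite mulr_ge0.
move=> t; rewrite /flat; case: ifPn => [t0|_]; last first.
  by rewrite normr0 mulr_ge0 ?sqr_ge0// sumr_ge0// => i _; rewrite mulr_ge0.
have s0 : 0 < t^-1 by rewrite invr_gt0.
rewrite normrM (ger0_norm (expR_ge0 _)) horner_coef.
apply: (@le_trans _ _ ((\sum_(i < size P) `|P`_i| * t^-1 ^+ i) * expR (- t^-1))).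
  rewrite ler_wpM2r ?expR_ge0//; apply: (le_trans (ler_norm_sum _ _ _)).
  by apply: ler_sum => i _; rewrite normrM normrX (gtr0_norm s0).
rewrite !mulr_suml; apply: ler_sum => i _.
rewrite -!mulrA ler_wpM2l//.
have H := expR_ge1Dxn i.+1 (ltW s0).
have f0 : (0 : R) < (i.+2)`!%:R by rewrite ltr0n fact_gt0.
have {}H : t^-1 ^+ i.+2 <= (i.+2)`!%:R * expR t^-1.
  by rewrite mulrC -ler_pdivrMr// (le_trans _ H)// lerDr.
rewrite expRN ler_pdivrMr ?expR_gt0//.
have tn : t != 0 by rewrite gt_eqF.
have -> : t^-1 ^+ i = t^-1 ^+ i.+2 * t ^+ 2.
  by rewrite -[i.+2]addn2 exprD -mulrA -exprMn mulVf// expr1n mulr1.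
by rewrite [leRHS]mulrAC ler_wpM2r ?sqr_ge0.
Qed.

Lemma is_derive_horner P t : is_derive t 1 (fun t => P.[t]) P^`()%R.[t].
Proof.
elim/poly_ind: P => [|P c IH].
  apply: (der_eq (is_derive_cst (0 : R) t 1)) => [u|]; first by rewrite horner0.
  by rewrite deriv0 horner0.
apply: (der_eq (derD (derM IH (is_derive_id t 1)) (is_derive_cst c t 1))) => [u|].
  by rewrite hornerMXaddC.
by rewrite derivMXaddC !hornerE /=; ring.
Qed.

Lemma flat_le0 P t : t <= 0 -> flat P t = 0.
Proof. by move=> t0; rewrite /flat ltNge t0. Qed.

Lemma flat_gt0 P t : 0 < t -> flat P t = P.[t^-1] * expR (- t^-1).
Proof. by move=> t0; rewrite /flat t0. Qed.

Lemma is_derive_flat P t : is_derive t 1 (flat P) (flat (flat_der P) t).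
Proof.
have [t0|t0|t0] := ltgtP t 0.
- rewrite flat_le0 ?ltW//.
  apply: (@near_eq_is_derive _ _ _ (cst (0 : R))).
  by near=> u; rewrite flat_le0// ltW//; near: u; exact: lt_nbhsl.
- rewrite flat_gt0//.
  apply: (@near_eq_is_derive _ _ _ (fun t => P.[t^-1] * expR (- t^-1))).
    by near=> u; rewrite flat_gt0//; near: u; exact: lt_nbhsr.
  have tn : t != 0 by rewrite gt_eqF.
  have dV : is_derive t 1 (fun u : R => u^-1) (- t ^- 2).
    by have := @is_deriveV R id t 1 1 tn (is_derive_id _ _); rewrite /GRing.scale/= mulr1.
  have d1 := @is_derive1_comp R (fun s => P.[s]) (fun u => u^-1) t _ _ (is_derive_horner P t^-1) dV.
  have d2 := @is_derive1_comp R expR (fun u => - u^-1) t _ _ (is_derive_expR (- t^-1)) (derN dV).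
  apply: (der_eq (derM d1 d2)) => //.
  by rewrite /flat_der !hornerE /=; field.
- rewrite t0 flat_le0//.
  have [C C0 HC] := flat_quadratic P.
  have E0 : flat P 0 = 0 by rewrite flat_le0.
  have cv : (fun h : R => h^-1 *: (flat P (h *: 1 + 0) - flat P 0)) @ 0^' --> (0 : R).
    apply: norm_cvg0; apply: (@squeeze_cvgr _ _ _ _ (fun=> 0) (fun h : R => C * `|h|)).
    + near=> h; rewrite normr_ge0/= E0 subr0 addr0 /GRing.scale/= mulr1.
      have hn : h != 0 by near: h; exact: nbhs_dnbhs_neq.
      rewrite normrM normfV mulrC ler_pdivrMr ?normr_gt0//.
      by rewrite -mulrA -expr2 real_normK ?num_real.
    + exact: cvg_cst.
    + have E : C * `|0 : R| = 0 by rewrite normr0 mulr0.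
      rewrite -[X in _ --> X]E.
      have cc : (fun h : R => C * `|h|) @ nbhs (0 : R) --> C * `|0 : R|.
        by apply: cvgM; [exact: cvg_cst|apply: cvg_norm; exact: cvg_id].
      by apply: cvg_trans cc; apply: cvg_app; exact: nbhs_dnbhs.
  split.
  + by apply/cvg_ex; exists 0.
  + by apply/cvg_lim.
Unshelve. all: by end_near. Qed.

End SmoothBump.

(** * Bumps converging to the indicator of a box *)

Section SmoothProducts.
Context {R : realType}.
Implicit Types (f g : R * R -> R) (P : {poly R}).

Lemma CkS k f : Ck k.+1 f -> Ck k f.
Proof.
elim: k f => [|k IH] f; first by case.
by move=> [cf hf]; split => // j; have [df /IH] := hf j.
Qed.

Lemma Ck_continuous k f : Ck k f -> continuous f.
Proof. by case: k => [|k] []. Qed.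

Lemma Ck_derive k f j x : Ck k.+1 f -> is_derive x (dir j) f ('D_(dir j) f x).
Proof. by move=> [_ /(_ j) [df _]]; split. Qed.

Lemma CkD k f g : Ck k f -> Ck k g -> Ck k (fun x => f x + g x).
Proof.
elim: k f g => [|k IH] f g hf hg.
  by split => // x; apply: cvgD; [exact: Ck_continuous hf x|exact: Ck_continuous hg x].
split=> [x|j]; first by apply: cvgD; [exact: Ck_continuous hf x|exact: Ck_continuous hg x].
have d x := derD (Ck_derive j x hf) (Ck_derive j x hg).
split=> [x|]; first by have [] := d x.
rewrite (_ : (fun x => 'D_(dir j) _ x) = fun x => 'D_(dir j) f x + 'D_(dir j) g x).
  by apply: IH; [case: hf => _ /(_ j) []|case: hg => _ /(_ j) []].
by apply/funext => x; apply: derive_val; exact: d.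
Qed.

Lemma CkM k f g : Ck k f -> Ck k g -> Ck k (fun x => f x * g x).
Proof.
elim: k f g => [|k IH] f g hf hg.
  by split => // x; apply: cvgM; [exact: Ck_continuous hf x|exact: Ck_continuous hg x].
split=> [x|j]; first by apply: cvgM; [exact: Ck_continuous hf x|exact: Ck_continuous hg x].
have d x := derM (Ck_derive j x hf) (Ck_derive j x hg).
split=> [x|]; first by have [] := d x.
rewrite (_ : (fun x => 'D_(dir j) _ x) = fun x => f x * 'D_(dir j) g x + g x * 'D_(dir j) f x).
  by apply: CkD; apply: IH; (try exact: CkS); [case: hg => _ /(_ j) []|case: hf => _ /(_ j) []].
by apply/funext => x; apply: derive_val; exact: d.
Qed.

Lemma Ck_cst k (c : R) : Ck k (fun=> c).
Proof.
elim: k c => [|k IH] c; first by split => // x; exact: cvg_cst.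
split=> [x|j]; first exact: cvg_cst.
have d x : is_derive x (dir j) (fun _ : R * R => c) 0 := is_derive_cst c x (dir j).
split=> [x|]; first by have [] := d x.
rewrite (_ : (fun x => 'D_(dir j) _ x) = fun=> 0); first exact: IH.
by apply/funext => x; apply: derive_val; exact: d.
Qed.

Lemma continuous_flat P : continuous (flat P).
Proof.
move=> t; apply: differentiable_continuous; apply/derivable1_diffP.
by have [] := is_derive_flat P t.
Qed.

Lemma Ck_flat k P (c1 c2 c0 : R) : Ck k (fun x => flat P (c1 * x.1 + c2 * x.2 + c0)).
Proof.
elim: k P => [|k IH] P.
  split => // x; apply: (@cvg_comp _ _ _ (fun x => _) (flat P)); first exact: cont_lin.
  exact: continuous_flat.
split=> [x|j].
  apply: (@cvg_comp _ _ _ (fun x => _) (flat P)); first exact: cont_lin.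
  exact: continuous_flat.
have d x := der_comp (der_coord c1 c2 c0 x j) (is_derive_flat P (c1 * x.1 + c2 * x.2 + c0)).
split=> [x|]; first by have [] := d x.
rewrite (_ : (fun x => 'D_(dir j) _ x) = fun x => flat (flat_der P) (c1 * x.1 + c2 * x.2 + c0) *
   (if j then c2 else c1)).
  by apply: CkM; [exact: IH|exact: Ck_cst].
by apply/funext => x; apply: derive_val; exact: d.
Qed.

Lemma flat1_bound (t : R) : 0 <= flat 1 t <= 1.
Proof.
have [t0|t0] := leP t 0; first by rewrite flat_le0// lexx ler01.
rewrite flat_gt0// hornerC mul1r expR_ge0/=.
by rewrite -[leRHS]expR0 ler_expR oppr_le0 invr_ge0 ltW.
Qed.

Lemma flat1_cvg (t : R) : (fun n => flat 1 (n.+1%:R * t)) @ \oo --> ((0 < t)%R%:R : R).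
Proof.
have [t0|t0] := leP t 0.
  rewrite (_ : (fun n => _) = fun=> 0); first exact: cvg_cst.
  by apply/funext => n; rewrite flat_le0// mulr_ge0_le0.
rewrite (_ : (fun n => _) = expR \o (fun n : nat => (- t^-1) * (n.+1%:R^-1 : R))); last first.
  by apply/funext => n; rewrite flat_gt0 ?mulr_gt0// hornerC mul1r invfM /= mulNr [t^-1 * _]mulrC.
have -> : (true%:R : R) = expR ((- t^-1) * 0) by rewrite mulr0 expR0.
apply: (@cvg_comp _ _ _ _ (@expR R)); last exact: continuous_expR.
by apply: cvgM; [exact: cvg_cst|exact: cvg_harmonic].
Qed.

Definition box (al be ga de : R) : set (R * R) := `]al, be[ `*` `]ga, de[.

(** Each factor [flat 1 (n.+1 * t)] is [exp (- 1 / (n.+1 t))] for positive [t], which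
    tends to 1. *)
Definition box_bump (al be ga de : R) n (x : R * R) : R :=
  flat 1 (n.+1%:R * (x.1 - al)) * flat 1 (n.+1%:R * (be - x.1)) *
  (flat 1 (n.+1%:R * (x.2 - ga)) * flat 1 (n.+1%:R * (de - x.2))).

Lemma box_bump_test (U : set (R * R)) al be ga de n :
  `[al, be] `*` `[ga, de] `<=` U -> test_function U (box_bump al be ga de n).
Proof.
move=> KU; split.
  move=> k.
  have h (c1 c2 c0 : R) (l : R * R -> R) : (forall x, l x = c1 * x.1 + c2 * x.2 + c0) -> Ck k (fun x => flat 1 (l x)).
    by move=> /funext ->; exact: Ck_flat.
  apply: CkM; apply: CkM.
  - by apply: (h n.+1%:R 0 (- (n.+1%:R * al))) => x; ring.
  - by apply: (h (- n.+1%:R) 0 (n.+1%:R * be)) => x; ring.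
  - by apply: (h 0 n.+1%:R (- (n.+1%:R * ga))) => x; ring.
  - by apply: (h 0 (- n.+1%:R) (n.+1%:R * de)) => x; ring.
exists (`[al, be] `*` `[ga, de]); split => //.
  by apply: compact_setX; exact: segment_compact.
move=> [x y] nK; rewrite /box_bump /=.
have z (c : R) : c <= 0 -> flat 1 (n.+1%:R * c) = 0.
  by move=> c0; rewrite flat_le0// mulr_ge0_le0.
have [x1|x1] := leP x al; first by rewrite z ?mul0r// subr_le0.
have [x2|x2] := leP be x; first by rewrite [flat 1 (_ * (be - x))]z ?(mulr0, mul0r)// subr_le0.
have [y1|y1] := leP y ga; first by rewrite [flat 1 (_ * (y - ga))]z ?(mulr0, mul0r)// subr_le0.
have [y2|y2] := leP de y; first by rewrite [flat 1 (_ * (de - y))]z ?(mulr0, mul0r)// subr_le0.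
by exfalso; apply: nK; split; rewrite /= in_itv/= !ltW.
Qed.

Lemma box_bump_bound al be ga de n x : `|box_bump al be ga de n x| <= 1.
Proof.
have h (s t : R) : 0 <= s <= 1 -> 0 <= t <= 1 -> 0 <= s * t <= 1.
  move=> /andP[s0 s1] /andP[t0 t1]; rewrite mulr_ge0//=.
  by rewrite -[leRHS]mulr1 ler_pM.
have /andP[h0 h1] : 0 <= box_bump al be ga de n x <= 1.
  by apply: (h _ _); apply: (h _ _); exact: flat1_bound.
by rewrite ger0_norm.
Qed.

Lemma box_bump_cvg al be ga de x :
  (fun n => box_bump al be ga de n x) @ \oo --> (\1_(box al be ga de) x : R).
Proof.
have -> : \1_(box al be ga de) x = (0 < x.1 - al)%R%:R * (0 < be - x.1)%R%:R *
   ((0 < x.2 - ga)%R%:R * (0 < de - x.2)%R%:R) :> R.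
  rewrite !subr_gt0 -!natrM !mulnb indicE; congr (_ %:R); congr nat_of_bool.
  apply/idP/idP => [/set_mem[]|/andP[h1 h2]]; first by rewrite /= !in_itv/= => -> ->.
  by apply: mem_set; split; rewrite /= in_itv/=.
by apply: cvgM; apply: cvgM; exact: flat1_cvg.
Qed.

End SmoothProducts.

(** * Uniqueness of weak derivatives *)

Section FundamentalLemma.
Context {R : realType}.
Notation mR := (measurableTypeR R).
Implicit Types (g : R * R -> R) (U : set (R * R)).

Definition boxes : set_system (R * R) :=
  [set B | exists al be ga de, B = box al be ga de].

Lemma boxP al be ga de (x : R * R) :
  box al be ga de x <-> [/\ al < x.1, x.1 < be, ga < x.2 & x.2 < de].
Proof.
rewrite /box /= !in_itv/=; split=> [[/andP[? ?] /andP[? ?]]//|[-> -> -> ->]//].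
Qed.

Lemma box_measurable al be ga de : measurable (box al be ga de : set (mR * mR)).
Proof. by apply: measurableX; exact: measurable_itv. Qed.

Lemma boxI (a1 b1 c1 d1 a2 b2 c2 d2 : R) : box a1 b1 c1 d1 `&` box a2 b2 c2 d2 =
  box (Num.max a1 a2) (Num.min b1 b2) (Num.max c1 c2) (Num.min d1 d2).
Proof.
apply/seteqP; split => x.
  by move=> [/boxP[? ? ? ?] /boxP[? ? ? ?]]; apply/boxP; rewrite !gt_max !lt_min; split; apply/andP.
move=> /boxP; rewrite !gt_max !lt_min => -[/andP[? ?] /andP[? ?] /andP[? ?] /andP[? ?]].
by split; apply/boxP.
Qed.

Lemma boxes_setI : setI_closed boxes.
Proof.
by move=> _ _ [? [? [? [? ->]]]] [? [? [? [? ->]]]]; rewrite boxI; do 4 eexists.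
Qed.

Lemma box_sigma : @measurable _ (mR * mR)%type = <<s boxes >>.
Proof.
rewrite eqEsubset; split; last first.
  apply: smallest_sub; first exact: sigma_algebra_measurable.
  by move=> _ [? [? [? [? ->]]]]; exact: box_measurable.
have bnd (x : R) : exists n : nat, - n%:R < x /\ x < n%:R.
  by exists (Num.bound `|x|); apply/andP; rewrite -ltr_norml archi_boundP.
apply: smallest_sub; first exact: smallest_sigma_algebra.
have sig := smallest_sigma_algebra setT boxes.
have sbox al be ga de : <<s boxes >> (box al be ga de).
  by apply: sub_sigma_algebra; do 4 eexists.
rewrite subUset; split=> _ [A mA <-]; rewrite setTI.
- suff : @measurable _ mR `<=` image_set_system setT (fst : R * R -> R) <<s boxes >>.
    by move=> /(_ A mA); rewrite /image_set_system /= setTI.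
  have -> : @measurable _ mR = <<s @RGenOpens.G R >> := RGenOpens.measurableE R.
  apply: smallest_sub; first exact: sigma_algebra_image.
  move=> _ [x [y ->]]; rewrite /image_set_system /= setTI.
  rewrite (_ : _ @^-1` _ = \bigcup_n box x y (- n%:R) n%:R).
    by apply: sigma_algebra_bigcup => n.
  apply/seteqP; split => z /=.
    rewrite in_itv/= => /andP[? ?]; have [n [? ?]] := bnd z.2.
    by exists n => //; apply/boxP.
  by move=> [n _ /boxP[? ? ? ?]]; rewrite in_itv/=; apply/andP.
- suff : @measurable _ mR `<=` image_set_system setT (snd : R * R -> R) <<s boxes >>.
    by move=> /(_ A mA); rewrite /image_set_system /= setTI.
  have -> : @measurable _ mR = <<s @RGenOpens.G R >> := RGenOpens.measurableE R.
  apply: smallest_sub; first exact: sigma_algebra_image.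
  move=> _ [x [y ->]]; rewrite /image_set_system /= setTI.
  rewrite (_ : _ @^-1` _ = \bigcup_n box (- n%:R) n%:R x y).
    by apply: sigma_algebra_bigcup => n.
  apply/seteqP; split => z /=.
    rewrite in_itv/= => /andP[? ?]; have [n [? ?]] := bnd z.1.
    by exists n => //; apply/boxP.
  by move=> [n _ /boxP[? ? ? ?]]; rewrite in_itv/=; apply/andP.
Qed.

(** The sets on which [g] integrates to 0 form a Dynkin system containing the
    boxes, which are stable under intersection and generate the Borel sets. *)
Lemma box_ae_eq0 al be ga de g :
  L1 (box al be ga de) g ->
  (forall a b c d, `[a, b] `*` `[c, d] `<=` `[al, be] `*` `[ga, de] ->
    \int[@leb2 R]_(x in box a b c d) (g x)%:E = 0)%E ->
  ae_eq (@leb2 R) (box al be ga de) (EFin \o g) (cst 0%E).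
Proof.
set Q := box al be ga de => ig g0.
have mQ : measurable (Q : set (mR * mR)) := box_measurable al be ga de.
pose P (A : set (R * R)) := (\int[@leb2 R]_(x in Q `&` A) (g x)%:E = 0)%E.
have sub (A : set (mR * mR)) : measurable A -> L1 (Q `&` A) g.
  by move=> mA; apply: integrableS ig => //; exact: measurableI.
have PB a b c d : P (box a b c d).
  rewrite /P /Q boxI; apply: g0 => -[x y] [/=]; rewrite !in_itv/= !ge_max !le_min.
  by move=> /andP[/andP[-> _] /andP[-> _]] /andP[/andP[-> _] /andP[-> _]].
have PT : (\int[@leb2 R]_(x in Q) (g x)%:E = 0)%E by apply: g0.
have PA A : @measurable _ (mR * mR)%type A -> P A.
  rewrite box_sigma; apply: (@dynkin_induction _ (mR * mR)%type boxes P).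
  - exact: box_sigma.
  - exact: boxes_setI.
  - by rewrite /P setIT.
  - by move=> _ [a [b [c [d ->]]]]; exact: PB.
  - move=> S mS PS.
    have mQS := measurableI _ _ mQ mS; have mQC := measurableI _ _ mQ (measurableC mS).
    have : (\int[@leb2 R]_(x in Q) (g x)%:E = \int[@leb2 R]_(x in Q `&` S) (g x)%:E +
        \int[@leb2 R]_(x in Q `&` ~` S) (g x)%:E)%E.
      rewrite -integral_setU//.
      + by rewrite -setIUr setUv setIT.
      + by rewrite -setIUr setUv setIT; exact: measurable_int ig.
      + by apply/disj_setPS => x [[_ Sx] [_ nSx]].
    by rewrite PT [X in (X + _)%E]PS add0e => /esym.
  - move=> F mF tF PF; rewrite /P setI_bigcupr integral_bigcup//.
    + by rewrite eseries0// => i _ _; exact: PF.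
    + exact: trivIset_setIl.
    + by move=> k; exact: measurableI.
    + by rewrite -setI_bigcupr; apply: sub; exact: bigcupT_measurable.
apply: integral_ae_eq => // E EQ mE.
by rewrite integral0 -(setIidr EQ); exact: PA.
Qed.

Lemma test_box_integral0 U g al be ga de : open U ->
  L1 U g ->
  (forall phi, test_function U phi -> \int[leb2]_(x in U) (g x * phi x) = 0) ->
  `[al, be] `*` `[ga, de] `<=` U ->
  (\int[@leb2 R]_(x in box al be ga de) (g x)%:E = 0)%E.
Proof.
move=> oU ig g0 KU.
have mU : measurable (U : set (mR * mR)) := open_measurable2 oU.
have mB := box_measurable al be ga de.
have mg : measurable_fun (U : set (mR * mR)) g by apply/measurable_EFinP; exact: measurable_int ig.
have BU : box al be ga de `<=` U.
  move=> x /boxP[? ? ? ?]; apply: KU; split; rewrite /= in_itv/= !ltW//.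
pose f_ n (x : R * R) := (g x * box_bump al be ga de n x)%:E.
pose f (x : R * R) := (g x * \1_(box al be ga de) x)%:E.
have mbump n : measurable_fun (U : set (mR * mR)) (box_bump al be ga de n).
  apply: open_continuous_measurable2 => // x _.
  have [h _] := box_bump_test n KU; exact: Ck_continuous (h 0%N) x.
have mf_ n : measurable_fun (U : set (mR * mR)) (f_ n).
  by apply/measurable_EFinP; apply: measurable_funM.
have dom n x : U x -> (`|f_ n x| <= (abse \o (EFin \o g)) x)%E.
  move=> _; rewrite /f_ /= lee_fin normrM -[leRHS]mulr1 ler_wpM2l//.
  exact: box_bump_bound.
have [] := @dominated_convergence _ _ R (@leb2 R) U mU f_ f (abse \o (EFin \o g)).
- exact: mf_.
- apply/measurable_EFinP; apply: measurable_funM => //; exact: measurable_indic.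
- apply: aeW => x Ux; apply: cvg_EFin; first by apply: nearW.
  by apply: cvgM; [exact: cvg_cst|exact: box_bump_cvg].
- exact: integrable_abse.
- by apply: aeW => x n; exact: dom.
move=> if_ _ lim.
have z n : (\int[@leb2 R]_(x in U) f_ n x = 0)%E.
  have ifn : (@leb2 R).-integrable U (f_ n).
    apply: le_integrable (integrable_abse ig) => // x Ux.
    by rewrite [X in (_ <= X)%E]abse_id; exact: dom.
  rewrite -[LHS]fineK; last exact: integrable_fin_num.
  by have := g0 _ (box_bump_test n KU); rewrite /Rintegral => ->.
have {lim} lim : (\int[@leb2 R]_(x in U) f_ n x)%E @[n --> \oo] --> (\int[@leb2 R]_(x in U) f x)%E by exact: lim.
have f0 : (\int[@leb2 R]_(x in U) f x = 0)%E.
  have lim0 : (\int[@leb2 R]_(x in U) f_ n x)%E @[n --> \oo] --> (0 : \bar R)%E.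
    by rewrite (_ : (fun n => _) = fun=> 0%E); [exact: cvg_cst|exact/funext].
  exact: (cvg_unique (@ereal_hausdorff R) lim lim0).
rewrite -f0 -(setIidr BU) integral_mkcondr.
apply: eq_integral => x _; rewrite /f patchE indicE.
by case: ifPn; rewrite ?mulr1 ?mulr0.
Qed.

Lemma rational_box U (x : R * R) : open U -> U x ->
  exists q : (rat * rat) * (rat * rat),
    `[ratr q.1.1, ratr q.1.2] `*` `[ratr q.2.1, ratr q.2.2] `<=` U /\
    box (ratr q.1.1) (ratr q.1.2) (ratr q.2.1) (ratr q.2.2) x.
Proof.
case: x => x y oU Uxy.
have /nbhs_ballP[e /= e0 eU] : nbhs (x, y) U by exact: open_nbhs_nbhs.
have lt (t : R) : t - e < t by rewrite ltrBlDr ltrDl.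
have gt (t : R) : t < t + e by rewrite ltrDl.
have [q1 q1x] := rat_in_itvoo (lt x); have [q2 q2x] := rat_in_itvoo (gt x).
have [q3 q3y] := rat_in_itvoo (lt y); have [q4 q4y] := rat_in_itvoo (gt y).
move: q1x q2x q3y q4y; rewrite !in_itv /= => /andP[? ?] /andP[? ?] /andP[? ?] /andP[? ?].
exists ((q1, q2), (q3, q4)); split; last exact/boxP.
move=> -[x' y'] [/=]; rewrite !in_itv /= => /andP[? ?] /andP[? ?].
by apply: eU; split => /=; rewrite /ball/= ltr_norml; apply/andP; split; lra.
Qed.

(** Countably many boxes with rational corners and closure in [U] cover [U]. *)
Lemma test_orthogonal_ae0 U g : open U -> L1 U g ->
  (forall phi, test_function U phi -> \int[leb2]_(x in U) (g x * phi x) = 0) ->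
  {ae @leb2 R, forall x, U x -> g x = 0}.
Proof.
move=> oU ig g0.
pose Q (q : (rat * rat) * (rat * rat)) := box (ratr q.1.1 : R) (ratr q.1.2) (ratr q.2.1) (ratr q.2.2).
pose K (q : (rat * rat) * (rat * rat)) : set (R * R) :=
  `[ratr q.1.1, ratr q.1.2] `*` `[ratr q.2.1, ratr q.2.2].
pose N n : set (mR * mR) := if unpickle n is Some q then
  [set x | K q `<=` U /\ ~ (Q q x -> g x = 0)] else set0.
have nN n : (@leb2 R).-negligible (N n).
  rewrite /N; case: unpickle => [q|]; last exact: negligible_set0.
  have [KU|nKU] := pselect (K q `<=` U); last first.
    by apply: negligibleS (negligible_set0 (@leb2 R)) => x [].
  have QU : Q q `<=` U.
    by move=> x /boxP[? ? ? ?]; apply: KU; split; rewrite /= in_itv/= !ltW.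
  have iQ : L1 (Q q) g.
    by apply: integrableS ig => //; [exact: open_measurable2|exact: box_measurable].
  have ae : ae_eq (@leb2 R) (Q q) (EFin \o g) (cst 0%E).
    apply: box_ae_eq0 => // a b c d abcd.
    by apply: test_box_integral0 ig g0 _ => // x /abcd /KU.
  have [M [mM M0 subM]] := ae.
  exists M; split => // x [_ nx]; apply: subM => /= hx; apply: nx => Qx.
  by have [] := hx Qx.
apply: (negligibleS _ (negligible_bigcup nN)) => x /= nx.
have Ux : U x by apply: contrapT => nU; apply: nx.
have [q [KU Qx]] := rational_box oU Ux.
exists (pickle q); first exact: I.
by rewrite /N pickleK; split; [exact: KU|move=> hx; apply: nx => _; exact: hx].
Qed.

End FundamentalLemma.

(** * C^1 functions as Sobolev functions *)

Section ClassicalDerivatives.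
Context {R : realType} (a b : R) (a0 : 0 < a) (b0 : 0 < b).
Notation mu := (@lebesgue_measure R).
Notation ctri := (ctri a b).
Notation ccont := (conton ctri).
Notation tri := (tri a b).
Let mT : measurable (tri : set (plane R)) := measurable_tri a b.

Lemma param_notin_tri s t : ~ tri (param a b s t).
Proof.
case: s => -[/= p q]; rewrite ?ltxx// in p q *.
by rewrite !mulfK ?gt_eqF// subrK ltxx.
Qed.

Lemma test_side0 phi s t : test_function tri phi -> phi (param a b s t) = 0.
Proof. by move=> [_ [K [_ Kt K0]]]; apply: K0 => /Kt; exact: param_notin_tri. Qed.

(** Applied to [f * phi] with [phi] a test function, this is integration by
    parts without boundary term. *)
Lemma side_vanish_green (F F1 F2 : R * R -> R) : C1on ctri F F1 F2 ->
  (forall s t, F (param a b s t) = 0) ->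
  \int[leb2]_(x in tri) F1 x = 0 /\ \int[leb2]_(x in tri) F2 x = 0.
Proof.
move=> [cF cF1 cF2 d1 d2] F0.
have z s : \int[mu]_(t in `[0, 1]) F (param a b s t) = 0.
  by under eq_Rintegral do rewrite F0; exact: Rintegral01_cst.
by rewrite (green1 a0 b0 cF cF1 d1) (green2 a0 b0 cF cF2 d2) !z subrr !mulr0.
Qed.

Lemma Ck1_real_weak_deriv f j : Ck 1 f -> real_weak_deriv tri j f (pd j f).
Proof.
move=> hf phi tphi; have hp : Ck 1 phi by case: tphi.
have cM := C1onM (Ck1_C1on ctri hf) (Ck1_C1on ctri hp).
have [_ c1 c2 _ _] := cM.
have [z1 z2] : _ /\ _ := side_vanish_green cM (fun s t => etrans (congr1 _ (test_side0 s t tphi)) (mulr0 _)).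
have cc h : continuous h -> ccont h by move=> ch x _; exact: ch.
have cf := cc _ (Ck1_continuous hf); have cp := cc _ (Ck1_continuous hp).
have i1 := ccont_integrable a0 b0 (ccontM cf (cc _ (@Ck1_pd_continuous _ _ j hp))).
have i2 := ccont_integrable a0 b0 (ccontM cp (cc _ (@Ck1_pd_continuous _ _ j hf))).
have z : \int[leb2]_(x in tri) (f x * pd j phi x + phi x * pd j f x) = 0 by case: (j).
apply/eqP; rewrite -addr_eq0; apply/eqP; rewrite -[RHS]z RintegralD//; congr (_ + _).
by apply: eq_Rintegral => x _; rewrite mulrC.
Qed.

Lemma csqint_inL2 (u : R * R -> R[i]) : csqint (@leb2 R) tri u -> inL2 tri u.
Proof. by move=> hu; exact: csqint_elim. Qed.

Lemma cC1_weak_deriv u j : cC1 u -> weak_deriv tri j u (cderiv j u).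
Proof.
move=> hu; split; first by apply: csqint_inL2; exact: csqint_cderiv.
- exact: Ck1_real_weak_deriv hu.1.
- exact: Ck1_real_weak_deriv hu.2.
Qed.

Lemma cC1_W12 u : cC1 u -> W12 tri u.
Proof.
move=> hu; split; first by apply: csqint_inL2; exact: csqint_cC1.
by move=> j; exists (cderiv j u); exact: cC1_weak_deriv.
Qed.

Lemma weak_deriv_unique j u w w' : weak_deriv tri j u w -> weak_deriv tri j u w' ->
  {ae @leb2 R, forall x, tri x -> w x = w' x}.
Proof.
move=> [hw w1 w2] [hw' w1' w2'].
have s1 := inL2_csqint hw; have s2 := inL2_csqint hw'.
have sB := csqintB mT s1 s2.
have P i : {ae @leb2 R, forall x, tri x -> cpart i (w x - w' x) = 0}.
  have one : sqint (@leb2 R) tri (fun=> 1) by apply: ccont_sqint => //; exact: ccont_cst.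
  apply: test_orthogonal_ae0; first exact: open_tri.
    by have := sqint_mul mT (sB i) one; apply: eq_integrable => // x _ /=; rewrite mulr1.
  move=> phi tphi.
  have sp : sqint (@leb2 R) tri phi.
    by apply: ccont_sqint => // x _; have [/(_ 0%N) h _] := tphi; exact: Ck_continuous h x.
  rewrite (_ : \int[leb2]_(x in tri) _ = \int[leb2]_(x in tri) (cpart i (w x) * phi x - cpart i (w' x) * phi x)); last first.
    by apply: eq_Rintegral => x _; rewrite cpartB mulrBl.
  rewrite RintegralB//; [|exact: sqint_mul|exact: sqint_mul].
  apply/eqP; rewrite subr_eq0; apply/eqP; apply: oppr_inj.
  by case: (i); [rewrite -[LHS]w2// -[RHS]w2'|rewrite -[LHS]w1// -[RHS]w1'].
apply: (@filterS2 _ _ (ae_filter_ringOfSetsType (@leb2 R)) _ _ _ _ (P false) (P true)) => x h1 h2 tx.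
have {h1} := h1 tx; have {h2} := h2 tx.
by case: (w x) (w' x) => ? ? [? ?]; rewrite /cpart /= => /subr0_eq -> /subr0_eq ->.
Qed.

Lemma cC1_wderiv_ae u j : cC1 u ->
  {ae @leb2 R, forall x, tri x -> wderiv tri j u x = cderiv j u x}.
Proof.
move=> hu; apply: weak_deriv_unique (cC1_weak_deriv j hu).
exact: wderivP (cC1_W12 hu).
Qed.

(** The constant sequence is an approximation; uniqueness of the weak derivative
    makes the gradients agree. *)
Lemma cC1_trace u : cC1 u -> is_trace a b u u.
Proof.
move=> hu; split; first by move=> s; apply: csqint_elim => //; exact: csqint_cC1_side.
have sq0 : sqmod (0 : R[i]) = 0 :> R by rewrite /sqmod /= expr0n/= addr0.
have uu x : sqmod ((u - u) x) = 0 :> R by rewrite /= subrr sq0.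
exists (fun=> u); split => //.
- rewrite (_ : (fun n => _) = fun=> 0); first exact: cvg_cst.
  apply/funext => _; rewrite /normL2sq; under eq_Rintegral do rewrite uu.
  by rewrite Rintegral_cst// mul0r.
- move=> j; rewrite (_ : (fun n => _) = fun=> 0); first exact: cvg_cst.
  apply/funext => _; rewrite /normL2sq /Rintegral.
  have hw : csqint (@leb2 R) tri (wderiv tri j u).
    by have [h _ _] := wderivP j (cC1_W12 hu); exact: inL2_csqint.
  have mi := csqint_sqmod mT (csqintB mT (csqint_cderiv a0 b0 j hu) hw).
  transitivity (fine (\int[@leb2 R]_(x in tri) (cst 0 x))%E); last by rewrite integral0.
  congr fine; apply: ae_eq_integral => //; first exact: measurable_int mi.
  apply: (@filterS _ _ (ae_filter_ringOfSetsType (@leb2 R)) _ _ _ (cC1_wderiv_ae j hu)) => x h tx.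
  have e : (cderiv j u - wderiv tri j u) x = 0.
    by rewrite -[LHS]/(cderiv j u x - wderiv tri j u x) h// subrr.
  by rewrite e sq0.
- rewrite (_ : (fun n => _) = fun=> 0); first exact: cvg_cst.
  apply/funext => _; rewrite /normL2sq_bd big1// => s _.
  under eq_Rintegral do rewrite uu.
  by rewrite Rintegral01_cst mulr0.
Qed.

End ClassicalDerivatives.

(** * The trial function on the isosceles triangle *)

Section DirichletTrial.
Context {R : realType} (a b : R) (a0 : 0 < a) (b0 : 0 < b).
Notation ctri := (ctri a b).
Notation ccont := (conton ctri).
Notation tri := (tri a b).
Implicit Types (f : R * R -> R).
Let mT : measurable (tri : set (plane R)) := measurable_tri a b.

Lemma dcst0 j (x : R * R) : 'D_(dir j) (fun _ : R * R => 0 : R) x = 0.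
Proof. by apply: derive_val; exact: is_derive_cst. Qed.

Lemma cderiv_real f j x : cderiv j (fun y => (f y)%:C%C) x = (pd j f x)%:C%C.
Proof. by rewrite /cderiv /= dcst0. Qed.

Lemma cC1_real f : Ck 1 f -> cC1 (fun x => (f x)%:C%C).
Proof. by move=> hf; split; [exact: hf|exact: (Ck_cst 1 0)]. Qed.

Lemma dirac_real_scalar (m p p1 p2 : R) :
  sqmod (m%:C%C * p%:C%C - 'i%C * (0 - 'i%C * 0)) = m ^+ 2 * p ^+ 2 /\
  sqmod (- 'i%C * (p1%:C%C + 'i%C * p2%:C%C) - m%:C%C * 0) = p1 ^+ 2 + p2 ^+ 2.
Proof. by simpc; rewrite /sqmod /=; split; ring. Qed.

(** With second component 0 the boundary condition becomes the Dirichlet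
    condition on the first component, and for a real function the operator
    [d1 + i d2] has the modulus of the gradient. *)
Lemma dirichlet_quotient (m : R) f : Ck 1 f -> (forall s t, f (param a b s t) = 0) ->
  \int[leb2]_(x in tri) (f x ^+ 2) != 0 ->
  rayleigh_quotients m a b
   (m ^+ 2 + (\int[leb2]_(x in tri) (pd false f x ^+ 2 + pd true f x ^+ 2)) / \int[leb2]_(x in tri) (f x ^+ 2)).
Proof.
move=> hf f0 n0.
pose u : R * R -> R[i] := fun x => (f x)%:C%C.
pose v : R * R -> R[i] := fun x => (0 : R)%:C%C.
have cu : cC1 u := cC1_real hf.
have cv : cC1 v := cC1_real (Ck_cst 1 0).
have cc h : continuous h -> ccont h by move=> ch x _; exact: ch.
have nE : spinor_normsq a b (u, v) = \int[leb2]_(x in tri) (f x ^+ 2).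
  rewrite /spinor_normsq /normL2sq /=.
  have -> : \int[leb2]_(x in tri) sqmod (v x) = 0.
    rewrite -[RHS](mul0r (fine (@leb2 R tri))) -Rintegral_cst//; apply: eq_Rintegral => x _.
    by rewrite /sqmod /= expr0n/= addr0.
  by rewrite addr0; apply: eq_Rintegral => x _; rewrite /sqmod /= expr0n/= addr0.
exists (u, v); split; last 1 first.
- rewrite nE -[X in X + _](mulfK n0) -mulrDl; congr (_ / _).
  have [s1 s2] := csqint_dirac (a := a) (b := b) m (psi := (u, v)) (cC1_W12 a0 b0 cu) (cC1_W12 a0 b0 cv).
  rewrite /spinor_normsq.
  have du j := cC1_wderiv_ae a0 b0 j cu; have dv j := cC1_wderiv_ae a0 b0 j cv.
  have c2 j : ccont (fun x => pd j f x ^+ 2) by apply: ccontX; apply: cc; exact: Ck1_pd_continuous.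
  have ig := ccont_integrable a0 b0 (ccontD (c2 false) (c2 true)).
  have cf := cc _ (Ck1_continuous hf).
  have if2 := ccont_integrable a0 b0 (ccontM (@ccont_cst _ ctri (m ^+ 2)) (@ccontX _ ctri _ 2 cf)).
  congr (_ + _); last first.
    rewrite /normL2sq; congr fine; apply/esym.
    apply: ae_eq_integral => //; [exact: measurable_int (csqint_sqmod mT s2)|exact: measurable_int ig|].
    apply: (@filterS2 _ _ (ae_filter_ringOfSetsType (@leb2 R)) _ _ _ _ (du false) (du true)) => x h1 h2 tx.
    congr EFin; rewrite /dirac_op /= [LHS](_ : _ = sqmod (- 'i%C * (wderiv tri false u x + 'i%C * wderiv tri true u x) - m%:C%C * 0))//.
    rewrite h1// h2// !cderiv_real.
    by have [_ ->] := dirac_real_scalar m 0 (pd false f x) (pd true f x).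
  have if0 := ccont_integrable a0 b0 (@ccontX _ ctri _ 2 cf).
  rewrite -RintegralZl//.
  rewrite /normL2sq; congr fine; apply/esym.
  apply: ae_eq_integral => //; [exact: measurable_int (csqint_sqmod mT s1)|exact: measurable_int if2|].
  apply: (@filterS2 _ _ (ae_filter_ringOfSetsType (@leb2 R)) _ _ _ _ (dv false) (dv true)) => x h1 h2 tx.
  congr EFin; rewrite /dirac_op /= [LHS](_ : _ = sqmod (m%:C%C * (f x)%:C%C - 'i%C * (wderiv tri false v x - 'i%C * wderiv tri true v x)))//.
  rewrite h1// h2// !cderiv_real /pd !dcst0.
  by have [-> _] := dirac_real_scalar m (f x) 0 0.
- by split; [exact: cC1_W12|exact: cC1_W12|exists u, v; split; [exact: cC1_trace|exact: cC1_trace|];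
    move=> s; apply: aeW => t _; rewrite /u /v f0 mulr0].
- by rewrite nE.
Qed.

End DirichletTrial.

Section TrialFunction.
Context {R : realType} (k : R) (k0 : 0 < k).
Notation ctri := (ctri k k).
Notation ccont := (conton ctri).
Notation tri := (tri k k).
Let mT : measurable (tri : set (plane R)) := measurable_tri k k.
Let c : R := pi / k.

(** Antisymmetrising with respect to the hypotenuse of a Dirichlet eigenfunction of
    the square of side [k]: the reflection exchanges the two products up to
    sign. *)
Definition trial (x : R * R) : R :=
  sin (c * x.1) * sin (2 * c * x.2) + sin (2 * c * x.1) * sin (c * x.2).
Definition trial1 (x : R * R) : R :=
  c * cos (c * x.1) * sin (2 * c * x.2) + 2 * c * cos (2 * c * x.1) * sin (c * x.2).
Definition trial2 (x : R * R) : R :=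
  2 * c * sin (c * x.1) * cos (2 * c * x.2) + c * sin (2 * c * x.1) * cos (c * x.2).
Definition trial11 (x : R * R) : R :=
  - c ^+ 2 * sin (c * x.1) * sin (2 * c * x.2) - 4 * c ^+ 2 * sin (2 * c * x.1) * sin (c * x.2).
Definition trial22 (x : R * R) : R :=
  - 4 * c ^+ 2 * sin (c * x.1) * sin (2 * c * x.2) - c ^+ 2 * sin (2 * c * x.1) * sin (c * x.2).

Lemma is_derive_sinM (p t : R) : is_derive t 1 (fun t => sin (p * t)) (p * cos (p * t)).
Proof.
have d : is_derive t 1 (fun t : R => p * t) p.
  by apply: (der_eq (derM (is_derive_cst p t 1) (is_derive_id t 1))) => //; rewrite mulr1 mulr0 addr0.
have := @is_derive1_comp R (@sin R) (fun t => p * t) t _ _ (is_derive_sin (p * t)) d.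
by rewrite mulrC.
Qed.

Lemma is_derive_cosM (p t : R) : is_derive t 1 (fun t => cos (p * t)) (- (p * sin (p * t))).
Proof.
have d : is_derive t 1 (fun t : R => p * t) p.
  by apply: (der_eq (derM (is_derive_cst p t 1) (is_derive_id t 1))) => //; rewrite mulr1 mulr0 addr0.
have := @is_derive1_comp R (@cos R) (fun t => p * t) t _ _ (is_derive_cos (p * t)) d.
by rewrite mulNr mulrC.
Qed.

Lemma der_lin2 (f g : R -> R) (A B df dg t : R) : is_derive t 1 f df -> is_derive t 1 g dg ->
  is_derive t 1 (fun t => A * f t + B * g t) (A * df + B * dg).
Proof.
move=> hf hg; apply: (der_eq (derD (derM (is_derive_cst A t 1) hf) (derM (is_derive_cst B t 1) hg))) => //.
by rewrite !mulr0 !addr0.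
Qed.

Lemma trial_derive1 x : is_derive x (dir false) trial (trial1 x).
Proof.
case: x => x y; apply/is_derive_dir1.
apply: (der_eq (der_lin2 (sin (2 * c * y)) (sin (c * y)) (is_derive_sinM c x) (is_derive_sinM (2 * c) x))).
  by move=> t; rewrite /trial /=; ring.
by rewrite /trial1 /=; ring.
Qed.

Lemma trial_derive2 x : is_derive x (dir true) trial (trial2 x).
Proof.
case: x => x y; apply/is_derive_dir2.
apply: (der_eq (der_lin2 (sin (c * x)) (sin (2 * c * x)) (is_derive_sinM (2 * c) y) (is_derive_sinM c y))).
  by move=> t; rewrite /trial /=; ring.
by rewrite /trial2 /=; ring.
Qed.

Lemma trial1_derive1 x : is_derive x (dir false) trial1 (trial11 x).
Proof.
case: x => x y; apply/is_derive_dir1.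
apply: (der_eq (der_lin2 (c * sin (2 * c * y)) (2 * c * sin (c * y)) (is_derive_cosM c x) (is_derive_cosM (2 * c) x))).
  by move=> t; rewrite /trial1 /=; ring.
by rewrite /trial11 /=; ring.
Qed.

Lemma trial2_derive2 x : is_derive x (dir true) trial2 (trial22 x).
Proof.
case: x => x y; apply/is_derive_dir2.
apply: (der_eq (der_lin2 (2 * c * sin (c * x)) (c * sin (2 * c * x)) (is_derive_cosM (2 * c) y) (is_derive_cosM c y))).
  by move=> t; rewrite /trial2 /=; ring.
by rewrite /trial22 /=; ring.
Qed.

Lemma continuous_sin_lin (p : R) : continuous (fun x : R * R => sin (p * x.1)) /\
  continuous (fun x : R * R => sin (p * x.2)).
Proof.
split=> x; apply: (@cvg_comp _ _ _ (fun x : R * R => _) (@sin R)); try exact: continuous_sin.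
- by apply: cvgM; [exact: cvg_cst|exact: cvg_fst].
- by apply: cvgM; [exact: cvg_cst|exact: cvg_snd].
Qed.

Lemma continuous_cos_lin (p : R) : continuous (fun x : R * R => cos (p * x.1)) /\
  continuous (fun x : R * R => cos (p * x.2)).
Proof.
split=> x; apply: (@cvg_comp _ _ _ (fun x : R * R => _) (@cos R)); try exact: continuous_cos.
- by apply: cvgM; [exact: cvg_cst|exact: cvg_fst].
- by apply: cvgM; [exact: cvg_cst|exact: cvg_snd].
Qed.

Lemma trial_continuous : [/\ continuous trial, continuous trial1, continuous trial2,
  continuous trial11 & continuous trial22].
Proof.
have S1 p x := (continuous_sin_lin p).1 x; have S2 p x := (continuous_sin_lin p).2 x.
have C1 p x := (continuous_cos_lin p).1 x; have C2 p x := (continuous_cos_lin p).2 x.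
have M (A : R) (f g : R * R -> R) x : {for x, continuous f} -> {for x, continuous g} ->
    {for x, continuous (fun y => A * f y * g y)}.
  by move=> hf hg; apply: cvgM => //; apply: cvgM => //; exact: cvg_cst.
split=> x; rewrite /trial /trial1 /trial2 /trial11 /trial22.
- by apply: cvgD; apply: cvgM; [exact: S1|exact: S2|exact: S1|exact: S2].
- by apply: cvgD; apply: M; [exact: C1|exact: S2|exact: C1|exact: S2].
- by apply: cvgD; apply: M; [exact: S1|exact: C2|exact: S1|exact: C2].
- by apply: cvgB; apply: M; [exact: S1|exact: S2|exact: S1|exact: S2].
- by apply: cvgB; apply: M; [exact: S1|exact: S2|exact: S1|exact: S2].
Qed.

Lemma trial_C1on : C1on setT trial trial1 trial2.
Proof.
have [h h1 h2 _ _] := trial_continuous.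
by split=> x _; [exact: h|exact: h1|exact: h2|exact: trial_derive1|exact: trial_derive2].
Qed.

Lemma trialE x : trial x =
  2 * sin (c * x.1) * sin (c * x.2) * (cos (c * x.1) + cos (c * x.2)).
Proof.
have dbl t : sin (2 * c * t) = 2 * (cos (c * t) * sin (c * t)).
  by rewrite -mulrA [2 * _]mulr_natl sin_mulr2n [RHS]mulr_natl.
rewrite /trial !dbl.
move: (sin (c * x.1)) (sin (c * x.2)) (cos (c * x.1)) (cos (c * x.2)) => p q r s.
by ring.
Qed.

Lemma trial_side0 s t : trial (param k k s t) = 0.
Proof.
rewrite trialE; case: s => /=; rewrite ?mulr0 ?sin0 ?(mulr0, mul0r)//.
have -> : c * ((1 - t) * k) = pi - c * (t * k).
  by rewrite /c mulrBl mul1r mulrBr mulfVK// gt_eqF.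
by rewrite cosB cospi sinpi mul0r addr0 mulN1r addNr mulr0.
Qed.

Lemma trial_gt0 x : tri x -> 0 < trial x.
Proof.
move=> [x0 y0 xy]; rewrite trialE.
have c0 : 0 < c by rewrite divr_gt0 ?pi_gt0.
have X0 : 0 < c * x.1 by rewrite mulr_gt0.
have Y0 : 0 < c * x.2 by rewrite mulr_gt0.
have XY : c * x.1 + c * x.2 < pi.
  have -> : c * x.1 + c * x.2 = pi * (x.1 / k + x.2 / k) by rewrite /c; ring.
  by rewrite -[ltRHS]mulr1 ltr_pM2l ?pi_gt0.
move: X0 Y0 XY; move: (c * x.1) (c * x.2) => X Y X0 Y0 XY.
have sX : 0 < sin X by apply: sin_gt0_pi; rewrite X0/=; lra.
have sY : 0 < sin Y by apply: sin_gt0_pi; rewrite Y0/=; lra.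
rewrite !mulr_gt0// -(opprK (cos Y)) subr_gt0.
have <- : cos (pi - Y) = - cos Y by rewrite cosB cospi sinpi mul0r addr0 mulN1r.
by rewrite ltr_cos ?in_itv/=; [lra|apply/andP; split; lra|apply/andP; split; lra].
Qed.

(** Green's formula for [trial * grad trial], together with
    [- (trial11 + trial22) = 5 c^2 trial]. *)
Lemma trial_energy :
  \int[leb2]_(x in tri) (pd false trial x ^+ 2 + pd true trial x ^+ 2) =
  5 * c ^+ 2 * \int[leb2]_(x in tri) (trial x ^+ 2).
Proof.
have [h h1 h2 h11 h22] := trial_continuous.
have cc g : continuous g -> ccont g by move=> ch x _; exact: ch.
have z (g : R * R -> R) s :
    \int[lebesgue_measure]_(t in `[0, 1]) (trial (param k k s t) * g (param k k s t)) = 0.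
  by under eq_Rintegral do rewrite trial_side0 mul0r; exact: Rintegral01_cst.
have G1 := ccontD (ccontM (cc _ h) (cc _ h11)) (ccontM (cc _ h1) (cc _ h1)).
have G2 := ccontD (ccontM (cc _ h) (cc _ h22)) (ccontM (cc _ h2) (cc _ h2)).
have I1 := green1 k0 k0 (ccontM (cc _ h) (cc _ h1)) G1
  (fun x _ => derM (trial_derive1 x) (trial1_derive1 x)).
have I2 := green2 k0 k0 (ccontM (cc _ h) (cc _ h2)) G2
  (fun x _ => derM (trial_derive2 x) (trial2_derive2 x)).
rewrite !z subrr mulr0 in I1; rewrite !z subrr mulr0 in I2.
have iG1 := ccont_integrable k0 k0 G1; have iG2 := ccont_integrable k0 k0 G2.
have iT := ccont_integrable k0 k0 (@ccontX _ ctri _ 2 (cc _ h)).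
have iD := integrableD mT iG1 iG2.
have [p1 p2] := C1on_pd trial_C1on.
have -> : \int[leb2]_(x in tri) (pd false trial x ^+ 2 + pd true trial x ^+ 2) =
   \int[leb2]_(x in tri) (trial x * trial11 x + trial1 x * trial1 x +
     (trial x * trial22 x + trial2 x * trial2 x) + 5 * c ^+ 2 * trial x ^+ 2).
  apply: eq_Rintegral => x _; rewrite p1 ?p2 ?inE//.
  have -> : trial11 x = - (5 * c ^+ 2 * trial x) - trial22 x by rewrite /trial11 /trial22 /trial; ring.
  by move: (trial x) (trial1 x) (trial2 x) (trial22 x) => *; ring.
rewrite RintegralD//.
- by rewrite RintegralD// [X in X + _ + _]I1 [X in _ + X + _]I2 !add0r RintegralZl.
- exact: (integrable_scale mT (5 * c ^+ 2) iT).
Qed.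

Lemma leb2_tri_gt0 : (0 < @leb2 R tri)%E.
Proof.
have k2 : 0 < k / 2 by rewrite divr_gt0.
have : (@leb2 R (box 0 (k / 2) 0 (k / 2)) <= @leb2 R tri)%E.
  apply: le_measure; rewrite ?inE; [exact: box_measurable|exact: mT|].
  move=> x /boxP[x0 x1 y0 y1]; split => //.
  by rewrite -mulrDl ltr_pdivrMr// mul1r; lra.
apply: lt_le_trans.
rewrite [X in (_ < X)%E](_ : _ = (@lebesgue_measure R `]0%R, (k / 2)%R[ * @lebesgue_measure R `]0%R, (k / 2)%R[)%E); last first.
  by apply: product_measure1E; exact: measurable_itv.
by rewrite lebesgue_measure_itv/= lte_fin k2 oppr0 adde0 mule_gt0.
Qed.

Lemma trial_neq0 : \int[leb2]_(x in tri) (trial x ^+ 2) != 0.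
Proof.
apply/eqP => z.
have [h _ _ _ _] := trial_continuous.
have ch : ccont trial by move=> x _; exact: h.
have iT := ccont_integrable k0 k0 (@ccontX _ ctri _ 2 ch).
have : ae_eq (@leb2 R) tri (EFin \o (fun x => trial x ^+ 2)) (cst 0%E).
  have [+ _] := ae_eq_integral_abs (@leb2 R) mT (measurable_int _ iT); apply.
  under eq_integral do rewrite /= ger0_norm ?sqr_ge0//.
  by rewrite -[LHS]fineK; [congr EFin|exact: integrable_fin_num iT].
move=> [N [mN N0 subN]].
have : (@leb2 R tri <= @leb2 R N)%E.
  apply: le_measure; [by apply: mem_set; exact: mT|by apply: mem_set|].
  move=> x tx; apply: subN => /(_ tx) [] /eqP; rewrite expf_eq0/= gt_eqF//.
  exact: trial_gt0.
by rewrite N0 leNgt leb2_tri_gt0.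
Qed.

Lemma trial_quotient (m : R) : rayleigh_quotients m k k (m ^+ 2 + 5 * (pi / k) ^+ 2).
Proof.
have := dirichlet_quotient k0 k0 m (C1on_Ck1 trial_C1on) trial_side0 trial_neq0.
by rewrite trial_energy mulfK ?trial_neq0.
Qed.

End TrialFunction.

(** * Comparison of the bounds *)

Section Comparison.
Context {R : realType}.
Implicit Types (a b k m q : R).

Lemma sqr_le (x y : R) : 0 <= x -> x <= y -> x ^+ 2 <= y ^+ 2.
Proof. by move=> x0 xy; rewrite ler_pXn2r ?nnegrE// (le_trans x0). Qed.

(** The left-hand side is the squared length of the sum of the outward normals of
    the long leg and of the hypotenuse. *)
Lemma thin_angle (l s : R) : 0 < s -> 9 * s <= l ->
  2 - 2 * (l / Num.sqrt (l ^+ 2 + s ^+ 2)) <= 9^-1 ^+ 2.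
Proof.
move=> s0 sl; have l0 : 0 < l by lra.
have D0 : 0 < l ^+ 2 + s ^+ 2 by rewrite addr_gt0// exprn_gt0.
set h := Num.sqrt _; have h0 : 0 < h by rewrite sqrtr_gt0.
have h2 : h ^+ 2 = l ^+ 2 + s ^+ 2 by rewrite sqr_sqrtr// ltW.
have hl : 161 * h <= 162 * l.
  have p1 : 0 <= 161 * h by lra.
  have p2 : 0 <= 162 * l by lra.
  rewrite -(@ler_pXn2r _ 2)//.
  rewrite !exprMn h2; have : (9 * s) ^+ 2 <= l ^+ 2 by apply: sqr_le => //; lra.
  rewrite exprMn; have := sqr_ge0 l; move: (l ^+ 2) (s ^+ 2) => L S; lra.
have : 161 / 162 <= l / h by rewrite ler_pdivlMr//; lra.
move: (l / h) => r; lra.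
Qed.

Lemma spinor_normsq_ge0 a b psi : 0 <= spinor_normsq a b psi.
Proof. by apply: addr_ge0; apply: Rintegral_ge0 => x _; exact: sqmod_ge0. Qed.

Lemma thin_lower_bound m a b q : 0 <= m -> 0 < a -> 0 < b ->
  9 * b <= a -> rayleigh_quotients m a b q -> m ^+ 2 + 544 / 475 / b ^+ 2 <= q.
Proof.
move=> m0 a0 b0 ba [psi [dom n0 ->]].
have npos : 0 < spinor_normsq a b psi.
  by rewrite lt_neqAle eq_sym n0 spinor_normsq_ge0.
rewrite ler_pdivlMr//; apply: (@dirac_lower_bound _ a b a0 b0 m psi OA AB true b) => //.
- by move=> x /(ctri_box a0 b0)[_]; rewrite /= in_itv/= => /andP[].
- move=> x [x0 y0 xy] /=.
  have : 0 <= b * (x.1 / a) by rewrite mulr_ge0 ?divr_ge0// ltW.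
  rewrite mulrBr mulr1; move: (b * _) => p; lra.
- have := thin_angle b0 ba; rewrite /cs /sn /=.
  have D0 : 0 < a ^+ 2 + b ^+ 2 by rewrite addr_gt0// exprn_gt0.
  set h := Num.sqrt _; have h0 : 0 < h by rewrite sqrtr_gt0.
  have : (a / h) ^+ 2 + (b / h) ^+ 2 = 1.
    by rewrite !exprMn -mulrDl exprVn sqr_sqrtr ?ltW// divff// gt_eqF.
  move: (a / h) (b / h) => p r pr; apply: le_trans.
  by rewrite (_ : _ + _ = 1 - 2 * p + (p ^+ 2 + r ^+ 2)); [rewrite pr; lra|ring].
Qed.

Lemma steep_lower_bound m a b q : 0 <= m -> 0 < a -> 0 < b ->
  9 * a <= b -> rayleigh_quotients m a b q -> m ^+ 2 + 544 / 475 / a ^+ 2 <= q.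
Proof.
move=> m0 a0 b0 ab [psi [dom n0 ->]].
have npos : 0 < spinor_normsq a b psi.
  by rewrite lt_neqAle eq_sym n0 spinor_normsq_ge0.
rewrite ler_pdivlMr//; apply: (@dirac_lower_bound _ a b a0 b0 m psi OB AB false a) => //.
- by move=> x /(ctri_box a0 b0)[+ _]; rewrite /= in_itv/= => /andP[].
- move=> x [x0 y0 xy] /=.
  have : 0 <= a * (x.2 / b) by rewrite mulr_ge0 ?divr_ge0// ltW.
  rewrite mulrBr mulr1; move: (a * _) => p; lra.
- have := thin_angle a0 ab; rewrite /cs /sn /= [b ^+ 2 + _]addrC.
  have D0 : 0 < a ^+ 2 + b ^+ 2 by rewrite addr_gt0// exprn_gt0.
  set h := Num.sqrt _; have h0 : 0 < h by rewrite sqrtr_gt0.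
  have : (a / h) ^+ 2 + (b / h) ^+ 2 = 1.
    by rewrite !exprMn -mulrDl exprVn sqr_sqrtr ?ltW// divff// gt_eqF.
  move: (a / h) (b / h) => p r pr; apply: le_trans.
  by rewrite (_ : _ + _ = 1 - 2 * r + (p ^+ 2 + r ^+ 2)); [rewrite pr; lra|ring].
Qed.

Lemma rayleigh_ge0 m a b q : rayleigh_quotients m a b q -> 0 <= q.
Proof.
by move=> [psi [_ _ ->]]; rewrite divr_ge0// spinor_normsq_ge0.
Qed.

(** [5 pi^2 < 80] because [pi < 4]. *)
Lemma square_upper_bound m k : 0 < k ->
  inf (rayleigh_quotients m k k) <= m ^+ 2 + 80 / k ^+ 2.
Proof.
move=> k0; apply: (@le_trans _ _ (m ^+ 2 + 5 * (pi / k) ^+ 2)).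
  by apply: ge_inf; [exists 0 => q; exact: rayleigh_ge0|exact: trial_quotient].
rewrite lerD2l exprMn exprVn mulrA ler_pM2r ?invr_gt0 ?exprn_gt0//.
have p4 : pi < 4 :> R by have := @pihalf_lt2 R; lra.
have := @pi_gt0 R; move: pi p4 => p p4 p0.
by have := sqr_le (ltW p0) (ltW p4); lra.
Qed.

Lemma inverse_square_le (s k : R) : 0 < s -> 9 * s <= k ->
  80 / k ^+ 2 <= 544 / 475 / s ^+ 2.
Proof.
move=> s0 sk; have k0 : 0 < k by lra.
rewrite ler_pdivrMr ?exprn_gt0// mulrAC ler_pdivlMr ?exprn_gt0//.
have : (9 * s) ^+ 2 <= k ^+ 2 by apply: sqr_le => //; lra.
rewrite exprMn; have := sqr_ge0 k; have := sqr_ge0 s.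
by move: (k ^+ 2) (s ^+ 2) => K S *; lra.
Qed.

Lemma comparison m (lambda1 : R -> R -> R) a b k : 0 <= m ->
  (forall a b, 0 < a -> 0 < b -> lowest_positive_eigenvalue m a b (lambda1 a b)) ->
  (forall a b, 0 < a -> 0 < b -> lambda1 a b ^+ 2 = inf (rayleigh_quotients m a b)) ->
  0 < a -> 0 < b ->
  (9 * b <= a /\ 9 * b <= k) \/ (9 * a <= b /\ 9 * a <= k) ->
  lambda1 k k <= lambda1 a b.
Proof.
move=> m0 low var a0 b0 thin.
have k0 : 0 < k by case: thin => -[? ?]; lra.
have [l0 _ _] := low _ _ a0 b0; have [l0' _ _] := low _ _ k0 k0.
rewrite -(@ler_pXn2r _ 2) ?nnegrE ?(ltW l0) ?(ltW l0')// (var k k k0 k0) (var a b a0 b0).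
have [psi [dom n0 _]] : eigenvalue_dirac m a b (lambda1 a b) by have [] := low _ _ a0 b0.
apply: (le_trans (square_upper_bound m k0)); apply: lb_le_inf.
  by exists (spinor_normsq a b (dirac_op m a b psi) / spinor_normsq a b psi), psi.
move=> q hq; case: thin => -[ratio short].
- by apply: le_trans (thin_lower_bound m0 a0 b0 ratio hq); rewrite lerD2l inverse_square_le.
- by apply: le_trans (steep_lower_bound m0 a0 b0 ratio hq); rewrite lerD2l inverse_square_le.
Qed.

End Comparison.

Local Close Scope classical_set_scope.

Theorem corollary1 (R : realType) (m : R) (hm : 0 <= m)
  (lambda1 : R -> R -> R)
  (lambda1_lowest : forall a b : R, 0 < a -> 0 < b ->
     lowest_positive_eigenvalue m a b (lambda1 a b))
  (lambda1_variational : forall a b : R, 0 < a -> 0 < b ->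
     lambda1 a b ^+ 2 = inf (rayleigh_quotients m a b)) :
  (forall a b k : R, 0 < a -> 0 < b -> 0 < k -> a * b = k ^+ 2 ->
     9 * k <= a \/ a <= k / 9 ->
     lambda1 k k <= lambda1 a b)
  /\
  (forall a b k : R, 0 < b -> 0 < k -> 0 < a -> a < (2 + Num.sqrt 2) * k ->
     a + b + Num.sqrt (a ^+ 2 + b ^+ 2) = (2 + Num.sqrt 2) * k ->
     7 / 2 * k <= a \/ a <= k / 9 ->
     lambda1 k k <= lambda1 a b).
Proof.
split=> [a b k a0 b0 k0 area|a b k b0 k0 a0 _ perim].
- case=> h; apply: (comparison hm lambda1_lowest lambda1_variational) => //; [left|right].
  + by split; nra.
  + by split; nra.
- have s0 : 0 <= Num.sqrt (2 : R) := sqrtr_ge0 2.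
  have q2 : Num.sqrt (2 : R) ^+ 2 = 2 by rewrite sqr_sqrtr.
  have s1 : 1 <= Num.sqrt (2 : R) by nra.
  have s2 : Num.sqrt (2 : R) <= 2 by nra.
  have hp : 0 <= a ^+ 2 + b ^+ 2 by rewrite addr_ge0// sqr_ge0.
  have ha : a <= Num.sqrt (a ^+ 2 + b ^+ 2).
    by rewrite -[leLHS](ger0_norm (ltW a0)) -sqrtr_sqr ler_wsqrtr// lerDl sqr_ge0.
  have hab : Num.sqrt (a ^+ 2 + b ^+ 2) <= a + b.
    rewrite -[leRHS](ger0_norm (ltW (addr_gt0 a0 b0))) -sqrtr_sqr ler_wsqrtr// sqrrD lerD2r lerDl.
    by rewrite mulrn_wge0// mulr_ge0// ltW.
  case=> h.
  + by exfalso; nra.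
  + apply: (comparison hm lambda1_lowest lambda1_variational) => //; right.
    by split; nra.
Qed.
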